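(* Let $a,q$ be fixed integers with $0<a<q$ and $\gcd(a,q)=1$. Then there exists a constant $C_q>0$, depending only on $q$, such that for all sufficiently large $T$, \[ \max_{\sqrt T\le t\le T}\left|\zeta\left(1+\mathrm{i}t,\tfrac aq\right)\right|\ \ge\ \mathrm{e}^{\gamma}\left(\log_2 T+\log_3 T\right)-C_q . \]
   Context: For $0<\alpha\le 1$, $\zeta(s,\alpha)$ denotes the Hurwitz zeta function: $\zeta(s,\alpha)=\sum_{n=0}^\infty (n+\alpha)^{-s}$ for $\operatorname{Re}(s)>1$, continued meromorphically to $\mathbb{C}$ with a unique simple pole at $s=1$ of residue $1$. Iterated logarithms: $\log_2 x=\log\log x$ and $\log_3 x=\log\log\log x$. $\gamma$ is the Euler–Mascheroni constant. *)

(* Defs.v *)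
From Stdlib Require Import Reals ZArith.
From Coquelicot Require Import Coquelicot.
Open Scope R_scope.

(* exp (x + iy) = e^x (cos y + i sin y); Coquelicot has no complex exponential. *)
Definition Cexp (z : C) : C :=
  (exp (Re z) * cos (Im z), exp (Re z) * sin (Im z)).

(* x ^ w = exp (w log x), meaningful for a real base x > 0. *)
Definition Rcpow (x : R) (w : C) : C := Cexp (w * RtoC (ln x))%C.

Definition holomorphic_at (f : C -> C) (s : C) : Prop :=
  @ex_derive C_AbsRing C_NormedModule f s.

(* [zeta] is the Hurwitz zeta function s |-> zeta(s, alpha): the sum of its
   Dirichlet series for Re s > 1, continued holomorphically to C \ {1}, with a
   simple pole of residue 1 at s = 1, i.e. (s - 1) zeta(s) -> 1 as s -> 1.
   By the identity theorem this determines [zeta] on C \ {1}; the value of the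
   Rocq function at the pole itself is irrelevant and left unconstrained. *)
Definition is_hurwitz_zeta (alpha : R) (zeta : C -> C) : Prop :=
  (forall s : C, 1 < Re s ->
     @is_series C_AbsRing C_NormedModule
       (fun n : nat => Rcpow (INR n + alpha) (- s)%C) (zeta s)) /\
  (forall s : C, s <> RtoC 1 -> holomorphic_at zeta s) /\
  filterlim (fun s : C => ((s - RtoC 1) * zeta s)%C)
    (locally' (RtoC 1)) (locally (RtoC 1)).

Definition euler_gamma : R :=
  real (Lim_seq (fun n : nat =>
    sum_n_m (fun k : nat => / INR k) 1 n - ln (INR n))).

(* Iterated logarithms, not logarithms to base 2 and 3. *)
Definition log2 (x : R) : R := ln (ln x).
Definition log3 (x : R) : R := ln (ln (ln x)).

Definition is_maximum (E : R -> Prop) (m : R) : Prop :=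
  E m /\ is_upper_bound E m.

(* Main.v *)
From HB Require Import structures.
From Stdlib Require Import Reals Lra ZArith.
From mathcomp Require Import all_boot zify.
From Coquelicot Require Import Coquelicot.
Require Import Defs.
Open Scope R_scope.
Set Implicit Arguments. Unset Strict Implicit. Unset Printing Implicit Defensive.

(** The large values are produced by the resonance method.

    Let k range over the positive integers congruent to a modulo q.  Comparing
    the Dirichlet series with an integral and letting the real part tend to 1
    gives, for t >= 1 and N >= t,
      Re (q^(-it) zeta(1 + it, a/q)) = q F(t) + O(1),
      F(t) = sum_(k <= qN) cos(t ln k) / k
    (lemma zeta_approx), so it suffices to make F(t) large for some t in
    [sqrt T, T].

    Put X = 2^J with J ln 2 = ln ln T + ln ln ln T + O(1), and let r be the
    completely multiplicative function with r(p) = 1 - p/X when p <= X does not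
    divide q, and r(p) = 0 for the other primes.  With R(t) the truncated
    Dirichlet series sum_(n <= M) r(n) n^(-it), compare the integrals of F |R|^2
    and of |R|^2 against the weight 1 - t/T on [0, T].  The cosine transform of
    that weight is a Fejer kernel, hence nonnegative: every term of the expanded
    first integral may be dropped, and keeping the pairs (m, kn) shows that the
    k-th term of F contributes r(k)/k times the second integral, up to a shorter
    truncation.  Thus the maximum of F is at least
    sum_(k <= qN) r(k)/k - O(1) (lemma resonance).  The range t < sqrt T is
    harmless because |R| <= prod_(p <= X) X/p = exp(O(X / ln X)) <= T^(1/8), by
    Chebyshev's bounds; this is what limits X to the order of ln T ln ln T.

    There remains q sum_k r(k)/k >= e^gamma ln X - O_q(1)
    (lemma smooth_progression), which has two ingredients.

    Mertens: sum_(p <= X) -ln(1 - 1/p) >= gamma + ln ln X - O(1 / ln X).  Its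
    increments over dyadic blocks are controlled by the first theorem of Mertens.
    The constant is found by comparing the Euler product of zeta(1 + d) for
    d -> 0 with sum_i z^i / i = -ln(1 - z), z = 2^(-d): if the partial sums over
    p <= 2^i stayed below the harmonic numbers plus ln ln 2 by a fixed amount,
    zeta(1 + d) would be smaller than 1/d (lemma mertens3).

    Equidistribution of the k among the classes coprime to q, without characters:
    for f of period q, mean 0 and supported on integers coprime to q, the sum of
    n^(-s) f(n) is bounded for s > 1 by partial summation.  Replacing the weight c
    of one prime by c' multiplies the supremum over x coprime to q of
    |sum_n w(n) f(nx)| by at most 1 + 2|c' - c| (lemma tsum_change_weight), and
    passing from the weights p^(-1-1/J) to r(p)/p costs a total change O(1)
    (lemma weight_distance).  The main term is then an Euler product. *)

(** * Finite sums and products of real numbers *)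

Lemma RplusA : associative Rplus. Proof. by move=> x y z; ring. Qed.
Lemma RplusC : commutative Rplus. Proof. by move=> x y; ring. Qed.
Lemma Rplus0l : left_id 0 Rplus. Proof. by move=> x; ring. Qed.
HB.instance Definition _ := Monoid.isComLaw.Build R 0 Rplus RplusA RplusC Rplus0l.
Lemma RmultA : associative Rmult. Proof. by move=> x y z; ring. Qed.
Lemma RmultC : commutative Rmult. Proof. by move=> x y; ring. Qed.
Lemma Rmult1l : left_id 1 Rmult. Proof. by move=> x; ring. Qed.
HB.instance Definition _ := Monoid.isComLaw.Build R 1 Rmult RmultA RmultC Rmult1l.
Lemma Rmult0l : left_zero 0 Rmult. Proof. by move=> x; ring. Qed.
Lemma Rmult0r : right_zero 0 Rmult. Proof. by move=> x; ring. Qed.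
HB.instance Definition _ := Monoid.isMulLaw.Build R 0 Rmult Rmult0l Rmult0r.
Lemma RmultDl : left_distributive Rmult Rplus. Proof. by move=> x y z; ring. Qed.
Lemma RmultDr : right_distributive Rmult Rplus. Proof. by move=> x y z; ring. Qed.
HB.instance Definition _ := Monoid.isAddLaw.Build R Rmult Rplus RmultDl RmultDr.

Notation "\rsum_ ( m <= i < n | P ) F" := (\big[Rplus/0]_(m <= i < n | P%B) F)
  (at level 41, F at level 41, i, m, n at level 50, format "\rsum_ ( m <= i < n | P )  F").
Notation "\rsum_ ( m <= i < n ) F" := (\big[Rplus/0]_(m <= i < n) F)
  (at level 41, F at level 41, i, m, n at level 50, format "\rsum_ ( m <= i < n )  F").
Notation "\rprod_ ( m <= i < n | P ) F" := (\big[Rmult/1]_(m <= i < n | P%B) F)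
  (at level 36, F at level 36, i, m, n at level 50, format "\rprod_ ( m <= i < n | P )  F").

Lemma INR_addn m n : INR (m + n)%N = INR m + INR n.
Proof. exact: plus_INR. Qed.
Lemma INR_muln m n : INR (m * n)%N = INR m * INR n.
Proof. exact: mult_INR. Qed.
Lemma INR_leq m n : (m <= n)%N -> INR m <= INR n.
Proof. by move=> /leP; exact: le_INR. Qed.
Lemma INR_ltn m n : (m < n)%N -> INR m < INR n.
Proof. by move=> /ltP; exact: lt_INR. Qed.
Lemma INR_gt0 n : (0 < n)%N -> 0 < INR n.
Proof. exact: (@INR_ltn 0). Qed.
Lemma INR_ge1 n : (0 < n)%N -> 1 <= INR n.
Proof. exact: (@INR_leq 1). Qed.
Lemma INR_expn m n : INR (m ^ n)%N = INR m ^ n.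
Proof. by elim: n => [//|n IH]; rewrite expnS INR_muln IH. Qed.
Lemma INR_pow2 n : INR (2 ^ n)%N = 2 ^ n.
Proof. by rewrite INR_expn. Qed.
Lemma ln_pow2 n : ln (INR (2 ^ n)%N) = INR n * ln 2.
Proof. by rewrite INR_pow2 ln_pow //; lra. Qed.
Lemma INR_prime_ge2 p : prime p -> 2 <= INR p.
Proof. by move=> /prime_gt1 /INR_leq. Qed.

Lemma rsum_le m n (P : pred nat) F G :
  (forall i, (m <= i < n)%N -> P i -> F i <= G i) ->
  \rsum_(m <= i < n | P i) F i <= \rsum_(m <= i < n | P i) G i.
Proof.
move=> H; rewrite big_nat_cond [X in _ <= X]big_nat_cond.
elim/big_ind2: _ => [|x1 x2 y1 y2|i /andP[]]; [lra|lra|exact: H].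
Qed.
Lemma rsum_ge0 m n (P : pred nat) F :
  (forall i, (m <= i < n)%N -> P i -> 0 <= F i) -> 0 <= \rsum_(m <= i < n | P i) F i.
Proof.
move=> H; rewrite big_nat_cond; elim/big_ind: _ => [|x y|i /andP[]]; [lra|lra|exact: H].
Qed.
Lemma rsum_scal c m n (P : pred nat) F :
  \rsum_(m <= i < n | P i) (c * F i) = c * (\rsum_(m <= i < n | P i) F i).
Proof. by rewrite big_distrr. Qed.
Lemma rsum_scalr c m n (P : pred nat) F :
  \rsum_(m <= i < n | P i) (F i * c) = (\rsum_(m <= i < n | P i) F i) * c.
Proof. by rewrite big_distrl. Qed.
Lemma rsum_add m n (P : pred nat) F G :
  \rsum_(m <= i < n | P i) (F i + G i) =
  (\rsum_(m <= i < n | P i) F i) + (\rsum_(m <= i < n | P i) G i).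
Proof. by rewrite big_split. Qed.
Lemma rsum_opp m n (P : pred nat) F :
  \rsum_(m <= i < n | P i) (- F i) = - (\rsum_(m <= i < n | P i) F i).
Proof.
rewrite (eq_bigr (fun i => (-1) * F i)) ?rsum_scal => [|i _]; lra.
Qed.
Lemma rsum_sub m n (P : pred nat) F G :
  \rsum_(m <= i < n | P i) (F i - G i) =
  (\rsum_(m <= i < n | P i) F i) - (\rsum_(m <= i < n | P i) G i).
Proof. by rewrite /Rminus rsum_add rsum_opp. Qed.
Lemma rsum_abs m n (P : pred nat) F :
  Rabs (\rsum_(m <= i < n | P i) F i) <= \rsum_(m <= i < n | P i) Rabs (F i).
Proof.
elim/big_ind2: _ => [|x1 x2 y1 y2 H1 H2|i _]; [rewrite Rabs_R0; lra| |lra].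
by apply: Rle_trans (Rabs_triang _ _) _; lra.
Qed.
Lemma rsum_sub_pred m n (P Q : pred nat) F :
  (forall i, P i -> Q i) -> (forall i, (m <= i < n)%N -> Q i -> 0 <= F i) ->
  \rsum_(m <= i < n | P i) F i <= \rsum_(m <= i < n | Q i) F i.
Proof.
move=> PQ H; rewrite big_mkcond [X in _ <= X]big_mkcond; apply: rsum_le => i hi _.
case: ifP => [/PQ ->|_]; first lra.
by case: ifP => // Qi; [exact: H|lra].
Qed.
Lemma rsum_cat m k n (P : pred nat) F : (m <= k)%N -> (k <= n)%N ->
  \rsum_(m <= i < n | P i) F i =
  (\rsum_(m <= i < k | P i) F i) + (\rsum_(k <= i < n | P i) F i).
Proof. exact: big_cat_nat. Qed.
Lemma rsum_recr m n F : (m <= n)%N ->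
  \rsum_(m <= i < n.+1) F i = (\rsum_(m <= i < n) F i) + F n.
Proof. by move=> h; rewrite big_nat_recr. Qed.
Lemma rsum_recr_cond m n (P : pred nat) F : (m <= n)%N ->
  \rsum_(m <= i < n.+1 | P i) F i =
  (\rsum_(m <= i < n | P i) F i) + (if P n then F n else 0).
Proof. by move=> h; rewrite big_mkcond big_nat_recr //= -big_mkcond. Qed.
Lemma rsum_telescope m n (F : nat -> R) : (m <= n)%N ->
  \rsum_(m <= i < n) (F i.+1 - F i) = F n - F m.
Proof.
elim: n => [|n IH]; first by rewrite leqn0 => /eqP ->; rewrite big_geq //; lra.
rewrite leq_eqVlt => /orP[/eqP ->|h]; first by rewrite big_geq //; lra.
by rewrite rsum_recr // IH //; lra.
Qed.
Lemma rsum_mono_range m n n' (P : pred nat) F : (n <= n')%N ->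
  (forall i, (m <= i < n')%N -> P i -> 0 <= F i) ->
  \rsum_(m <= i < n | P i) F i <= \rsum_(m <= i < n' | P i) F i.
Proof.
move=> h H; case: (leqP m n) => hm; last first.
  by rewrite big_geq 1?ltnW //; apply: rsum_ge0.
rewrite (@rsum_cat m n n') //.
suff: 0 <= \rsum_(n <= i < n' | P i) F i by lra.
by apply: rsum_ge0 => i /andP[h1 h2]; apply: H; rewrite h2 (leq_trans hm).
Qed.
Lemma rsum_const m n c : \rsum_(m <= i < n) c = INR (n - m) * c.
Proof.
rewrite big_const_nat; elim: (n - m)%N => [|k IH] /=; first by lra.
by rewrite IH; case: k {IH} => [|k] /=; lra.
Qed.

Lemma rprod_gt0 m n (P : pred nat) F :
  (forall i, (m <= i < n)%N -> P i -> 0 < F i) -> 0 < \rprod_(m <= i < n | P i) F i.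
Proof.
move=> H; rewrite big_nat_cond.
elim/big_ind: _ => [|x y|i /andP[]]; [lra|exact: Rmult_lt_0_compat|exact: H].
Qed.
Lemma rprod_exp m n (P : pred nat) F :
  \rprod_(m <= i < n | P i) exp (F i) = exp (\rsum_(m <= i < n | P i) F i).
Proof.
by elim/big_ind2: _ => [|x1 x2 y1 y2 -> ->|//]; rewrite ?exp_0 // exp_plus.
Qed.
Lemma rprod_le m n (P : pred nat) F G :
  (forall i, (m <= i < n)%N -> P i -> 0 <= F i <= G i) ->
  0 <= \rprod_(m <= i < n | P i) F i <= \rprod_(m <= i < n | P i) G i.
Proof.
move=> H; rewrite big_nat_cond [X in _ <= _ <= X]big_nat_cond.
elim/big_ind2: _ => [|x1 x2 y1 y2 [? ?] [? ?]|i /andP[]]; [lra| |exact: H].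
by split; [exact: Rmult_le_pos|apply: Rmult_le_compat].
Qed.

(** * Completely multiplicative weights and their sums *)

(** The completely multiplicative function with prescribed values at primes. *)
Definition cmext (w : nat -> R) (n : nat) : R :=
  \rprod_(0 <= p < n.+1 | prime p) (w p ^ logn p n).

Lemma cmext_widen w n N : (n <= N)%N ->
  cmext w n = \rprod_(0 <= p < N.+1 | prime p) (w p ^ logn p n).
Proof.
move=> h; rewrite /cmext (@big_cat_nat _ _ _ n.+1 0 N.+1) //=.
rewrite [X in _ = _ * X]big_nat_cond [X in _ = _ * X]big1 ?Rmult_1_r // => p /andP[/andP[hp _] _].
by rewrite ltn_log0.
Qed.

Lemma cmext1 w : cmext w 1 = 1.
Proof. by rewrite /cmext big_mkcond big_nat_recr //= big_nat1 /= Rmult_1_r. Qed.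

Lemma cmextM w m n : (0 < m)%N -> (0 < n)%N -> cmext w (m * n)%N = cmext w m * cmext w n.
Proof.
move=> hm hn.
rewrite (@cmext_widen w m (m * n)%N) ?leq_pmulr // (@cmext_widen w n (m * n)%N) ?leq_pmull //.
rewrite /cmext -big_split /=; apply: eq_bigr => p _.
by rewrite lognM // pow_add.
Qed.

Lemma cmext_prime w p : prime p -> cmext w p = w p.
Proof.
move=> hp; rewrite /cmext big_mkcond big_nat_recr //= hp logn_prime // eqxx /= Rmult_1_r.
rewrite big_nat_cond big1 ?Rmult_1_l // => i /andP[/andP[_ hi] _].
by rewrite logn_prime //; case: eqP hi => [->|_ _]; rewrite ?ltnn //=; case: ifP.
Qed.

Lemma cmext_eq w w' n : (0 < n)%N ->
  (forall p, prime p -> p %| n -> w p = w' p) -> cmext w n = cmext w' n.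
Proof.
move=> hn H; apply: eq_bigr => p hp.
case: (boolP (p %| n)) => [/H ->//|hpn].
by rewrite lognE hp hn (negbTE hpn).
Qed.

Lemma prime_ind (P : nat -> Prop) : P 1%N ->
  (forall p n, prime p -> (0 < n)%N -> P n -> P (p * n)%N) -> forall n, (0 < n)%N -> P n.
Proof.
move=> P1 IH; elim/ltn_ind => n H hn.
case: (leqP n 1) => h1; first by have -> : n = 1%N by lia.
have hp := pdiv_prime h1; have /dvdnP[m e] := pdiv_dvd n.
have p2 := prime_gt1 hp; have hm : (0 < m)%N by case: m e => [|m] // e; move: hn; rewrite e.
by rewrite e mulnC; apply: IH => //; apply: H => //; rewrite [X in (_ < X)%N]e ltn_Pmulr.
Qed.

Lemma cmext_id (c : nat -> R) : c 1%N = 1 ->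
  (forall m n, (0 < m)%N -> (0 < n)%N -> c (m * n)%N = c m * c n) ->
  forall n, (0 < n)%N -> cmext c n = c n.
Proof.
move=> c1 mertens_const; apply: prime_ind => [|p n hp hn IH]; first by rewrite cmext1.
have p0 := prime_gt0 hp; by rewrite cmextM // mertens_const // cmext_prime // IH.
Qed.

Lemma cmext_mul u v n : cmext (fun p => u p * v p) n = cmext u n * cmext v n.
Proof. by rewrite /cmext -big_split; apply: eq_bigr => p _; rewrite Rpow_mult_distr. Qed.

Lemma cmext_inv n : (0 < n)%N -> cmext (fun p => / INR p) n = / INR n.
Proof.
apply: cmext_id => [|m k hm hk]; first by rewrite /= Rinv_1.
by rewrite INR_muln Rinv_mult.
Qed.

Lemma cmext_Rpower s n : (0 < n)%N -> cmext (fun p => Rpower (INR p) s) n = Rpower (INR n) s.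
Proof.
apply: (@cmext_id (fun p => Rpower (INR p) s)) => [|m k hm hk].
  by rewrite /Rpower ln_1 Rmult_0_r exp_0.
by rewrite INR_muln Rpower_mult_distr //; exact: INR_gt0.
Qed.

Lemma cmext_ge0 w n : (forall p, 0 <= w p) -> 0 <= cmext w n.
Proof.
move=> H; apply: (big_ind (fun x => 0 <= x)) => [|x y|p _];
  [lra|exact: Rmult_le_pos|exact: pow_le].
Qed.

Lemma cmext_eq0 w n p : (0 < n)%N -> prime p -> p %| n -> w p = 0 -> cmext w n = 0.
Proof.
move=> hn hp /dvdnP[m e] w0; have hm : (0 < m)%N.
  by rewrite lt0n; apply/eqP => m0; move: hn; rewrite e m0.
have p0 := prime_gt0 hp.
by rewrite e cmextM // (cmext_prime w hp) w0 Rmult_0_r.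
Qed.

Definition upd (w : nat -> R) p c x : R := if x == p then c else w x.

(** The integers divisible by p are split off; this one recursion gives both the
    Euler product and the comparison of two weights that differ at p. *)
Lemma cmext_upd w p c n : (0 < n)%N -> prime p ->
  cmext (upd w p c) n = cmext (upd w p 0) n +
    (if p %| n then c * cmext (upd w p c) (n %/ p) else 0).
Proof.
move=> hn hp; case: ifP => [hpn|/negbT hpn].
  rewrite [X in X + _](@cmext_eq0 _ _ p) //; last by rewrite /upd eqxx.
  have p0 := prime_gt0 hp.
  have n0 : (0 < n %/ p)%N by rewrite divn_gt0 // dvdn_leq.
  by rewrite Rplus_0_l -{1}(divnK hpn) mulnC cmextM // (cmext_prime _ hp) {1}/upd eqxx.
rewrite Rplus_0_r; apply: cmext_eq => // r _ hr; rewrite /upd.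
by case: eqP => // e; move: hpn; rewrite -e hr.
Qed.

Definition psum (w : nat -> R) (f : nat -> R) N := \rsum_(1 <= k < N.+1) (cmext w k * f k).

Lemma rsum_dvd p N (g : nat -> R) : (0 < p)%N ->
  \rsum_(1 <= k < N.+1) (if p %| k then g (k %/ p) else 0) =
  \rsum_(1 <= j < (N %/ p).+1) g j.
Proof.
move=> hp; elim: N => [|N IH]; first by rewrite div0n !big_geq.
rewrite rsum_recr // IH divnS //; case: (boolP (p %| N.+1)) => h.
  by rewrite add1n [in RHS]rsum_recr.
by rewrite Rplus_0_r.
Qed.

Lemma psum_upd w p c f N : prime p ->
  psum (upd w p c) f N = psum (upd w p 0) f N + c * psum (upd w p c) (fun k =>
    f (p * k)%N) (N %/ p).
Proof.
move=> hp; rewrite /psum -rsum_scal -(@rsum_dvd p N (fun j =>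
  c * (cmext (upd w p c) j * f (p * j)%N))) ?prime_gt0 //.
rewrite -rsum_add; rewrite big_nat_cond [RHS]big_nat_cond.
apply: eq_bigr => k /andP[/andP[hk _] _].
rewrite (@cmext_upd w p c k) //; case: ifP => hpk; last lra.
by rewrite [(p * (k %/ p))%N]mulnC (divnK hpk); lra.
Qed.

Definition admissible (w : nat -> R) Y :=
  (forall p, 0 <= w p < 1) /\ (forall p, (Y <= p)%N -> w p = 0).

Lemma psum_eq w w' f f' N : (forall p, prime p -> w p = w' p) ->
  (forall k, (0 < k)%N -> f k = f' k) -> psum w f N = psum w' f' N.
Proof.
move=> Hw Hf; rewrite /psum big_nat_cond [RHS]big_nat_cond.
apply: eq_bigr => k /andP[/andP[hk _] _]; rewrite Hf //; congr (_ * _).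
by apply: cmext_eq => // p /Hw.
Qed.

Definition euler_prod (w : nat -> R) Y := \rprod_(0 <= p < Y | prime p) / (1 - w p).

Lemma euler_prod_recr w Y : euler_prod w Y.+1 = euler_prod w Y * (if prime Y then / (1 - w Y)
  else 1).
Proof. by rewrite /euler_prod big_mkcond big_nat_recr //= -big_mkcond. Qed.

Lemma upd_id w p : forall x, upd (upd w p 0) p (w p) x = w x.
Proof. by move=> x; rewrite /upd; case: eqP => // ->. Qed.

Lemma admissible_pred w Y : admissible w Y.+1 -> admissible (upd w Y 0) Y.
Proof.
move=> [H1 H2]; split=> p; rewrite /upd; case: eqP => //; try lra.
by move=> hp hY; apply: H2; lia.
Qed.

Lemma psum1_mono w f N N' : (forall p, 0 <= w p) -> (forall k, 0 <= f k) -> (N <= N')%N ->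
  psum w f N <= psum w f N'.
Proof.
move=> H Hf h; apply: rsum_mono_range => // k _ _.
by apply: Rmult_le_pos => //; apply: cmext_ge0.
Qed.

Lemma euler_prod_eq w w' Y : (forall p, (p < Y)%N -> prime p -> w p = w' p) ->
  euler_prod w Y = euler_prod w' Y.
Proof.
move=> H; rewrite /euler_prod big_nat_cond [RHS]big_nat_cond.
by apply: eq_bigr => p /andP[/andP[_ h1] h2]; rewrite H.
Qed.

Lemma psum_upd_self w p f N : prime p ->
  psum w f N = psum (upd w p 0) f N + w p * psum w (fun k => f (p * k)%N) (N %/ p).
Proof.
move=> hp; have E : forall f N, psum (upd (upd w p 0) p (w p)) f N = psum w f N.
  by move=> g K; apply: psum_eq => // x _; exact: upd_id.
rewrite -E psum_upd // E; congr (_ + _).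
by apply: psum_eq => // x _; rewrite /upd; case: ifP => // ->.
Qed.

(** Nonnegativity lets the truncation point N / p of the recursion be replaced by N,
    after which the recursion can be solved for the sum. *)
Lemma psum1_le w Y N : admissible w Y -> psum w (fun=> 1) N <= euler_prod w Y.
Proof.
elim: Y w => [|Y IH] w H.
  rewrite /euler_prod big_geq //; case: N => [|N]; first by rewrite /psum big_geq //; lra.
  rewrite /psum big_nat_recl // cmext1 big_nat_cond big1; first lra.
  move=> k /andP[/andP[hk _] _]; have h2 : (1 < k.+1)%N by [].
  by rewrite (@cmext_eq0 _ _ (pdiv k.+1)) ?pdiv_prime ?pdiv_dvd //; [lra|case: H => _ ->].
have E : euler_prod (upd w Y 0) Y = euler_prod w Y.
  by apply: euler_prod_eq => p hp _; rewrite /upd; case: eqP hp => // ->; rewrite ltnn.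
have := IH _ (admissible_pred H); rewrite E euler_prod_recr.
case: ifP => [hY|/negbT hY] IH'; last first.
  rewrite Rmult_1_r; apply: Rle_trans IH'; apply: Req_le; apply: psum_eq => // p hp.
  by rewrite /upd; case: eqP => // e; move: hY; rewrite -e hp.
have [H1 H2] := H; have [a b] := H1 Y.
have h : psum w (fun=> 1) (N %/ Y) <= psum w (fun=> 1) N.
  by apply: psum1_mono; [move=> p; case: (H1 p)|move=> _; lra|exact: leq_div].
have e := @psum_upd_self w Y (fun=> 1) N hY.
have h' := Rmult_le_compat_l _ _ _ a h.
apply: (Rmult_le_reg_r (1 - w Y)); first lra.
rewrite Rmult_assoc Rinv_l ?Rmult_1_r; lra.
Qed.

(** The sum of w(k) f(k) over all k; it is meaningful for bounded f and admissible
    w, when the partial sums converge absolutely. *)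
Definition tsum w f := real (Lim_seq (psum w f)).

Lemma psum_add w f g N : psum w (fun k => f k + g k) N = psum w f N + psum w g N.
Proof. by rewrite /psum -rsum_add; apply: eq_bigr => k _; lra. Qed.
Lemma psum_scal w c f N : psum w (fun k => c * f k) N = c * psum w f N.
Proof. by rewrite /psum -rsum_scal; apply: eq_bigr => k _; lra. Qed.

Lemma psum_abs w Y f B N : admissible w Y -> (forall k, Rabs (f k) <= B) ->
  Rabs (psum w f N) <= B * euler_prod w Y.
Proof.
move=> H Hf; apply: Rle_trans (rsum_abs _ _ _ _) _.
have w0 : forall p, 0 <= w p by move=> p; case: H => H _; case: (H p).
have B0 : 0 <= B by apply: Rle_trans (Rabs_pos _) (Hf 0%N).
apply: Rle_trans (Rmult_le_compat_l _ _ _ B0 (psum1_le N H)).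
rewrite -psum_scal; apply: rsum_le => k _ _; rewrite Rabs_mult Rabs_pos_eq; last exact: cmext_ge0.
by apply: Rmult_le_compat_l; [exact: cmext_ge0|have := Hf k; lra].
Qed.

Lemma psum_cv w Y f B : admissible w Y -> (forall k, Rabs (f k) <= B) ->
  is_lim_seq (psum w f) (tsum w f).
Proof.
move=> H Hf; apply: Lim_seq_correct'.
have w0 : forall p, 0 <= w p by move=> p; case: H => H' _; case: (H' p).
have B0 : 0 <= B by apply: Rle_trans (Rabs_pos _) (Hf 0%N).
have cv g : (forall k, 0 <= g k <= 2 * B) -> ex_finite_lim_seq (psum w g).
  move=> Hg; apply: (@ex_finite_lim_seq_incr _ (2 * B * euler_prod w Y)) => n.
    by apply: psum1_mono => // k; case: (Hg k).
  apply: Rle_trans (Rle_abs _) _; apply: psum_abs => // k.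
  by rewrite Rabs_pos_eq; case: (Hg k).
have [l1 c1] : ex_finite_lim_seq (psum w (fun k => f k + B)).
  by apply: cv => k; move: (Hf k) => /Rabs_le_between; lra.
have [l2 c2] : ex_finite_lim_seq (psum w (fun=> B)) by apply: cv => k; lra.
exists (l1 - l2); apply: (is_lim_seq_ext (fun n => psum w (fun k =>
  f k + B) n - psum w (fun=> B) n)).
  by move=> n; rewrite psum_add; lra.
exact: is_lim_seq_minus'.
Qed.

Lemma tsum_eq w w' f f' : (forall p, prime p -> w p = w' p) ->
  (forall k, (0 < k)%N -> f k = f' k) -> tsum w f = tsum w' f'.
Proof. by move=> h1 h2; rewrite /tsum; congr real; apply: Lim_seq_ext => N; apply: psum_eq. Qed.

Lemma filterlim_divn p : (0 < p)%N -> filterlim (fun n => n %/ p)%N eventually eventually.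
Proof.
move=> hp P [N HN]; exists (N * p)%N => n /leP hn.
by apply: HN; apply/leP; rewrite leq_divRL.
Qed.

Lemma tsum_upd_self w Y p f B : admissible w Y -> prime p -> (forall k, Rabs (f k) <= B) ->
  tsum w f = tsum (upd w p 0) f + w p * tsum w (fun k => f (p * k)%N).
Proof.
move=> H hp Hf; have H0 : admissible (upd w p 0) Y.
  by case: H => H1 H2; split=> x; rewrite /upd; case: ifP => // _; [lra|exact: H2].
have c1 := psum_cv H Hf; have c2 := psum_cv H0 Hf.
have c3 := psum_cv H (fun k => Hf (p * k)%N).
have c3' := is_lim_seq_subseq _ _ _ (filterlim_divn (prime_gt0 hp)) c3.
have c4 := is_lim_seq_plus' _ _ _ _ c2 (is_lim_seq_scal_l _ (w p) _ c3').
have c5 : is_lim_seq (psum w f) (tsum (upd w p 0) f + w p * tsum w (fun k => f (p * k)%N)).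
  by apply: is_lim_seq_ext c4 => n; rewrite [RHS](@psum_upd_self w p).
have := is_lim_seq_unique _ _ c1; rewrite (is_lim_seq_unique _ _ c5).
by case.
Qed.

Lemma tsum1_euler_prod w Y : admissible w Y -> tsum w (fun=> 1) = euler_prod w Y.
Proof.
elim: Y w => [|Y IH] w H.
  have c : is_lim_seq (psum w (fun=> 1)) 1.
    apply: (is_lim_seq_ext_loc (fun=> 1)); last exact: is_lim_seq_const.
    exists 1%N => N /leP; case: N => // N _;
      rewrite /psum big_nat_recl // cmext1 big_nat_cond big1; first lra.
    move=> k /andP[/andP[hk _] _]; have h2 : (1 < k.+1)%N by [].
    by rewrite (@cmext_eq0 _ _ (pdiv k.+1)) ?pdiv_prime ?pdiv_dvd //; [lra|case: H => _ ->].
  by rewrite /tsum (is_lim_seq_unique _ _ c) /euler_prod big_geq.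
have E : euler_prod (upd w Y 0) Y = euler_prod w Y.
  by apply: euler_prod_eq => p hp _; rewrite /upd; case: eqP hp => // ->; rewrite ltnn.
have := IH _ (admissible_pred H); rewrite E euler_prod_recr.
case: ifP => [hY|/negbT hY] IH'; last first.
  rewrite Rmult_1_r -IH'; apply: tsum_eq => // p hp.
  by rewrite /upd; case: eqP => // e; move: hY; rewrite -e hp.
have [H1 H2] := H; have [a b] := H1 Y.
have /= := @tsum_upd_self w Y.+1 Y (fun=> 1) 1 H hY (fun=> _).
rewrite IH' Rabs_R1 => /(_ (fun=> Rle_refl _)) e.
apply: (Rmult_eq_reg_r (1 - w Y)); last lra.
rewrite Rmult_assoc Rinv_l ?Rmult_1_r; last lra.
by rewrite Rmult_minus_distr_l {1}e; ring.
Qed.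

(** * Chebyshev bounds on dyadic blocks of primes *)

Lemma ln2_gt0 : 0 < ln 2. Proof. by have := ln_lt_2; lra. Qed.
Lemma ln2_lt1 : ln 2 < 1.
Proof. rewrite -(ln_exp 1); apply: ln_increasing; first lra. by have := exp_ineq1 1; lra. Qed.
Lemma ln4 : ln 4 = 2 * ln 2.
Proof. have -> : 4 = 2 * 2 by lra. rewrite ln_mult; lra. Qed.
Lemma ln_ge0 x : 1 <= x -> 0 <= ln x.
Proof. by move=> h; rewrite -ln_1; apply: ln_le; lra. Qed.
Lemma ln_INR_ge0 n : 0 <= ln (INR n).
Proof.
case: n => [|n]; first by rewrite /ln; case: Rlt_dec => [h|_]; [move: (Rlt_irrefl _ h)|lra].
by apply: ln_ge0; exact: INR_ge1.
Qed.
Lemma ln_le_sub1 x : 0 < x -> ln x <= x - 1.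
Proof. by move=> h; have := exp_ineq1_le (ln x); rewrite exp_ln //; lra. Qed.

Lemma ln_primes n N : (0 < n)%N -> (n <= N)%N ->
  ln (INR n) = \rsum_(0 <= p < N.+1 | prime p) (INR (logn p n) * ln (INR p)).
Proof.
move=> hn hN; have <- : cmext INR n = INR n by apply: cmext_id => // m k _ _; exact: INR_muln.
rewrite (cmext_widen _ hN).
suff : 0 < \rprod_(0 <= p < N.+1 | prime p) (INR p ^ logn p n) /\
  ln (\rprod_(0 <= p < N.+1 | prime p) (INR p ^ logn p n)) =
  \rsum_(0 <= p < N.+1 | prime p) (INR (logn p n) * ln (INR p)) by case.
elim/big_rec2: _ => [|p y1 y2 hp [h0 h]]; first by split; [lra|exact: ln_1].
have p0 : 0 < INR p by have := INR_prime_ge2 hp; lra.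
have := pow_lt _ (logn p n) p0.
by split; [exact: Rmult_lt_0_compat|rewrite ln_mult // ln_pow // h].
Qed.

Lemma dvdn_fact_prime p n : prime p -> (p %| n`!) = (p <= n)%N.
Proof.
move=> hp; have p0 := prime_gt0 hp; elim: n => [|n IH].
  by rewrite fact0 dvdn1 leqNgt p0; have := prime_gt1 hp; case: eqP => // ->.
rewrite factS Euclid_dvdM // IH; case: (boolP (p %| n.+1)) => h /=.
  by rewrite dvdn_leq.
by rewrite [RHS]leq_eqVlt; case: eqP h => // ->; rewrite dvdnn.
Qed.

Lemma bin_le_pow n k : ('C(n, k) <= 2 ^ n)%N.
Proof.
elim: n k => [|n IH] [|k] //; rewrite ?bin0 ?expn_gt0 //.
by rewrite binS expnS mul2n -addnn leq_add.
Qed.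

(** Every prime in (n, 2n] divides the binomial coefficient of 2n and n, which is
    at most 4^n. *)
Lemma chebyshev_block n :
  \rsum_(n.+1 <= p < (2 * n).+1 | prime p) ln (INR p) <= INR n * ln 4.
Proof.
set c := 'C(2 * n, n); have hb : (c * (n`! * n`!))%N = (2 * n)`!.
  have := bin_fact (leq_addr n n).
  by rewrite addnK addnn -mul2n.
have c0 : (0 < c)%N by rewrite bin_gt0; lia.
have hc : (c <= 2 ^ (2 * n))%N by exact: bin_le_pow.
apply: Rle_trans (_ : ln (INR c) <= _); last first.
  rewrite ln4; have := ln_le _ _ (INR_gt0 c0) (INR_leq hc).
  rewrite ln_pow2 INR_muln; change (INR 2) with 2; lra.
have N1 : (n <= maxn (2 * n) c)%N by lia.
rewrite (@ln_primes c (maxn (2 * n) c)) //; last by lia.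
rewrite (@rsum_cat 0 n.+1 _ _ (fun p => INR (logn p c) * ln (INR p))) //.
have h1 : 0 <= \rsum_(0 <= p < n.+1 | prime p) (INR (logn p c) * ln (INR p)).
  by apply: rsum_ge0 => p _ _; apply: Rmult_le_pos (pos_INR _) (ln_INR_ge0 _).
apply: Rle_trans (_ : \rsum_(n.+1 <= p < (maxn (2 * n) c).+1 | prime p)
     (INR (logn p c) * ln (INR p)) <= _); last lra.
apply: Rle_trans (_ : \rsum_(n.+1 <= p < (2 * n).+1 | prime p)
     (INR (logn p c) * ln (INR p)) <= _); last first.
  apply: rsum_mono_range; first by lia.
  by move=> p _ _; apply: Rmult_le_pos (pos_INR _) (ln_INR_ge0 _).
apply: rsum_le => p /andP[h2 h3] hp; rewrite -{1}(Rmult_1_l (ln _)).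
apply: Rmult_le_compat_r (ln_INR_ge0 _) _; apply: INR_ge1.
rewrite logn_gt0 mem_primes hp c0 /=.
have : p %| (2 * n)`! by rewrite dvdn_fact_prime.
by rewrite -hb !Euclid_dvdM // !dvdn_fact_prime // [(p <= n)%N]leqNgt h2 !orbF.
Qed.

Definition theta i := \rsum_(0 <= p < (2 ^ i).+1 | prime p) ln (INR p).

Lemma theta_recr i :
  theta i.+1 = theta i + \rsum_((2 ^ i).+1 <= p < (2 ^ i.+1).+1 | prime p) ln (INR p).
Proof. by rewrite /theta -rsum_cat //; rewrite ltnS leq_exp2l. Qed.

Lemma theta_le i : theta i <= 2 ^ i * ln 4.
Proof.
elim: i => [|i IH].
  rewrite /theta big_mkcond 2?rsum_recr // big_geq //= ln4; have := ln2_gt0; lra.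
rewrite theta_recr; have := chebyshev_block (2 ^ i).
rewrite -expnS INR_pow2 /=; move: IH; lra.
Qed.

Lemma block_count i :
  \rsum_((2 ^ i).+1 <= p < (2 ^ i.+1).+1 | prime p) 1 <= 4 * 2 ^ i / INR i.+1.
Proof.
have h2 := ln2_gt0; have p2 : 0 < 2 ^ i by apply: pow_lt; lra.
case: i p2 => [|i] p2.
  rewrite expn0 expn1 rsum_recr_cond // big_geq //= Rplus_0_l; lra.
have H : (INR i.+1 * ln 2) * (\rsum_((2 ^ i.+1).+1 <= p < (2 ^ i.+2).+1 | prime p) 1) <=
  2 ^ i.+1 * ln 4.
  rewrite -rsum_scal -(INR_pow2 i.+1); apply: Rle_trans (chebyshev_block (2 ^ i.+1)).
  rewrite -expnS; apply: rsum_le => p /andP[hp _] _; rewrite Rmult_1_r -ln_pow2.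
  by apply: ln_le; [apply: INR_gt0; rewrite expn_gt0|apply: INR_leq; exact: ltnW].
move: H; set s := bigop.body _ _ _ => H.
have i1 : 1 <= INR i.+1 by exact: INR_ge1.
apply: (Rmult_le_reg_l (INR i.+1)); first lra.
have : INR i.+1 * s <= 2 * 2 ^ i.+1.
  by apply: (Rmult_le_reg_l (ln 2)) => //; rewrite ln4 in H; lra.
move=> /Rle_trans; apply; rewrite [INR i.+2]S_INR.
apply: (Rmult_le_reg_r (INR i.+1 + 1)); first lra.
have -> : INR i.+1 * (4 * 2 ^ i.+1 / (INR i.+1 + 1)) * (INR i.+1 + 1) = INR i.+1 * 4 * 2 ^ i.+1.
  by field; lra.
by nra.
Qed.

Lemma sum_blocks (F : nat -> R) J :
  \rsum_(0 <= p < (2 ^ J).+1 | prime p) F p =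
  \rsum_(0 <= i < J) \rsum_((2 ^ i).+1 <= p < (2 ^ i.+1).+1 | prime p) F p.
Proof.
elim: J => [|J IH]; first by rewrite big_mkcond 2?rsum_recr // !big_geq //=; lra.
by rewrite rsum_recr // -IH -rsum_cat // ltnS leq_exp2l.
Qed.

(** Bounds on F over dyadic blocks turn into bounds on its sum over primes, since
    the i-th block has O(2^i / i) elements. *)
Lemma sum_blocks_le (F : nat -> R) (c : nat -> R) J :
  (forall i, (i < J)%N -> 0 <= c i) ->
  (forall i p, (i < J)%N -> (2 ^ i < p <= 2 ^ i.+1)%N -> prime p -> F p <= c i) ->
  \rsum_(0 <= p < (2 ^ J).+1 | prime p) F p <=
  \rsum_(0 <= i < J) (c i * (4 * 2 ^ i / INR i.+1)).
Proof.
move=> c0 H; rewrite sum_blocks; apply: rsum_le => i /andP[_ hi] _.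
apply: Rle_trans (Rmult_le_compat_l _ _ _ (c0 _ hi) (block_count i)).
rewrite -rsum_scal; apply: rsum_le => p hp pp; rewrite Rmult_1_r.
by apply: H => //; move: hp; rewrite ltnS.
Qed.

(** * The first theorem of Mertens *)

Lemma INR_sum m n (F : nat -> nat) :
  INR (\sum_(m <= i < n) F i) = \rsum_(m <= i < n) INR (F i).
Proof. by apply: (big_morph INR INR_addn). Qed.

Lemma INR_divn_le n d : (0 < d)%N -> INR (n %/ d) <= INR n / INR d.
Proof.
move=> hd; apply: (Rmult_le_reg_r (INR d)); first exact: INR_gt0.
have d0 := INR_gt0 hd; have -> : INR n / INR d * INR d = INR n by field; lra.
by rewrite -INR_muln; apply: INR_leq; exact: leq_divM.
Qed.

Lemma INR_divn_gt n d : (0 < d)%N -> INR n / INR d - 1 <= INR (n %/ d).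
Proof.
move=> hd; have d0 := INR_gt0 hd; apply: (Rmult_le_reg_r (INR d)) => //.
have -> : (INR n / INR d - 1) * INR d = INR n - INR d by field; lra.
have := INR_leq (ltnW (ltn_ceil n hd)).
by rewrite INR_muln S_INR; lra.
Qed.

Lemma geometric_sum_le x n : 0 < x < 1 -> \rsum_(1 <= k < n) x ^ k <= x / (1 - x).
Proof.
move=> hx; have H : forall n, (1 <= n)%N -> \rsum_(1 <= k < n) x ^ k = (x - x ^ n) / (1 - x).
  elim=> [//|[|m] IH] _; first by rewrite big_geq //=; field; lra.
  by rewrite rsum_recr // IH //=; field; lra.
case: n => [|n]; first by rewrite big_geq //; apply: Rlt_le; apply: Rdiv_lt_0_compat; lra.
rewrite H //; apply: Rmult_le_compat_r; first by apply: Rlt_le; apply: Rinv_0_lt_compat; lra.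
have : 0 < x ^ n.+1 by apply: pow_lt; lra.
lra.
Qed.

(** Legendre's formula, with floors bounded above and the geometric series summed. *)
Lemma legendre_le p N : prime p -> INR (logn p N`!) <= INR N / (INR p - 1).
Proof.
move=> hp; have p2 := INR_prime_ge2 hp; rewrite logn_fact // INR_sum.
apply: Rle_trans (_ : \rsum_(1 <= k < N.+1) (INR N * (/ INR p) ^ k) <= _).
  apply: rsum_le => k _ _.
  have := @INR_divn_le N (p ^ k); rewrite expn_gt0 prime_gt0 // INR_expn => /(_ isT).
  by rewrite pow_inv.
rewrite rsum_scal; apply: Rmult_le_compat_l; first exact: pos_INR.
apply: Rle_trans (geometric_sum_le _ _) _.
  split; first by apply: Rinv_0_lt_compat; lra.
  by rewrite -Rinv_1; apply: Rinv_lt_contravar; lra.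
by apply: Req_le; field; lra.
Qed.

Lemma legendre_ge p N : prime p -> (0 < N)%N -> INR N / INR p - 1 <= INR (logn p N`!).
Proof.
move=> hp hN; apply: Rle_trans (INR_divn_gt _ (prime_gt0 hp)) _.
apply: INR_leq; rewrite logn_fact // big_ltn // expn1; exact: leq_addr.
Qed.

Lemma ln_fact_primes N :
  ln (INR N`!) = \rsum_(0 <= p < N.+1 | prime p) (INR (logn p N`!) * ln (INR p)).
Proof.
have h1 : (N <= maxn N N`!)%N by exact: leq_maxl.
rewrite (@ln_primes _ (maxn N N`!)) ?fact_gt0 //; last exact: leq_maxr.
rewrite (@rsum_cat 0 N.+1) //.
rewrite [X in _ + X]big_nat_cond [X in _ + X]big1 ?Rplus_0_r // => p /andP[/andP[hp _] pp].
have -> : logn p N`! = 0%N.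
  by apply/eqP; rewrite -leqn0 leqNgt logn_gt0 mem_primes pp fact_gt0 dvdn_fact_prime // leqNgt hp.
by rewrite Rmult_0_l.
Qed.

Lemma ln_fact_le N : (0 < N)%N -> ln (INR N`!) <= INR N * ln (INR N).
Proof.
elim: N => [//|[|N] IH] _; first by rewrite /= ln_1; lra.
rewrite factS INR_muln ln_mult; try by apply: INR_gt0; rewrite ?fact_gt0.
have := IH isT; have : ln (INR N.+1) <= ln (INR N.+2).
  by apply: ln_le; [exact: INR_gt0|exact: INR_leq].
by have := pos_INR N.+1; rewrite (S_INR N.+1); nra.
Qed.

Lemma ln_fact_ge N : (0 < N)%N -> INR N * ln (INR N) - INR N <= ln (INR N`!).
Proof.
elim: N => [//|[|N] IH] _; first by rewrite /= ln_1; lra.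
rewrite factS INR_muln ln_mult; try by apply: INR_gt0; rewrite ?fact_gt0.
have := IH isT; have n0 : 0 < INR N.+1 by exact: INR_gt0.
have n1 : 0 < INR N.+2 by exact: INR_gt0.
have : ln (INR N.+2) - ln (INR N.+1) <= / INR N.+1.
  rewrite -ln_div //; apply: Rle_trans (ln_le_sub1 _) _; first exact: Rdiv_lt_0_compat.
  by rewrite (S_INR N.+1); apply: Req_le; field; lra.
move=> h1 h2; have : INR N.+1 * (ln (INR N.+2) - ln (INR N.+1)) <= 1.
  apply: Rle_trans (Rmult_le_compat_l _ _ _ (Rlt_le _ _ n0) h1) _.
  by apply: Req_le; field; lra.
by rewrite (S_INR N.+1); lra.
Qed.

(** The function (ln n + 2) / n telescopes above the summand. *)
Lemma sum_ln_sq N : \rsum_(2 <= n < N) (ln (INR n) / (INR n * (INR n - 1))) <= 2.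
Proof.
have H : forall N, (2 <= N)%N -> \rsum_(2 <= n < N) (ln (INR n) / (INR n * (INR n - 1))) <=
   2 - (ln (INR N.-1) + 2) / INR N.-1.
  elim=> [//|[|[|M]] IH] // _; first by rewrite big_geq //= ln_1; lra.
  rewrite rsum_recr //.
  have := IH isT; set s := bigop.body _ _ _ => {}IH.
  have m1 : 0 < INR M.+1 by exact: INR_gt0.
  rewrite /= -/(INR M.+1) -/(INR M.+2) in IH *.
  have e : INR M.+2 = INR M.+1 + 1 by exact: S_INR.
  have m1' : 1 <= INR M.+1 by exact: INR_ge1.
  have h : ln (INR M.+2) - ln (INR M.+1) <= / INR M.+1.
    rewrite -ln_div //; last lra; apply: Rle_trans (ln_le_sub1 _) _;
      first by apply: Rdiv_lt_0_compat; lra.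
    by rewrite e; apply: Req_le; field; lra.
  have h' : INR M.+2 * (ln (INR M.+2) - ln (INR M.+1)) <= 2.
    apply: Rle_trans (Rmult_le_compat_l _ _ _ _ h) _; first lra.
    apply: (Rmult_le_reg_r (INR M.+1)) => //; rewrite Rmult_assoc Rinv_l; lra.
  suff : ln (INR M.+2) / (INR M.+2 * (INR M.+2 - 1)) <=
    (ln (INR M.+1) + 2) / INR M.+1 - (ln (INR M.+2) + 2) / INR M.+2 by lra.
  have -> : (ln (INR M.+1) + 2) / INR M.+1 - (ln (INR M.+2) + 2) / INR M.+2 =
    ((ln (INR M.+2)) + (2 - INR M.+2 * (ln (INR M.+2) - ln (INR M.+1)))) / (INR M.+2 * (INR M.+2
      - 1)).
    by rewrite e; field; lra.
  apply: Rmult_le_compat_r; last lra.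
  by apply: Rlt_le; apply: Rinv_0_lt_compat; rewrite e; nra.
case: (leqP 2 N) => h; last by rewrite big_geq; [lra|exact: ltnW].
apply: Rle_trans (H _ h) _; have : 0 <= (ln (INR N.-1) + 2) / INR N.-1; last lra.
have hn : (0 < N.-1)%N by lia.
apply: Rmult_le_pos; first by have := ln_INR_ge0 N.-1; lra.
by apply: Rlt_le; apply: Rinv_0_lt_compat; exact: INR_gt0.
Qed.

Definition log_over_p i := \rsum_(0 <= p < (2 ^ i).+1 | prime p) (ln (INR p) / INR p).
Definition log_over_pm1 i := \rsum_(0 <= p < (2 ^ i).+1 | prime p) (ln (INR p) / (INR p - 1)).

Lemma log_over_pm1_le i : log_over_pm1 i <= log_over_p i + 2.
Proof.
have -> : log_over_pm1 i = log_over_p i + \rsum_(0 <=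
  p < (2 ^ i).+1 | prime p) (ln (INR p) / (INR p * (INR p - 1))).
  rewrite /log_over_pm1 /log_over_p -rsum_add; apply: eq_bigr => p hp;
    have := INR_prime_ge2 hp => p2.
  by field; lra.
apply: Rplus_le_compat_l; apply: Rle_trans (sum_ln_sq (2 ^ i).+1).
have h1 : (1 <= 2 ^ i)%N by rewrite expn_gt0.
rewrite (@rsum_cat 0 2) //.
rewrite [X in X + _]big_nat_cond [X in X + _]big1; last first.
  by move=> p /andP[/andP[_ p1] pp]; have := prime_gt1 pp; lia.
rewrite Rplus_0_l; apply: rsum_sub_pred => // p /andP[hp _] _.
have p2 : 2 <= INR p by exact: (@INR_leq 2).
apply: Rmult_le_pos (ln_INR_ge0 _) _; apply: Rlt_le; apply: Rinv_0_lt_compat; nra.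
Qed.

(** The lower bound in Legendre's formula loses at most 1 at each prime, that is
    theta(2^i) in total, which Chebyshev's bound absorbs. *)
Lemma log_over_p_le i : log_over_p i <= INR i * ln 2 + 2.
Proof.
have N0 : (0 < 2 ^ i)%N by rewrite expn_gt0.
have N0' := INR_gt0 N0.
have := ln_fact_le N0; rewrite ln_fact_primes ln_pow2.
have h : INR (2 ^ i) * log_over_p i - theta i <=
   \rsum_(0 <= p < (2 ^ i).+1 | prime p) (INR (logn p (2 ^ i)`!) * ln (INR p)).
  rewrite /log_over_p /theta -rsum_scal -rsum_sub; apply: rsum_le => p _ hp.
  apply: Rle_trans (Rmult_le_compat_r _ _ _ (ln_INR_ge0 _) (legendre_ge hp N0)).
  by apply: Req_le; have := INR_prime_ge2 hp => p2; field; lra.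
move=> h2; have h3 := theta_le i; rewrite -INR_pow2 in h3.
have l4 : ln 4 < 2 by rewrite ln4; have := ln2_lt1; lra.
apply: (Rmult_le_reg_l (INR (2 ^ i))) => //.
by nra.
Qed.

Lemma log_over_p_ge i : INR i * ln 2 - 3 <= log_over_p i.
Proof.
have N0 : (0 < 2 ^ i)%N by rewrite expn_gt0.
have N0' := INR_gt0 N0.
have := ln_fact_ge N0; rewrite ln_fact_primes ln_pow2.
have h : \rsum_(0 <= p < (2 ^ i).+1 | prime p) (INR (logn p (2 ^ i)`!) * ln (INR p)) <=
   INR (2 ^ i) * log_over_pm1 i.
  rewrite /log_over_pm1 -rsum_scal; apply: rsum_le => p _ hp.
  apply: Rle_trans (Rmult_le_compat_r _ _ _ (ln_INR_ge0 _) (legendre_le _ hp)) _.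
  by apply: Req_le; have := INR_prime_ge2 hp => p2; field; lra.
have h1 := log_over_pm1_le i.
move=> h2; apply: (Rmult_le_reg_l (INR (2 ^ i))) => //; nra.
Qed.

(** The logarithm of an Euler factor at s = 1; it lies between 1/p and 1/(p - 1),
    so sums of ln p * ell p and of ln p / p differ by O(1). *)
Definition ell (p : nat) := - ln (1 - / INR p).

Lemma ell_bounds p : prime p -> / INR p <= ell p <= / (INR p - 1).
Proof.
move=> hp; have p2 := INR_prime_ge2 hp.
have i1 : 0 < 1 - / INR p.
  by have : / INR p < 1; [rewrite -Rinv_1; apply: Rinv_lt_contravar; lra|lra].
rewrite /ell; split; first by have := ln_le_sub1 i1; lra.
rewrite -ln_Rinv //; apply: Rle_trans (ln_le_sub1 _) _; first exact: Rinv_0_lt_compat.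
by apply: Req_le; field; lra.
Qed.

Lemma ell_ge0 p : prime p -> 0 <= ell p.
Proof.
move=> hp; have p2 := INR_prime_ge2 hp; case: (ell_bounds hp) => h _.
by have := Rinv_0_lt_compat (INR p); lra.
Qed.

Definition log_ell i := \rsum_(0 <= p < (2 ^ i).+1 | prime p) (ln (INR p) * ell p).

Lemma mertens1 i : Rabs (log_ell i - INR i * ln 2) <= 4.
Proof.
apply/Rabs_le_between; split.
  have := log_over_p_ge i; suff : log_over_p i <= log_ell i by lra.
  apply: rsum_le => p _ hp; apply: Rmult_le_compat_l (ln_INR_ge0 _) _.
  by case: (ell_bounds hp).
have := log_over_p_le i; have := log_over_pm1_le i; suff : log_ell i <= log_over_pm1 i by lra.
apply: rsum_le => p _ hp; apply: Rmult_le_compat_l (ln_INR_ge0 _) _.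
by case: (ell_bounds hp).
Qed.

Lemma sum_l_sq n : \rsum_(1 <= l < n) (INR l * (INR l + 1) * (/ 2) ^ l) <= 8.
Proof.
have H : forall n, (1 <= n)%N -> \rsum_(1 <= l < n) (INR l * (INR l + 1) * (/ 2) ^ l) =
  8 - 2 * ((INR n - 1) ^ 2 + 5 * (INR n - 1) + 8) * (/ 2) ^ n.
  elim=> [//|[|m] IH] _; first by rewrite big_geq //=; field.
  by rewrite rsum_recr // IH // (S_INR m.+1) /=; field.
case: n => [|n]; first by rewrite big_geq //; lra.
rewrite H //; have : 0 < (/ 2) ^ n.+1 by apply: pow_lt; lra.
have := @INR_ge1 n.+1 isT; move: (INR _) ((/ 2) ^ _) => x y hx hy.
have : 0 <= (x - 1) ^ 2 + 5 * (x - 1) + 8 by nra.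
by nra.
Qed.

(** Substituting l = J - i, the factor 1 / (J - l + 1) is at most 2 (l + 1) / J, and
    the sum of l (l + 1) 2^(-l) converges. *)
Lemma block_weight J : (0 < J)%N ->
  \rsum_(0 <= i < J) (INR (J - i) * (2 ^ i / INR i.+1)) <= 16 * (2 ^ J / INR J).
Proof.
move=> hJ; rewrite big_nat_rev.
have J0 := INR_gt0 hJ; have p2 : 0 < 2 ^ J by apply: pow_lt; lra.
apply: Rle_trans (_ : \rsum_(0 <= i < J) (2 * (2 ^ J / INR J) *
    (INR i.+1 * (INR i.+1 + 1) * (/ 2) ^ i.+1)) <= _); last first.
  rewrite rsum_scal; have := sum_l_sq J.+1; rewrite big_add1 /= => h.
  have : 0 < 2 ^ J / INR J by exact: Rdiv_lt_0_compat.
  by nra.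
apply: rsum_le => i /andP[_ hi] _; rewrite add0n.
have -> : (J - (J - i.+1))%N = i.+1 by lia.
have -> : 2 ^ (J - i.+1) = 2 ^ J * (/ 2) ^ i.+1.
  rewrite -{2}(subnK hi) pow_add Rmult_assoc -Rpow_mult_distr Rinv_r ?pow1; lra.
have e : INR (J - i.+1).+1 = INR J - INR i.
  by rewrite S_INR minus_INR ?S_INR; [lra|apply/ltP].
rewrite e; have a1 : INR i.+1 <= INR J by exact: INR_leq.
rewrite S_INR in a1 *; have a0 := pos_INR i.
have q0 : 0 < (/ 2) ^ i.+1 by apply: pow_lt; lra.
have -> : (INR i + 1) * (2 ^ J * (/ 2) ^ i.+1 / (INR J - INR i)) =
  (2 ^ J * (/ 2) ^ i.+1 * (INR i + 1)) * / (INR J - INR i) by field; lra.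
have -> : 2 * (2 ^ J / INR J) * ((INR i + 1) * (INR i + 1 + 1) * (/ 2) ^ i.+1) =
  (2 ^ J * (/ 2) ^ i.+1 * (INR i + 1)) * (2 * (INR i + 2) / INR J) by field; lra.
apply: Rmult_le_compat_l; first by apply: Rmult_le_pos; [apply: Rmult_le_pos|]; lra.
apply: (Rmult_le_reg_r ((INR J - INR i) * INR J)); first nra.
have -> : / (INR J - INR i) * ((INR J - INR i) * INR J) = INR J by field; lra.
have -> : 2 * (INR i + 2) / INR J * ((INR J - INR i) * INR J) = 2 * (INR i +
  2) * (INR J - INR i) by field; lra.
nra.
Qed.

(** It bounds the logarithm of the sum of the coefficients of the resonator, whose
    Euler factor at p is X/p. *)
Lemma sum_ln_ratio J : (0 < J)%N ->
  \rsum_(0 <= p < (2 ^ J).+1 | prime p) (ln (2 ^ J / INR p)) <= 64 * (2 ^ J / INR J).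
Proof.
move=> hJ; apply: Rle_trans (_ : \rsum_(0 <= i < J) (INR (J - i) * (4 * 2 ^ i / INR i.+1)) <= _).
  apply: (@sum_blocks_le _ (fun i => INR (J - i))) => [i _|i p hi /andP[hp _] pp];
    first exact: pos_INR.
  have p2 := INR_prime_ge2 pp; have l2 := ln2_gt0; have l1 := ln2_lt1.
  rewrite ln_div; [|by apply: pow_lt; lra|lra].
  rewrite ln_pow; last lra.
  have : INR i * ln 2 <= ln (INR p).
    rewrite -ln_pow2; apply: ln_le; first by apply: INR_gt0; rewrite expn_gt0.
    exact: INR_leq (ltnW hp).
  rewrite minus_INR; last by apply/leP/ltnW.
  have : INR i < INR J by exact: INR_ltn.
  by nra.
have := block_weight hJ.
have -> : \rsum_(0 <= i < J) (INR (J - i) * (4 * 2 ^ i / INR i.+1)) =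
  4 * (\rsum_(0 <= i < J) (INR (J - i) * (2 ^ i / INR i.+1))).
  rewrite -rsum_scal; apply: eq_bigr => i _; field.
  by have := @INR_gt0 i.+1 isT; lra.
lra.
Qed.

Lemma prime_count J : (0 < J)%N ->
  \rsum_(0 <= p < (2 ^ J).+1 | prime p) 1 <= 64 * (2 ^ J / INR J).
Proof.
move=> hJ; apply: Rle_trans (_ : \rsum_(0 <= i < J) (INR (J - i) * (4 * 2 ^ i / INR i.+1)) <= _).
  apply: (@sum_blocks_le _ (fun i => INR (J - i))) => [i _|i p hi _ pp]; first exact: pos_INR.
  by apply: INR_ge1; rewrite subn_gt0.
have := block_weight hJ.
have -> : \rsum_(0 <= i < J) (INR (J - i) * (4 * 2 ^ i / INR i.+1)) =
  4 * (\rsum_(0 <= i < J) (INR (J - i) * (2 ^ i / INR i.+1))).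
  rewrite -rsum_scal; apply: eq_bigr => i _; field.
  by have := @INR_gt0 i.+1 isT; lra.
lra.
Qed.

(** * The third theorem of Mertens, with its constant *)

Definition mertens_sum i := \rsum_(0 <= p < (2 ^ i).+1 | prime p) ell p.
Definition harm n := \rsum_(1 <= k < n.+1) / INR k.

Lemma mertens_sum_recr i :
  mertens_sum i.+1 = mertens_sum i + \rsum_((2 ^ i).+1 <= p < (2 ^ i.+1).+1 | prime p) ell p.
Proof. by rewrite /mertens_sum -rsum_cat //; rewrite ltnS leq_exp2l. Qed.
Lemma log_ell_recr i :
  log_ell i.+1 = log_ell i + \rsum_((2 ^ i).+1 <= p < (2 ^ i.+1).+1 | prime p) (ln (INR p) * ell p).
Proof. by rewrite /log_ell -rsum_cat //; rewrite ltnS leq_exp2l. Qed.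
Lemma harm_recr n : harm n.+1 = harm n + / INR n.+1.
Proof. by rewrite /harm rsum_recr. Qed.

Lemma mertens_block i : INR i * ln 2 * (mertens_sum i.+1 - mertens_sum i) <=
  log_ell i.+1 - log_ell i.
Proof.
rewrite mertens_sum_recr log_ell_recr.
have H : INR i * ln 2 * (\rsum_((2 ^ i).+1 <= p < (2 ^ i.+1).+1 | prime p) ell p) <=
  \rsum_((2 ^ i).+1 <= p < (2 ^ i.+1).+1 | prime p) (ln (INR p) * ell p).
  rewrite -rsum_scal; apply: rsum_le => p /andP[hp _] pp.
  apply: Rmult_le_compat_r; first exact: ell_ge0.
  rewrite -ln_pow2; apply: ln_le; first by apply: INR_gt0; rewrite expn_gt0.
  exact: INR_leq (ltnW hp).
lra.
Qed.

(** Partial summation of the first theorem of Mertens.  The induction carries the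
    error term E (j + 1) of that theorem, shifted by its bound 4 so that it is
    negative and may be divided by a smaller number at each step. *)
Lemma mertens_incr i j : (i <= j)%N ->
  mertens_sum j.+1 - mertens_sum i.+1 <= harm j - harm i + 8 / ln 2 / INR i.+1.
Proof.
move=> hij; have l2 := ln2_gt0.
pose E k := log_ell k - INR k * ln 2.
have HE k : -4 <= E k <= 4 by exact: (Rabs_le_between _ _).1 (mertens1 k).
suff H : mertens_sum j.+1 - mertens_sum i.+1 <= harm j - harm i +
    / ln 2 * (8 / INR i.+1 + (E j.+1 - 4) / INR j.+1).
  apply: Rle_trans H _; have j0 := @INR_gt0 j.+1 isT; have i0 := @INR_gt0 i.+1 isT.
  have : (E j.+1 - 4) / INR j.+1 <= 0.
    have := Rinv_0_lt_compat _ j0; have := HE j.+1; rewrite /Rdiv; nra.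
  have -> : 8 / ln 2 / INR i.+1 = / ln 2 * (8 / INR i.+1) by field; lra.
  move=> h; apply: Rplus_le_compat_l; apply: Rmult_le_compat_l; last lra.
  by apply: Rlt_le; apply: Rinv_0_lt_compat.
elim: j hij => [|j IH]; last rewrite leq_eqVlt; last case/orP; last 1 first.
- move=> hij; have {}IH := IH hij; have j0 := @INR_gt0 j.+1 isT; have j1 := @INR_gt0 j.+2 isT.
  have b : mertens_sum j.+2 - mertens_sum j.+1 <= / ln 2 * ((ln 2 + E j.+2 - E j.+1) / INR j.+1).
    apply: (Rmult_le_reg_l (INR j.+1 * ln 2)); first nra.
    apply: Rle_trans (mertens_block j.+1) _; rewrite /E (S_INR j.+1).
    by apply: Req_le; field; lra.
  rewrite harm_recr.
  have e : / ln 2 * (8 / INR i.+1 + (E j.+1 - 4) / INR j.+1) +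
     / ln 2 * ((ln 2 + E j.+2 - E j.+1) / INR j.+1) =
     / INR j.+1 + / ln 2 * (8 / INR i.+1 + (E j.+2 - 4) / INR j.+1).
    by field; split; [|split]; try lra; have := @INR_gt0 i.+1 isT; lra.
  have h : (E j.+2 - 4) / INR j.+1 <= (E j.+2 - 4) / INR j.+2.
    have : / INR j.+2 <= / INR j.+1 by apply: Rinv_le_contravar => //; exact: INR_leq.
    by have := HE j.+2; rewrite /Rdiv; nra.
  have : / ln 2 * (8 / INR i.+1 + (E j.+2 - 4) / INR j.+1) <=
         / ln 2 * (8 / INR i.+1 + (E j.+2 - 4) / INR j.+2).
    by apply: Rmult_le_compat_l; [apply: Rlt_le; apply: Rinv_0_lt_compat|lra].
  lra.
- rewrite leqn0 => /eqP ->; have := HE 1%N => h /=.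
  have : 0 <= / ln 2 * (8 / 1 + (E 1%N - 4) / 1); last lra.
  by apply: Rmult_le_pos; [apply: Rlt_le; apply: Rinv_0_lt_compat|lra].
- move=> /eqP ->; have h := HE j.+2; have j0 := @INR_gt0 j.+2 isT.
  have -> : 8 / INR j.+2 + (E j.+2 - 4) / INR j.+2 = (E j.+2 + 4) / INR j.+2 by field; lra.
  have : 0 <= / ln 2 * ((E j.+2 + 4) / INR j.+2); last lra.
  apply: Rmult_le_pos; first by apply: Rlt_le; apply: Rinv_0_lt_compat.
  by apply: Rmult_le_pos; [lra|apply: Rlt_le; apply: Rinv_0_lt_compat].
Qed.

(** Convexity of -ln(1 - x y) in y: compare the tangent of ln at 1 - x y with its
    values at 1 - x and 1. *)
Lemma bernoulli_ln x y : 0 < x < 1 -> 0 <= y <= 1 -> - ln (1 - x * y) <= - (y * ln (1 - x)).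
Proof.
move=> hx hy; have A0 : 0 < 1 - x * y by nra.
set A := 1 - x * y in A0 *.
have tang u : 0 < u -> ln u <= ln A + (u / A - 1).
  move=> hu; have := @ln_le_sub1 (u / A); rewrite ln_div // => h.
  by have := h (Rdiv_lt_0_compat _ _ hu A0); lra.
have h1 := tang (1 - x); have h2 := tang 1 Rlt_0_1; rewrite ln_1 in h2.
have {}h1 : ln (1 - x) <= ln A + ((1 - x) / A - 1) by apply: h1; lra.
have e : y * ((1 - x) / A - 1) + (1 - y) * (1 / A - 1) = 0 by rewrite /A; field; rewrite -/A; lra.
by nra.
Qed.

Lemma inv_1_exp u : 0 < u -> u / (1 + u) <= 1 - exp (- u).
Proof.
move=> hu; rewrite exp_Ropp; have := exp_ineq1_le u => h.
have : / exp u <= / (1 + u) by apply: Rinv_le_contravar; lra.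
suff -> : u / (1 + u) = 1 - / (1 + u) by lra.
by field; lra.
Qed.

Lemma Rpower_opp_le x y s : 0 <= s -> 0 < x -> x <= y -> Rpower y (- s) <= Rpower x (- s).
Proof.
move=> hs hx hxy; rewrite /Rpower; have : ln x <= ln y by exact: ln_le.
move=> h; have : - s * ln y <= - s * ln x by nra.
by case=> [/exp_increasing|->]; lra.
Qed.
Lemma Rpower_gt0 x s : 0 < Rpower x s. Proof. exact: exp_pos. Qed.

Lemma Rpower_2pow i s : Rpower (INR (2 ^ i)) (- s) = (Rpower 2 (- s)) ^ i.
Proof.
rewrite -Rpower_pow; last exact: exp_pos.
by rewrite Rpower_mult INR_pow2 -Rpower_pow ?Rpower_mult; [congr Rpower; ring|lra].
Qed.

Lemma is_derive_continuity_pt (f : R -> R) x l : is_derive f x l -> continuity_pt f x.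
Proof. by move=> /is_derive_Reals h; apply: derivable_continuous_pt; exists l. Qed.

Section ZetaEuler.
Variable d : R.
Hypothesis d0 : 0 < d.
Let z := Rpower 2 (- d).

Let z01 : 0 < z < 1.
Proof.
split; first exact: exp_pos.
rewrite /z /Rpower -exp_0; apply: exp_increasing; have := ln2_gt0; nra.
Qed.

Lemma Rpower_succ n : (0 < n)%N -> Rpower (INR n) (- (1 + d)) = / INR n * Rpower (INR n) (- d).
Proof.
move=> hn; have n0 := INR_gt0 hn.
by rewrite Ropp_plus_distr Rpower_plus Rpower_Ropp Rpower_1.
Qed.

(** Telescoping, from n^(-1-d) >= (n^(-d) - (n+1)^(-d)) / d. *)
Lemma zeta_lower N : (1 - Rpower (INR N.+1) (- d)) / d <=
  \rsum_(1 <= n < N.+1) Rpower (INR n) (- (1 + d)).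
Proof.
elim: N => [|N IH].
  by rewrite big_geq // /Rpower ln_1 Rmult_0_r exp_0; apply: Req_le; field; lra.
rewrite rsum_recr //; apply: Rle_trans (Rplus_le_compat_r _ _ _ IH).
have n0 := @INR_gt0 N.+1 isT; rewrite Rpower_succ //.
suff h : Rpower (INR N.+1) (- d) * (1 - d / INR N.+1) <= Rpower (INR N.+2) (- d).
  apply: (Rmult_le_reg_r d) => //.
  have -> : ((1 - Rpower (INR N.+1) (- d)) / d + / INR N.+1 * Rpower (INR N.+1) (- d)) * d =
    1 - Rpower (INR N.+1) (- d) * (1 - d / INR N.+1) by field; lra.
  have -> : (1 - Rpower (INR N.+2) (- d)) / d * d = 1 - Rpower (INR N.+2) (- d) by field; lra.
  lra.
have e : ln (INR N.+2) <= ln (INR N.+1) + / INR N.+1.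
  have n1 := @INR_gt0 N.+2 isT.
  have := @ln_le_sub1 (INR N.+2 / INR N.+1); rewrite ln_div // => h.
  have := h (Rdiv_lt_0_compat _ _ n1 n0); rewrite (S_INR N.+1).
  have -> : (INR N.+1 + 1) / INR N.+1 = 1 + / INR N.+1 by field; lra.
  lra.
apply: Rle_trans (_ : Rpower (INR N.+1) (- d) * exp (- (d / INR N.+1)) <= _).
  apply: Rmult_le_compat_l; first exact: Rlt_le (Rpower_gt0 _ _).
  by have := exp_ineq1_le (- (d / INR N.+1)); lra.
rewrite /Rpower -exp_plus.
have : - d * ln (INR N.+1) + - (d / INR N.+1) <= - d * ln (INR N.+2).
  have : d * ln (INR N.+2) <= d * (ln (INR N.+1) + / INR N.+1) by apply: Rmult_le_compat_l; lra.
  rewrite /Rdiv; lra.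
by case=> [/exp_increasing|->]; lra.
Qed.

Lemma Rpower_le1 x : 1 <= x -> Rpower x (- d) <= 1.
Proof.
move=> hx; have := @Rpower_opp_le 1 x d; rewrite {2}/Rpower ln_1 Rmult_0_r exp_0.
by apply; lra.
Qed.

Lemma Rpower_prime_half p : prime p -> Rpower (INR p) (- (1 + d)) <= / 2.
Proof.
move=> hp; have p2 := INR_prime_ge2 hp.
rewrite Rpower_succ ?prime_gt0 //.
have := @Rpower_le1 (INR p); have := Rinv_le_contravar 2 (INR p).
have := Rpower_gt0 (INR p) (- d); have := Rinv_0_lt_compat (INR p). nra.
Qed.

(** The Euler product bounds the Dirichlet series; each Euler factor at 1 + d is at
    most exp (p^(-d) ell p), and p^(-d) <= z^i on the i-th dyadic block. *)
Lemma zeta_euler L : (1 - z ^ L) / d <= exp (\rsum_(0 <=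
  i < L) (z ^ i * (mertens_sum i.+1 - mertens_sum i))).
Proof.
set N := (2 ^ L)%N; have N0 : (0 < N)%N by rewrite expn_gt0.
pose w p := if (p < N.+1)%N && prime p then Rpower (INR p) (- (1 + d)) else 0.
have w1 p : 0 <= w p < 1.
  rewrite /w; case: ifP => [/andP[_ hp]|_]; last lra.
  by have := Rpower_prime_half hp; have := Rpower_gt0 (INR p) (- (1 + d)); lra.
have aw : admissible w N.+1.
  by split=> // p hp; rewrite /w ltnNge hp.
apply: Rle_trans (_ : \rsum_(1 <= n < N.+1) Rpower (INR n) (- (1 + d)) <= _).
  apply: Rle_trans (zeta_lower N); apply: Rmult_le_compat_r; first by apply: Rlt_le;
    apply: Rinv_0_lt_compat.
  rewrite -Rpower_2pow; have := @Rpower_opp_le (INR N) (INR N.+1) d; rewrite -/N.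
  have := INR_gt0 N0; have : INR N <= INR N.+1 by exact: INR_leq.
  by move=> a b c; have := c (Rlt_le _ _ d0) b a; lra.
have -> : \rsum_(1 <= n < N.+1) Rpower (INR n) (- (1 + d)) = psum w (fun=> 1) N.
  rewrite /psum big_nat_cond [RHS]big_nat_cond; apply: eq_bigr => n /andP[/andP[n0 nN] _].
  rewrite Rmult_1_r -cmext_Rpower //; apply: cmext_eq => // p hp pn; rewrite /w hp andbT ifT //.
  by apply: leq_ltn_trans nN; apply: dvdn_leq.
apply: Rle_trans (psum1_le _ aw) _.
apply: Rle_trans (_ : exp (\rsum_(0 <= p < N.+1 | prime p) (Rpower (INR p) (- d) * ell p)) <= _).
  rewrite -rprod_exp; apply: (@rprod_le 0 N.+1 prime (fun p => / (1 - w p)) _ _).2 =>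
    p /andP[_ pN] hp.
  have [a b] := w1 p; split; first by apply: Rlt_le; apply: Rinv_0_lt_compat; lra.
  rewrite -(exp_ln (/ (1 - w p))); last by apply: Rinv_0_lt_compat; lra.
  have p2 := INR_prime_ge2 hp.
  have : ln (/ (1 - w p)) <= Rpower (INR p) (- d) * ell p.
    rewrite ln_Rinv; last lra.
    rewrite /w pN hp /= Rpower_succ ?prime_gt0 // /ell.
    have := @bernoulli_ln (/ INR p) (Rpower (INR p) (- d)).
    have := @Rpower_le1 (INR p); have := Rpower_gt0 (INR p) (- d).
    have i0 : 0 < / INR p by apply: Rinv_0_lt_compat; lra.
    have i1 : / INR p < 1 by rewrite -Rinv_1; apply: Rinv_lt_contravar; lra.
    move=> q0 q1 h; have := h (conj i0 i1) (conj (Rlt_le _ _ q0) (q1 _)); lra.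
  by case=> [/exp_increasing|->]; lra.
have H : \rsum_(0 <= p < N.+1 | prime p) (Rpower (INR p) (- d) * ell p) <=
   \rsum_(0 <= i < L) (z ^ i * (mertens_sum i.+1 - mertens_sum i)).
  rewrite sum_blocks; apply: rsum_le => i _ _; rewrite mertens_sum_recr.
  set s := bigop.body _ _ _.
  have -> : mertens_sum i + bigop.body 0 (index_iota (2 ^ i).+1 (2 ^ i.+1).+1)
    (fun i0 : nat => BigBody i0 Rplus (prime i0) (ell i0)) - mertens_sum i =
     \rsum_((2 ^ i).+1 <= p < (2 ^ i.+1).+1 | prime p) ell p by lra.
  rewrite /s -rsum_scal; apply: rsum_le => p /andP[hp _] pp.
  apply: Rmult_le_compat_r; first exact: ell_ge0.
  rewrite -Rpower_2pow; apply: Rpower_opp_le; first lra.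
    by apply: INR_gt0; rewrite expn_gt0.
  exact: INR_leq (ltnW hp).
by case: H => [/exp_increasing|->]; lra.
Qed.

(** The difference of both sides vanishes at z = 0 and has derivative
    1 / (1 - z) - (1 + z + .. + z^(n-2)) >= 0. *)
Lemma log_series n : \rsum_(1 <= i < n) (z ^ i / INR i) <= - ln (1 - z).
Proof.
pose f n x := \rsum_(1 <= i < n) (x ^ i / INR i).
pose g n x := \rsum_(1 <= i < n) x ^ i.-1.
have Df m x : is_derive (f m) x (g m x).
  elim: m => [|m IH].
    apply: (is_derive_ext (fun=> 0)); first by move=> t; rewrite /f big_geq.
    by rewrite /g big_geq //; exact: is_derive_const.
  case: m IH => [|m] IH.
    apply: (is_derive_ext (fun=> 0)); first by move=> t; rewrite /f big_geq.
    by rewrite /g big_geq //; exact: is_derive_const.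
  apply: (is_derive_ext (fun x => f m.+1 x + x ^ m.+1 / INR m.+1)).
    by move=> t; rewrite /f [RHS]rsum_recr.
  rewrite /g rsum_recr //; apply: (is_derive_plus (f m.+1)) => //.
  auto_derive => //; rewrite /=; have := @INR_gt0 m.+1 isT; rewrite /= => h; field; lra.
have Dl x : x < 1 -> is_derive (fun x => - ln (1 - x)) x (/ (1 - x)).
  by move=> hx; auto_derive; [lra|field; lra].
have [c [hc hz]] : exists c, 0 <= c <= z /\ (- ln (1 - z) - f n z) - (- ln (1 - 0) - f n 0) =
   (/ (1 - c) - g n c) * (z - 0).
  have := @MVT_gen (fun x => - ln (1 - x) - f n x) 0 z (fun x => / (1 - x) - g n x).
  rewrite Rmin_left ?Rmax_right; try lra.
  have D x : x < 1 -> is_derive (fun x => - ln (1 - x) - f n x) x (/ (1 - x) - g n x).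
    by move=> hx; apply: (is_derive_minus (fun x => - ln (1 - x)) (f n)); [exact: Dl|exact: Df].
  case=> [x hx|x hx|c [hc e]]; [apply: D; lra| |by exists c].
  by apply: (is_derive_continuity_pt (l := / (1 - x) - g n x)); apply: D; lra.
have f0 : f n 0 = 0.
  rewrite /f big_nat_cond big1 // => i /andP[/andP[hi _] _].
  by rewrite pow_i; [lra|apply/ltP].
rewrite f0 (Rminus_0_r 1) ln_1 in hz.
suff : 0 <= / (1 - c) - g n c by rewrite -/(f n z); nra.
have e : g n c * (1 - c) <= 1.
  rewrite /g big_add1; elim: (n.-1) => [|m IH]; first by rewrite big_geq //; lra.
  have E : (\rsum_(0 <= i < m.+1) c ^ i.+1.-1) * (1 - c) = 1 - c ^ m.+1.
    elim: m {IH} => [|m IH]; first by rewrite rsum_recr // big_geq //=; lra.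
    by rewrite rsum_recr // Rmult_plus_distr_r IH /=; lra.
  by rewrite E; have := pow_le c m.+1 ltac:(lra); lra.
apply: (Rmult_le_reg_r (1 - c)); first lra.
by rewrite Rmult_0_l Rmult_minus_distr_r Rinv_l; lra.
Qed.

Lemma mertens_abel L : \rsum_(0 <= i < L.+1) (z ^ i * (mertens_sum i.+1 - mertens_sum i)) =
  (\rsum_(1 <= i < L.+1) (z ^ i / INR i)) +
  (\rsum_(0 <= i < L) ((z ^ i - z ^ i.+1) * (mertens_sum i.+1 - harm i))) +
    z ^ L * (mertens_sum L.+1 - harm L).
Proof.
elim: L => [|L IH].
  have m0 : mertens_sum 0 = 0.
    by rewrite /mertens_sum expn0 (@rsum_recr_cond 0 1) // (@rsum_recr_cond 0 0) // big_geq //=;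
      lra.
  have h0 : harm 0 = 0 by rewrite /harm big_geq.
  by rewrite rsum_recr // !big_geq // m0 h0; lra.
rewrite rsum_recr // IH [\rsum_(1 <= i < L.+2) _]rsum_recr // [\rsum_(0 <= i < L.+1) _]rsum_recr //.
by rewrite harm_recr; field; have := @INR_gt0 L.+1 isT; lra.
Qed.

(** L tends to infinity in zeta_euler, whose exponent mertens_abel and log_series
    rearrange.  The finitely many exceptional i < I cost the factor
    exp ((M - k) (1 - z^I)), which tends to 1 as d -> 0. *)
Lemma mertens_abscissa I k M : k <= M ->
  (forall i, (i < I)%N -> mertens_sum i.+1 - harm i <= M) ->
  (forall i, (I <= i)%N -> mertens_sum i.+1 - harm i <= k) ->
  (1 - z) / d <= exp (k + (M - k) * (1 - z ^ I)).
Proof.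
move=> kM H1 H2.
have zp i : 0 < z ^ i by apply: pow_lt; lra.
have H L : (I <= L)%N -> (1 - z ^ L.+1) / d <= / (1 - z) * exp (k + (M - k) * (1 - z ^ I)).
  move=> hL; apply: Rle_trans (zeta_euler L.+1) _.
  have -> : / (1 - z) = exp (- ln (1 - z)).
    by rewrite -ln_Rinv ?exp_ln //; [apply: Rinv_0_lt_compat|]; lra.
  rewrite -exp_plus.
  have h : \rsum_(0 <= i < L.+1) (z ^ i * (mertens_sum i.+1 - mertens_sum i)) <=
    - ln (1 - z) + (k + (M - k) * (1 - z ^ I)).
    rewrite mertens_abel; have := log_series L.+1.
    have t1 m n : (m <= n)%N -> \rsum_(m <= i < n) (z ^ i - z ^ i.+1) = z ^ m - z ^ n.
      move=> hmn; have := @rsum_telescope m n (fun i => - z ^ i) hmn.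
      by rewrite (eq_bigr (fun i => z ^ i - z ^ i.+1)) => [->|i _]; lra.
    have zd i : 0 <= z ^ i - z ^ i.+1 by have := zp i; rewrite /=; nra.
    rewrite (@rsum_cat 0 I L) //.
    have a : \rsum_(0 <= i < I) ((z ^ i - z ^ i.+1) * (mertens_sum i.+1 - harm i)) <=
      (1 - z ^ I) * M.
      rewrite -(t1 0%N I) // -rsum_scalr; apply: rsum_le => i /andP[_ hi] _.
      by apply: Rmult_le_compat_l; [exact: zd|exact: H1].
    have b : \rsum_(I <= i < L) ((z ^ i - z ^ i.+1) * (mertens_sum i.+1 - harm i)) <=
      (z ^ I - z ^ L) * k.
      rewrite -(t1 I L) // -rsum_scalr; apply: rsum_le => i /andP[hi _] _.
      by apply: Rmult_le_compat_l; [exact: zd|exact: H2].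
    have c : z ^ L * (mertens_sum L.+1 - harm L) <= z ^ L * k.
      by apply: Rmult_le_compat_l; [exact: Rlt_le|exact: H2].
    lra.
  by case: h => [/exp_increasing|->]; lra.
set C := exp _ in H *.
apply: Rnot_lt_le => hlt.
have C0 : 0 < C by exact: exp_pos.
pose e := 1 - d * (/ (1 - z) * C).
have e0 : 0 < e.
  rewrite /e; have : C * (d / (1 - z)) < (1 - z) / d * (d / (1 - z)).
    by apply: Rmult_lt_compat_r => //; apply: Rdiv_lt_0_compat; lra.
  have -> : (1 - z) / d * (d / (1 - z)) = 1 by field; lra.
  rewrite /Rdiv; lra.
have [n Hn] := pow_lt_1_zero z ltac:(rewrite Rabs_pos_eq; lra) e e0.
have := Hn (maxn n I).+1 ltac:(apply/leP; rewrite ltnW // ltnS leq_maxl).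
have := H (maxn n I) (leq_maxr _ _); have := zp (maxn n I).+1.
move: (z ^ _) => y hy h; rewrite Rabs_pos_eq; last lra.
have : (1 - y) <= d * (/ (1 - z) * C).
  have -> : 1 - y = d * ((1 - y) / d) by field; lra.
  by apply: Rmult_le_compat_l; lra.
by move=> h1 /(_ isT); rewrite /e; lra.
Qed.
End ZetaEuler.

(** If this failed at i, then by mertens_incr mertens_sum (j + 1) - harm j would stay
    below ln ln 2 by a fixed amount for all j >= i; but (1 - z) / d tends to ln 2 as
    d -> 0, contradicting mertens_abscissa. *)
Lemma mertens3 i : harm i + ln (ln 2) - 8 / ln 2 / INR i.+1 <= mertens_sum i.+1.
Proof.
apply: Rnot_lt_le => hlt; have l2 := ln2_gt0; have l1 := ln2_lt1.
pose eta := harm i + ln (ln 2) - 8 / ln 2 / INR i.+1 - mertens_sum i.+1.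
have eta0 : 0 < eta by rewrite /eta; lra.
pose k := ln (ln 2) - eta.
(* A crude bound for the finitely many indices below i. *)
pose M := Rabs k + \rsum_(0 <= j < i) Rabs (mertens_sum j.+1 - harm j).
have s0 : 0 <= \rsum_(0 <= j < i) Rabs (mertens_sum j.+1 - harm j).
  by apply: rsum_ge0 => j _ _; exact: Rabs_pos.
have kM : k <= M by rewrite /M; have := Rle_abs k; lra.
have H1 j : (j < i)%N -> mertens_sum j.+1 - harm j <= M.
  move=> hj; apply: Rle_trans (Rle_abs _) _; rewrite /M.
  have := Rabs_pos k; suff : Rabs (mertens_sum j.+1 - harm j) <= \rsum_(0 <=
    j < i) Rabs (mertens_sum j.+1 - harm j) by lra.
  rewrite (@rsum_cat 0 j.+1) // rsum_recr //.
  have : 0 <= \rsum_(0 <= j < j) Rabs (mertens_sum j.+1 - harm j) by apply: rsum_ge0 => m _ _;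
    exact: Rabs_pos.
  have : 0 <= \rsum_(j.+1 <= j < i) Rabs (mertens_sum j.+1 - harm j) by apply: rsum_ge0 =>
    m _ _; exact: Rabs_pos.
  by lra.
have H2 j : (i <= j)%N -> mertens_sum j.+1 - harm j <= k.
  by move=> /mertens_incr; rewrite /k /eta; lra.
pose B := 1 + (M - k) * INR i.
have B0 : 0 < B by rewrite /B; have := pos_INR i; nra.
have key d : 0 < d -> ln (ln 2) <= k + B * (d * ln 2).
  move=> d0; have := mertens_abscissa d0 kM H1 H2.
  set z := Rpower 2 (- d).
  have u0 : 0 < d * ln 2 by exact: Rmult_lt_0_compat.
  have ez : z = exp (- (d * ln 2)) by rewrite /z /Rpower; congr exp; ring.
  have h1 : ln 2 / (1 + d * ln 2) <= (1 - z) / d.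
    have := inv_1_exp u0; rewrite -ez => h.
    have -> : ln 2 / (1 + d * ln 2) = (d * ln 2 / (1 + d * ln 2)) / d by field; lra.
    by apply: Rmult_le_compat_r => //; apply: Rlt_le; apply: Rinv_0_lt_compat.
  have h2 : 1 - z ^ i <= INR i * (d * ln 2).
    have -> : z ^ i = exp (- (INR i * (d * ln 2))).
      by rewrite ez -Rpower_pow; [rewrite /Rpower ln_exp; congr exp; ring|exact: exp_pos].
    by have := exp_ineq1_le (- (INR i * (d * ln 2))); lra.
  move=> h3; have h4 := Rle_trans _ _ _ h1 h3.
  have h5 := ln_le _ _ (Rdiv_lt_0_compat (ln 2) (1 + d * ln 2) l2 ltac:(lra)) h4.
  rewrite ln_exp ln_div in h5; [|lra|lra].
  have := @ln_le_sub1 (1 + d * ln 2) ltac:(lra) => h6.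
  have : (M - k) * (1 - z ^ i) <= (M - k) * (INR i * (d * ln 2)) by apply: Rmult_le_compat_l; lra.
  by rewrite /B; lra.
have := key (eta / (2 * B)) ltac:(apply: Rdiv_lt_0_compat; lra).
have -> : B * (eta / (2 * B) * ln 2) = eta / 2 * ln 2 by field; lra.
rewrite /k; nra.
Qed.

Lemma harm_ge_ln n : ln (INR n.+1) <= harm n.
Proof.
elim: n => [|n IH]; first by rewrite /harm big_geq // ln_1; lra.
rewrite harm_recr; apply: Rle_trans (Rplus_le_compat_r _ _ _ IH).
have n0 := @INR_gt0 n.+1 isT; have n1 := @INR_gt0 n.+2 isT.
have := @ln_le_sub1 (INR n.+2 / INR n.+1); rewrite ln_div // => h.
have := h (Rdiv_lt_0_compat _ _ n1 n0); rewrite (S_INR n.+1).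
have -> : (INR n.+1 + 1) / INR n.+1 = 1 + / INR n.+1 by field; lra.
lra.
Qed.

(** The sequence defining Euler's constant decreases to it. *)
Lemma gamma_le n : euler_gamma + ln (INR n.+1) <= harm n.+1.
Proof.
pose u n := harm n.+1 - ln (INR n.+1).
have ud m : u m.+1 <= u m.
  rewrite /u (harm_recr m.+1).
  have n0 := @INR_gt0 m.+1 isT; have n1 := @INR_gt0 m.+2 isT.
  have := @ln_le_sub1 (INR m.+1 / INR m.+2); rewrite ln_div // => h.
  have := h (Rdiv_lt_0_compat _ _ n0 n1).
  have -> : INR m.+1 / INR m.+2 - 1 = - / INR m.+2 by rewrite (S_INR m.+1); field;
    rewrite -S_INR; lra.
  lra.
have ex : ex_finite_lim_seq u.
  apply: (ex_finite_lim_seq_decr u 0) => // m; rewrite /u.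
  have := harm_ge_ln m.+1; have : ln (INR m.+1) <= ln (INR m.+2); last lra.
  by apply: ln_le; [exact: INR_gt0|exact: INR_leq].
have -> : euler_gamma = real (Lim_seq u).
  rewrite /euler_gamma -Lim_seq_incr_1; congr real; apply: Lim_seq_ext => m; rewrite /u;
    congr (_ - _).
  elim: m => [|m IH]; first by rewrite sum_n_n /harm rsum_recr // big_geq //= Rplus_0_l.
  by rewrite sum_n_Sm ?IH 1?(harm_recr m.+1) //; apply/leP.
have := is_lim_seq_decr_compare u _ (Lim_seq_correct' u ex) ud n; rewrite /u; lra.
Qed.

Definition mertens_const := 8 / ln 2 + 1.

Lemma mertens3_gamma J : (0 < J)%N ->
  euler_gamma + ln (INR J * ln 2) - mertens_const / INR J <= mertens_sum J.
Proof.
case: J => [//|J] _; have := mertens3 J; have := gamma_le J; rewrite harm_recr.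
have J0 := @INR_gt0 J.+1 isT; have l2 := ln2_gt0.
rewrite ln_mult // /mertens_const /Rdiv Rmult_plus_distr_r; lra.
Qed.

(** * Weights of the resonator and of the zeta function *)

Lemma inv_sub_Rpower x d : 0 < x -> / x - Rpower x (- (1 + d)) <= d * (ln x / x).
Proof.
move=> hx; rewrite Ropp_plus_distr Rpower_plus Rpower_Ropp Rpower_1 //.
have i0 := Rinv_0_lt_compat _ hx.
have -> : / x - / x * Rpower x (- d) = (1 - Rpower x (- d)) * / x by ring.
have -> : d * (ln x / x) = d * ln x * / x by rewrite /Rdiv; ring.
apply: Rmult_le_compat_r; first lra.
by rewrite /Rpower; have := exp_ineq1_le (- d * ln x); lra.
Qed.

Lemma Rpower_le_inv x d : 0 <= d -> 1 <= x -> Rpower x (- (1 + d)) <= / x.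
Proof.
move=> hd hx; rewrite -{2}(Rpower_1 x); last lra.
rewrite -Rpower_Ropp /Rpower.
have : - (1 + d) * ln x <= - (1) * ln x by have := ln_ge0 hx; nra.
by case=> [/exp_increasing|->]; lra.
Qed.

(** Since 1/p - p^(-1-d) <= d ln p / p, the first theorem of Mertens with d = 1/J
    gives O(1). *)
Lemma sum_small_primes J : (0 < J)%N ->
  \rsum_(0 <= p < (2 ^ J).+1 | prime p) (/ INR p - Rpower (INR p) (- (1 + / INR J))) <= 3.
Proof.
move=> hJ; have J0 := INR_gt0 hJ; have j0 := Rinv_0_lt_compat _ J0.
apply: Rle_trans (_ : / INR J * log_over_p J <= _).
  rewrite /log_over_p -rsum_scal; apply: rsum_le => p _ hp; apply: inv_sub_Rpower.
  by have := INR_prime_ge2 hp; lra.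
have := log_over_p_le J => h; have l1 := ln2_lt1.
have j1 : / INR J <= 1 by rewrite -Rinv_1; apply: Rinv_le_contravar; [lra|exact: INR_ge1].
apply: Rle_trans (Rmult_le_compat_l _ _ _ (Rlt_le _ _ j0) h) _.
have -> : / INR J * (INR J * ln 2 + 2) = ln 2 + 2 * / INR J by field; lra.
lra.
Qed.

(** On the i-th block p^(-1-1/J) sums to O(2^(-i/J) / i), and for i >= J this is
    dominated by a geometric series of ratio 2^(-1/J), divided by J. *)
Lemma sum_large_primes J L : (0 < J)%N -> (J <= L)%N ->
  \rsum_((2 ^ J).+1 <= p < (2 ^ L).+1 | prime p) Rpower (INR p) (- (1 + / INR J)) <= 8 / ln 2.
Proof.
move=> hJ hL; have J0 := INR_gt0 hJ; have j0 := Rinv_0_lt_compat _ J0.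
have l1 := ln2_lt1; have l0 := ln2_gt0.
set d := / INR J in j0 *; pose z := Rpower 2 (- d).
have z0 : 0 < z by exact: exp_pos.
have u0 : 0 < d * ln 2 by nra.
have z1 : d * ln 2 / (1 + d * ln 2) <= 1 - z.
  by have := inv_1_exp u0; rewrite /z /Rpower; have -> : - d * ln 2 = - (d * ln 2) by ring.
have q0 : 0 < d * ln 2 / (1 + d * ln 2) by apply: Rdiv_lt_0_compat; lra.
have H : \rsum_((2 ^ J).+1 <= p < (2 ^ L).+1 | prime p) Rpower (INR p) (- (1 + d)) <=
   \rsum_(J <= i < L) (4 * d * z ^ i).
  elim: L hL => [|L IH]; first by rewrite leqn0 => /eqP ->; rewrite !big_geq //; lra.
  rewrite leq_eqVlt => /orP[/eqP ->|hL]; first by rewrite !big_geq //; lra.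
  rewrite [X in _ <= X]rsum_recr //.
  rewrite (@rsum_cat _ (2 ^ L).+1); [|by rewrite ltnS leq_exp2l|by rewrite ltnS leq_exp2l].
  apply: Rplus_le_compat; first exact: IH.
  apply: Rle_trans (_ : (/ 2 ^ L * z ^ L) * (4 * 2 ^ L / INR L.+1) <= _).
    have := block_count L => h.
    have p0 : 0 < / 2 ^ L * z ^ L.
      by apply: Rmult_lt_0_compat; [apply: Rinv_0_lt_compat|]; apply: pow_lt; lra.
    apply: Rle_trans (Rmult_le_compat_l _ _ _ (Rlt_le _ _ p0) h); rewrite -rsum_scal.
    apply: rsum_le => p /andP[hp _] pp; rewrite Rmult_1_r.
    have N0 : (0 < 2 ^ L)%N by rewrite expn_gt0.
    rewrite -Rpower_2pow -INR_pow2 -Rpower_succ //; apply: Rpower_opp_le; first lra.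
      exact: INR_gt0.
    exact: INR_leq (ltnW hp).
  have p2 : 0 < 2 ^ L by apply: pow_lt; lra.
  have L1 : 0 < INR L.+1 by exact: INR_gt0.
  have -> : / 2 ^ L * z ^ L * (4 * 2 ^ L / INR L.+1) = 4 * / INR L.+1 * z ^ L by field; lra.
  apply: Rmult_le_compat_r; first by apply: pow_le; lra.
  suff : / INR L.+1 <= d by lra.
  by apply: Rinv_le_contravar => //; apply: INR_leq; exact: leqW.
apply: Rle_trans H _; rewrite rsum_scal.
have G : (1 - z) * (\rsum_(J <= i < L) z ^ i) <= 1.
  rewrite -rsum_scal; have := @rsum_telescope J L (fun i => - z ^ i) hL.
  rewrite (eq_bigr (fun i => (1 - z) * z ^ i)) => [->|i _]; last by rewrite /=; ring.
  have a0 : 0 <= z ^ L by apply: pow_le; lra.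
  have : z ^ J <= 1 by rewrite -(pow1 J); apply: pow_incr; lra.
  lra.
have s0 : 0 <= \rsum_(J <= i < L) z ^ i by apply: rsum_ge0 => i _ _; apply: pow_le; lra.
move: G s0; move: (bigop.body _ _ _) => s G s0.
have d1 : d <= 1 by rewrite /d -Rinv_1; apply: Rinv_le_contravar; [lra|exact: INR_ge1].
have : d * ln 2 / (1 + d * ln 2) * s <= 1 by nra.
move=> h; apply: (Rmult_le_reg_l (ln 2)) => //.
have -> : ln 2 * (8 / ln 2) = 8 by field; lra.
have -> : ln 2 * (4 * d * s) = 4 * (1 + d * ln 2) * (d * ln 2 / (1 + d * ln 2) * s) by field; lra.
nra.
Qed.

(** The value r(p)/p = 1/p - 1/X at the primes that the resonator uses. *)
Definition res_weight q J p : R :=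
  if [&& (p <= 2 ^ J)%N, prime p & ~~ (p %| q)] then / INR p - / 2 ^ J else 0.
Definition zeta_weight q d L p : R :=
  if [&& (p <= 2 ^ L)%N, prime p & ~~ (p %| q)] then Rpower (INR p) (- (1 + d)) else 0.
(** Interpolates from zeta_weight (i = 0) to res_weight (i > 2^L), one prime at a
    time. *)
Definition hyb_weight q J d L i p : R := if (p < i)%N then res_weight q J p else zeta_weight q d
  L p.

Lemma res_weight_bounds q J p : 0 <= res_weight q J p <= / 2.
Proof.
rewrite /res_weight; case: ifP => [/and3P[h1 h2 _]|_]; last lra.
have p2 := INR_prime_ge2 h2; have X0 : 0 < 2 ^ J by apply: pow_lt; lra.
have h := INR_leq h1; rewrite INR_pow2 in h.
have := Rinv_le_contravar _ _ _ h; have := Rinv_le_contravar 2 (INR p).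
have := Rinv_0_lt_compat _ X0; lra.
Qed.

Lemma zeta_weight_bounds q d L p : 0 < d -> 0 <= zeta_weight q d L p <= / 2.
Proof.
move=> d0; rewrite /zeta_weight; case: ifP => [/and3P[_ h2 _]|_]; last lra.
split; first exact: Rlt_le (Rpower_gt0 _ _).
exact: Rpower_prime_half.
Qed.

Lemma hyb_weight_bounds q J d L i p : 0 < d -> 0 <= hyb_weight q J d L i p <= / 2.
Proof. by move=> d0; rewrite /hyb_weight; case: ifP => _;
  [exact: res_weight_bounds|exact: zeta_weight_bounds]. Qed.

Lemma res_weight_admissible q J L : (J <= L)%N -> admissible (res_weight q J) (2 ^ L).+1.
Proof.
move=> h; split=> p; first by have := res_weight_bounds q J p; lra.
move=> hp; rewrite /res_weight; case: ifP => // /and3P[h1 _ _].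
by have : (2 ^ J <= 2 ^ L)%N; [rewrite leq_exp2l|lia].
Qed.

Lemma hyb_weight_admissible q J d L i : 0 < d -> (J <= L)%N ->
  admissible (hyb_weight q J d L i) (2 ^ L).+1.
Proof.
move=> d0 h; split=> p; first by have := hyb_weight_bounds q J L i p d0; lra.
move=> hp; have := (res_weight_admissible q h).2 p hp; rewrite /hyb_weight => ->.
by case: ifP => // _; rewrite /zeta_weight leqNgt hp.
Qed.

(** Iterating the inequality along x, px, p^2 x, .. with ratio at most 1/2. *)
Lemma contraction_bound (Q : nat -> bool) (D : nat -> R) p c e D0 :
  0 <= c <= / 2 -> (forall x, Q x -> Q (p * x)%N) ->
  (forall x, Q x -> Rabs (D x) <= D0) ->
  (forall x, Q x -> Rabs (D x) <= c * Rabs (D (p * x)%N) + e) ->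
  forall x, Q x -> Rabs (D x) <= 2 * e.
Proof.
move=> hc HQ H0 H x Qx.
have D00 : 0 <= D0 by apply: Rle_trans (H0 _ Qx); exact: Rabs_pos.
have It n : forall x, Q x -> Rabs (D x) <= (/ 2) ^ n * D0 + 2 * e.
  elim: n => [|n IH] y Qy /=; first by have := H0 y Qy; have := H y Qy; have := H0 _ (HQ _ Qy);
    have := Rabs_pos (D (p * y)%N); have := Rabs_pos (D y); nra.
  have := H y Qy; have := IH _ (HQ _ Qy); have := Rabs_pos (D (p * y)%N).
  by nra.
apply: Rnot_lt_le => hlt.
have [n Hn] := pow_lt_1_zero (/ 2) ltac:(rewrite Rabs_pos_eq; lra)
  ((Rabs (D x) - 2 * e) / (D0 + 1)) ltac:(apply: Rdiv_lt_0_compat; lra).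
have := Hn n (le_n n); have := It n x Qx.
have q0 : 0 < (/ 2) ^ n by apply: pow_lt; lra.
rewrite (Rabs_pos_eq ((/ 2) ^ n)); last lra.
move=> h1 h2; have : (/ 2) ^ n * (D0 + 1) < Rabs (D x) - 2 * e.
  have -> : Rabs (D x) - 2 * e = (Rabs (D x) - 2 * e) / (D0 + 1) * (D0 + 1) by field; lra.
  by apply: Rmult_lt_compat_r; lra.
by nra.
Qed.

Lemma coprime_prime_mul q p x : prime p -> ~~ (p %| q) -> coprime x q -> coprime (p * x) q.
Proof. by move=> hp hq hx; rewrite coprimeMl prime_coprime // hq. Qed.

Lemma tsum_abs w Y f B : admissible w Y -> (forall k, Rabs (f k) <= B) ->
  Rabs (tsum w f) <= B * euler_prod w Y.
Proof.
move=> H Hf; have c := is_lim_seq_abs _ _ (psum_cv H Hf).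
have := is_lim_seq_le _ (fun=> B * euler_prod w Y) (Rbar_abs (tsum w f)) (B * euler_prod w Y) _
  c (is_lim_seq_const _).
by apply=> n; exact: psum_abs.
Qed.

(** * Equidistribution modulo q *)

(** Let D(x) be the difference of the two sums twisted by x.  The recursion at p
    applied to both weights, which agree away from p, gives
    D(x) = w'(p) D(px) + (w'(p) - w(p)) (sum for w twisted by px),
    so D is controlled by contraction_bound. *)
Lemma tsum_change_weight w w' Y q p (f : nat -> R) Bf B :
  admissible w Y -> admissible w' Y -> prime p -> ~~ (p %| q) ->
  (forall r, r <> p -> w r = w' r) -> w' p <= / 2 -> (forall k, Rabs (f k) <= Bf) ->
  (forall x, coprime x q -> Rabs (tsum w (fun k => f (k * x)%N)) <= B) ->
  forall x, coprime x q ->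
  Rabs (tsum w' (fun k => f (k * x)%N)) <= B * (1 + 2 * Rabs (w' p - w p)).
Proof.
move=> aw aw' hp hpq E h2 Hf HB x hx.
pose D x := tsum w' (fun k => f (k * x)%N) - tsum w (fun k => f (k * x)%N).
have Hf' y k : Rabs (f (k * y)%N) <= Bf by exact: Hf.
have rec w1 y : admissible w1 Y -> tsum w1 (fun k => f (k * y)%N) =
    tsum (upd w1 p 0) (fun k => f (k * y)%N) + w1 p * tsum w1 (fun k => f (k * (p * y))%N).
  move=> a1; rewrite (tsum_upd_self a1 hp (Hf' y)); congr (_ + _ * _).
  by apply: tsum_eq => // k _; congr f; lia.
have eu y : tsum (upd w' p 0) (fun k => f (k * y)%N) = tsum (upd w p 0) (fun k => f (k * y)%N).
  by apply: tsum_eq => // r _; rewrite /upd; case: eqP => // /E ->.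
have eD y : D y = w' p * D (p * y)%N + (w' p - w p) * tsum w (fun k => f (k * (p * y))%N).
  by rewrite /D (rec w') // (rec w y) // eu; ring.
have [a1 _] := aw' ; have [a2 _] := a1 p.
have step : forall y, coprime y q -> Rabs (D y) <= 2 * (Rabs (w' p - w p) * B).
  apply: (@contraction_bound (fun y =>
    coprime y q) D p (w' p) _ (Bf * euler_prod w' Y + Bf * euler_prod w Y)).
  - by move: a2; lra.
  - by move=> y; exact: coprime_prime_mul.
  - move=> y _; apply: Rle_trans (Rabs_triang _ _) _; rewrite Rabs_Ropp.
    by apply: Rplus_le_compat; apply: tsum_abs.
  - move=> y hy; rewrite {1}eD; apply: Rle_trans (Rabs_triang _ _) _.
    rewrite !Rabs_mult (Rabs_pos_eq (w' p)); last by move: a2; lra.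
    apply: Rplus_le_compat_l; apply: Rmult_le_compat_l; first exact: Rabs_pos.
    by apply: HB; exact: coprime_prime_mul.
have -> : tsum w' (fun k => f (k * x)%N) = D x + tsum w (fun k => f (k * x)%N) by rewrite /D; ring.
apply: Rle_trans (Rabs_triang _ _) _; have := step x hx; have := HB x hx; lra.
Qed.

Lemma hyb_weight_succ_other q J d L i r : r <> i ->
  hyb_weight q J d L i r = hyb_weight q J d L i.+1 r.
Proof.
move=> h; rewrite /hyb_weight; have -> // : (r < i.+1)%N = (r < i)%N.
by rewrite ltnS leq_eqVlt; case: eqP.
Qed.

Lemma tsum_abs_ge0 (Q : R) w f : Rabs (tsum w f) <= Q -> 0 <= Q.
Proof. exact: Rle_trans (Rabs_pos _). Qed.

Lemma tsum_hyb_weight q J d L (f : nat -> R) Bf B : 0 < d -> (J <= L)%N ->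
  (forall k, Rabs (f k) <= Bf) ->
  (forall x, coprime x q -> Rabs (tsum (zeta_weight q d L) (fun k => f (k * x)%N)) <= B) ->
  forall i x, coprime x q -> Rabs (tsum (hyb_weight q J d L i) (fun k => f (k * x)%N)) <=
     B * exp (2 * \rsum_(0 <= p < i | prime p) Rabs (res_weight q J p - zeta_weight q d L p)).
Proof.
move=> d0 hJL Hf HB; elim=> [|i IH] x hx.
  rewrite big_geq // Rmult_0_r exp_0 Rmult_1_r.
  by rewrite (@tsum_eq _ (zeta_weight q d L) _ (fun k => f (k * x)%N)) //; exact: HB.
rewrite rsum_recr_cond //.
case: ifP => hi; last first.
  rewrite Rplus_0_r; apply: Rle_trans (IH x hx); apply: Req_le; congr Rabs;
    apply: tsum_eq => // p hp.
  by rewrite -hyb_weight_succ_other // => e; rewrite -e hp in hi.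
set s := bigop.body _ _ _ in IH *.
have B0 : 0 <= B * exp (2 * s) by apply: tsum_abs_ge0 (IH x hx).
case: (boolP (i %| q)) => hiq.
  apply: Rle_trans (_ : B * exp (2 * s) <= _).
    apply: Rle_trans (IH x hx); apply: Req_le; congr Rabs; apply: tsum_eq => // p hp.
    rewrite /hyb_weight; case: (ltngtP p i) => h; first by rewrite ltnS ltnW.
      by rewrite ltnS leqNgt h.
    by rewrite h ltnSn /zeta_weight /res_weight hiq !andbF.
  rewrite Rmult_plus_distr_l exp_plus -Rmult_assoc -{1}(Rmult_1_r (B * _)).
  apply: Rmult_le_compat_l => //; rewrite -exp_0.
  have : 0 <= 2 * Rabs (res_weight q J i - zeta_weight q d L i) by have := Rabs_pos (res_weight
    q J i - zeta_weight q d L i); lra.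
  by case=> [/exp_increasing|<-]; lra.
apply: Rle_trans (tsum_change_weight (w := hyb_weight q J d L i) (Y := (2 ^ L).+1) (p := i) _ _
  hi hiq _ _ Hf IH hx) _.
- exact: hyb_weight_admissible.
- exact: hyb_weight_admissible.
- by move=> r /hyb_weight_succ_other.
- by have := hyb_weight_bounds q J L i.+1 i d0; lra.
rewrite {1 2}/hyb_weight ltnSn ltnn (Rmult_plus_distr_l 2 s) exp_plus -Rmult_assoc.
apply: Rmult_le_compat_l => //.
by have := exp_ineq1_le (2 * Rabs (res_weight q J i - zeta_weight q d L i)); lra.
Qed.

(** Here 67 = 3 + 64 comes from sum_small_primes and prime_count, 8 / ln 2 from
    sum_large_primes, and the factor 2 from tsum_change_weight. *)
Definition distance_const := 2 * (67 + 8 / ln 2).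

(** Primes up to 2^J: 1/p versus p^(-1-1/J), plus 1/X for each of the O(X / J)
    primes.  Larger primes: only p^(-1-1/J) is left. *)
Lemma weight_distance q J L : (0 < J)%N -> (J <= L)%N ->
  2 * (\rsum_(0 <= p < (2 ^ L).+1 | prime p) Rabs (res_weight q J p - zeta_weight q (/ INR J) L
    p)) <= distance_const.
Proof.
move=> hJ hL; rewrite /distance_const; apply: Rmult_le_compat_l; first lra.
have X0 : 0 < 2 ^ J by apply: pow_lt; lra.
have J0 := INR_gt0 hJ; have j0 := Rinv_0_lt_compat _ J0.
have hJL : (2 ^ J <= 2 ^ L)%N by rewrite leq_exp2l.
rewrite (@rsum_cat 0 (2 ^ J).+1) //.
have A : \rsum_(0 <= p < (2 ^ J).+1 | prime p) Rabs (res_weight q J p - zeta_weight q (/ INR J)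
  L p) <= 3 + 64.
  apply: Rle_trans (_ : (\rsum_(0 <=
    p < (2 ^ J).+1 | prime p) (/ INR p - Rpower (INR p) (- (1 + / INR J)))) +
     / 2 ^ J * (\rsum_(0 <= p < (2 ^ J).+1 | prime p) 1) <= _).
    rewrite -rsum_scal -rsum_add; apply: rsum_le => p /andP[_ hp] pp.
    have p2 := INR_prime_ge2 pp.
    have a := @Rpower_le_inv (INR p) (/ INR J) (Rlt_le _ _ j0) ltac:(lra).
    have x0 := Rinv_0_lt_compat _ X0.
    rewrite /res_weight /zeta_weight pp /= -ltnS hp (leq_trans _ hJL) //=; case: ifP => _;
      last first.
      by rewrite Rminus_diag Rabs_R0; lra.
    have -> : / INR p - / 2 ^ J - Rpower (INR p) (- (1 + / INR J)) =
      (/ INR p - Rpower (INR p) (- (1 + / INR J))) + - / 2 ^ J by ring.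
    apply: Rle_trans (Rabs_triang _ _) _; rewrite Rabs_Ropp !Rabs_pos_eq; lra.
  have := sum_small_primes hJ.
  have x0 := Rinv_0_lt_compat _ X0.
  have := Rmult_le_compat_l _ _ _ (Rlt_le _ _ x0) (prime_count hJ).
  have -> : / 2 ^ J * (64 * (2 ^ J / INR J)) = 64 * / INR J by field; lra.
  have j1 : / INR J <= 1 by rewrite -Rinv_1; apply: Rinv_le_contravar; [lra|exact: INR_ge1].
  lra.
have Bd : \rsum_((2 ^ J).+1 <= p < (2 ^ L).+1 | prime p) Rabs (res_weight q J p - zeta_weight q
  (/ INR J) L p) <= 8 / ln 2.
  apply: Rle_trans (sum_large_primes hJ hL); apply: rsum_le => p /andP[hp _] pp.
  rewrite /res_weight leqNgt hp /= Rminus_0_l Rabs_Ropp /zeta_weight.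
  have r0 := Rpower_gt0 (INR p) (- (1 + / INR J)).
  by case: ifP => _; rewrite Rabs_pos_eq; lra.
lra.
Qed.

Lemma periodic_psum q (F : nat -> R) B : (0 < q)%N -> (forall k, F (k + q)%N = F k) ->
  \rsum_(0 <= k < q) F k = 0 -> (forall k, Rabs (F k) <= B) ->
  forall N, Rabs (\rsum_(0 <= k < N) F k) <= INR q * B.
Proof.
move=> hq per mean HB.
have per' m k : F (k + m * q)%N = F k.
  by elim: m => [|m IH]; rewrite ?mul0n ?addn0 // mulSn [(q + _)%N]addnC addnA per IH.
have z m : \rsum_(0 <= k < (m * q)) F k = 0.
  elim: m => [|m IH]; first by rewrite mul0n big_geq.
  rewrite (@rsum_cat 0 (m * q)) ?leq_mul2r ?leqnSn ?orbT // IH Rplus_0_l.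
  rewrite -{1}[(m * q)%N]add0n big_addn mulSn addnK; apply: etrans mean; apply: eq_bigr => k _.
  exact: per'.
move=> N; rewrite {1}(divn_eq N q) (@rsum_cat 0 (N %/ q * q)) ?leq_addr // z Rplus_0_l.
apply: Rle_trans (rsum_abs _ _ _ _) _.
apply: Rle_trans (_ : \rsum_(N %/ q * q <= i < N %/ q * q + N %% q) B <= _).
  by apply: rsum_le => k _ _.
rewrite rsum_const addKn; apply: Rmult_le_compat_r.
  by apply: Rle_trans (HB 0%N); exact: Rabs_pos.
by apply: INR_leq; rewrite ltnW // ltn_mod.
Qed.

Lemma abel_bound (v F : nat -> R) G : (forall k, 0 <= v k) ->
  (forall k, (0 < k)%N -> v k.+1 <= v k) ->
  (forall N, Rabs (\rsum_(1 <= k < N) F k) <= G) ->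
  forall N, Rabs (\rsum_(1 <= k < N) (v k * F k)) <= G * v 1%N.
Proof.
move=> v0 vd HG; have G0 : 0 <= G by apply: Rle_trans (HG 0%N); exact: Rabs_pos.
have E N : \rsum_(1 <= k < N.+1) (v k * F k) =
   (\rsum_(1 <= k < N.+1) ((v k - v k.+1) * \rsum_(1 <= j < k.+1) F j)) +
   v N.+1 * \rsum_(1 <= j < N.+1) F j.
  elim: N => [|N IH]; first by rewrite !big_geq //; ring.
  rewrite rsum_recr // IH [\rsum_(1 <= k < N.+2) (_ * _)]rsum_recr // [\rsum_(1 <=
    j < N.+2) F j]rsum_recr //.
  ring.
case=> [|N]; first by rewrite big_geq // Rabs_R0; exact: Rmult_le_pos.
rewrite E; apply: Rle_trans (Rabs_triang _ _) _.
have a : Rabs (\rsum_(1 <= k < N.+1) ((v k - v k.+1) * \rsum_(1 <= j < k.+1) F j)) <=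
  (v 1%N - v N.+1) * G.
  apply: Rle_trans (rsum_abs _ _ _ _) _.
  have -> : v 1%N - v N.+1 = \rsum_(1 <= k < N.+1) (v k - v k.+1).
    have := @rsum_telescope 1 N.+1 (fun k => - v k) isT.
    by rewrite (eq_bigr (fun k => v k - v k.+1)) => [->|k _]; ring.
  rewrite -rsum_scalr; apply: rsum_le => k /andP[hk _] _; rewrite Rabs_mult.
  have := vd k hk => hv; rewrite Rabs_pos_eq; last lra.
  by apply: Rmult_le_compat_l; [lra|exact: HG].
rewrite Rabs_mult (Rabs_pos_eq (v N.+1)) //.
have := Rmult_le_compat_l _ _ _ (v0 N.+1) (HG N.+1); lra.
Qed.

Lemma zeta_tail d N0 N : 0 < d -> (0 < N0)%N ->
  \rsum_(N0.+1 <= n < N.+1) Rpower (INR n) (- (1 + d)) <= Rpower (INR N0) (- d) / d.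
Proof.
move=> d0 h0.
suff H : forall N, (N0 <= N)%N -> \rsum_(N0.+1 <= n < N.+1) Rpower (INR n) (- (1 + d)) <=
    (Rpower (INR N0) (- d) - Rpower (INR N) (- d)) / d.
  have r0 := Rpower_gt0 (INR N0) (- d); have i0 := Rinv_0_lt_compat _ d0.
  case: (leqP N0 N) => h; last first.
    rewrite big_geq; last by rewrite ltnS ltnW.
    by apply: Rlt_le; apply: Rdiv_lt_0_compat.
  apply: Rle_trans (H _ h) _; have := Rpower_gt0 (INR N) (- d); rewrite /Rdiv; nra.
elim=> [|n IH]; first by rewrite leqn0 => /eqP e; rewrite e in h0.
rewrite leq_eqVlt => /orP[/eqP ->|hn]; first by rewrite big_geq //;
  rewrite Rminus_diag /Rdiv Rmult_0_l; lra.
rewrite rsum_recr //; have {}IH := IH hn.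
have n0 : (0 < n)%N by exact: leq_trans h0 hn.
have a0 := INR_gt0 n0; have a1 := @INR_gt0 n.+1 isT.
suff : Rpower (INR n.+1) (- (1 + d)) <= (Rpower (INR n) (- d) - Rpower (INR n.+1) (- d)) / d.
  rewrite /Rdiv in IH *; lra.
rewrite Rpower_succ //; apply: (Rmult_le_reg_r d) => //.
have -> : (Rpower (INR n) (- d) - Rpower (INR n.+1) (- d)) / d * d =
  Rpower (INR n) (- d) - Rpower (INR n.+1) (- d) by field; lra.
suff : Rpower (INR n.+1) (- d) * (1 + d / INR n.+1) <= Rpower (INR n) (- d).
  rewrite /Rdiv; lra.
apply: Rle_trans (_ : Rpower (INR n.+1) (- d) * exp (d / INR n.+1) <= _).
  apply: Rmult_le_compat_l; first exact: Rlt_le (Rpower_gt0 _ _).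
  by have := exp_ineq1_le (d / INR n.+1); lra.
rewrite /Rpower -exp_plus.
have := @ln_le_sub1 (INR n / INR n.+1); rewrite ln_div // => h.
have := h (Rdiv_lt_0_compat _ _ a0 a1).
have -> : INR n / INR n.+1 - 1 = - / INR n.+1 by rewrite (S_INR n); field; rewrite -S_INR; lra.
move=> h'.
have : - d * ln (INR n.+1) + d / INR n.+1 <= - d * ln (INR n).
  have : d * (/ INR n.+1) <= d * (ln (INR n.+1) - ln (INR n)) by apply: Rmult_le_compat_l; lra.
  rewrite /Rdiv; lra.
by case=> [/exp_increasing|->]; lra.
Qed.

Lemma cmext_zeta_weight_le q d L n : (0 < n)%N -> 0 < d ->
  0 <= cmext (zeta_weight q d L) n <= Rpower (INR n) (- (1 + d)).
Proof.
move=> hn d0; rewrite -cmext_Rpower //; apply: rprod_le => p _ hp.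
have w0 := zeta_weight_bounds q L p d0.
split; first by apply: pow_le; lra.
apply: pow_incr; split; first lra; rewrite /zeta_weight; case: ifP => _; first lra.
exact: Rlt_le (Rpower_gt0 _ _).
Qed.

Lemma cmext_zeta_weight_eq q d L n : (0 < n <= 2 ^ L)%N -> coprime n q ->
  cmext (zeta_weight q d L) n = Rpower (INR n) (- (1 + d)).
Proof.
move=> /andP[hn hnL] hc; rewrite -cmext_Rpower //; apply: cmext_eq => // p hp pn.
rewrite /zeta_weight hp (leq_trans (dvdn_leq hn pn) hnL) /=.
by rewrite -prime_coprime // (coprime_dvdl pn hc).
Qed.

Lemma tsum_le w Y f B C : admissible w Y -> (forall k, Rabs (f k) <= B) ->
  (forall N, Rabs (psum w f N) <= C) -> Rabs (tsum w f) <= C.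
Proof.
move=> H Hf HC; have c := is_lim_seq_abs _ _ (psum_cv H Hf).
exact: (is_lim_seq_le _ (fun=> C) (Rbar_abs (tsum w f)) C HC c (is_lim_seq_const _)).
Qed.

(** Up to 2^L the weight zeta_weight is n^(-1-d) on integers coprime to q, where
    partial summation applies; the level L is taken so high that the tail of
    zeta(1 + d) beyond 2^L is at most 1. *)
Lemma zeta_weight_tsum q d L (F : nat -> R) B : 0 < d -> (0 < q)%N ->
  (forall k, F (k + q)%N = F k) -> \rsum_(0 <= k < q) F k = 0 -> (forall k, Rabs (F k) <= B) ->
  (forall k, ~~ coprime k q -> F k = 0) ->
  Rpower 2 (- d) ^ L / d <= 1 ->
  Rabs (tsum (zeta_weight q d L) F) <= (INR q + 2) * B.
Proof.
move=> d0 hq per mean HB Hc hL.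
have B0 : 0 <= B by apply: Rle_trans (HB 0%N); exact: Rabs_pos.
have aw : admissible (zeta_weight q d L) (2 ^ L).+1 by have := @hyb_weight_admissible q L d L 0
  d0 (leqnn _).
apply: (tsum_le aw HB) => N.
pose v n := Rpower (INR n) (- (1 + d)).
have A : Rabs (\rsum_(1 <= k < N.+1) (v k * F k)) <= (INR q * B + B).
  have -> : INR q * B + B = (INR q * B + B) * v 1%N.
    by rewrite /v /Rpower ln_1 Rmult_0_r exp_0 Rmult_1_r.
  apply: abel_bound => [k|k hk|M]; first exact: Rlt_le (Rpower_gt0 _ _).
    by apply: Rpower_opp_le; [lra|exact: INR_gt0|exact: INR_leq].
  case: M => [|M]; first by rewrite big_geq // Rabs_R0; have := pos_INR q; nra.
  have := periodic_psum hq per mean HB M.+1.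
  rewrite big_ltn //; move: (bigop.body _ _ _) => s h.
  have -> : s = (F 0%N + s) + - F 0%N by ring.
  by apply: Rle_trans (Rabs_triang _ _) _; rewrite Rabs_Ropp; have := HB 0%N; lra.
have D : Rabs (\rsum_(1 <= k < N.+1) ((v k - cmext (zeta_weight q d L) k) * F k)) <= B.
  apply: Rle_trans (rsum_abs _ _ _ _) _.
  apply: Rle_trans (_ : \rsum_(1 <= k < N.+1) (if (2 ^ L < k)%N then v k * B else 0) <= _).
    apply: rsum_le => k /andP[hk _] _; rewrite Rabs_mult.
    have c := @cmext_zeta_weight_le q d L k hk d0; rewrite -/(v k) in c.
    case: ifP => hkL.
      apply: Rmult_le_compat; try exact: Rabs_pos; last exact: HB.
      by rewrite Rabs_pos_eq; lra.
    case: (boolP (coprime k q)) => hc; last by rewrite (Hc k hc) Rabs_R0; lra.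
    by rewrite cmext_zeta_weight_eq // ?hk 1?leqNgt ?hkL // Rminus_diag Rabs_R0; lra.
  have N1 : (0 < 2 ^ L)%N by rewrite expn_gt0.
  rewrite -big_mkcond.
  apply: Rle_trans (_ : \rsum_((2 ^ L).+1 <= k < N.+1) (v k * B) <= _).
    case: (leqP (2 ^ L) N) => h; last first.
      rewrite big_nat_cond big1 ?big_geq //; [lra|by rewrite ltnS ltnW|].
      by move=> k /andP[/andP[_ h1] h2]; lia.
    rewrite (@rsum_cat 1 (2 ^ L).+1) //.
    rewrite [X in X + _]big_nat_cond [X in X + _]big1; last by move=> k /andP[/andP[_ h1] h2]; lia.
    rewrite Rplus_0_l; apply: Req_le; rewrite big_nat_cond [RHS]big_nat_cond.
    by apply: eq_bigl => k; case: (leqP (2 ^ L).+1 k) => h1 //=; rewrite ?andbF ?andbT.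
  rewrite rsum_scalr; have := @zeta_tail d (2 ^ L) N d0 N1; rewrite Rpower_2pow.
  move=> h; have {}h := Rle_trans _ _ _ h hL.
  by have := Rmult_le_compat_r _ _ _ B0 h; rewrite Rmult_1_l.
have -> : psum (zeta_weight q d L) F N = (\rsum_(1 <= k < N.+1) (v k * F k)) +
   - (\rsum_(1 <= k < N.+1) ((v k - cmext (zeta_weight q d L) k) * F k)).
  by rewrite -rsum_opp -rsum_add; apply: eq_bigr => k _; ring.
by apply: Rle_trans (Rabs_triang _ _) _; rewrite Rabs_Ropp; lra.
Qed.

Definition residue q a k : R := INR (k %% q == a).
(** The mean-zero function that tests whether the class of a has its fair share of
    the integers coprime to q. *)
Definition discrep q a k : R := INR (totient q) * residue q a k - INR (coprime k q).

Lemma INR_bool (b : bool) : 0 <= INR b <= 1.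
Proof. by case: b => /=; lra. Qed.

Lemma totient_le q : (0 < q)%N -> (0 < totient q <= q)%N.
Proof.
move=> hq; rewrite totient_gt0 hq /= totient_count_coprime.
apply: leq_trans (_ : \sum_(0 <= d < q) 1 <= _)%N; first by apply: leq_sum => i _; case: coprime.
by rewrite sum_nat_const_nat muln1 subn0.
Qed.

Lemma discrep_abs q a k : (0 < q)%N -> Rabs (discrep q a k) <= INR q.
Proof.
move=> hq; have /andP[h1 h2] := totient_le hq.
have := INR_leq h2; have := INR_ge1 h1; rewrite /discrep /residue.
have := INR_bool (k %% q == a); have := INR_bool (coprime k q).
by move=> a1 a2 a3 a4; apply/Rabs_le_between; nra.
Qed.

Lemma perm_mul_mod q x : (0 < q)%N -> coprime x q ->
  perm_eq [seq (d * x) %% q | d <- index_iota 0%N q] (index_iota 0%N q).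
Proof.
move=> hq hx; rewrite /index_iota subn0.
have U : uniq [seq (d * x) %% q | d <- seq.iota 0 q].
  rewrite map_inj_in_uniq ?iota_uniq // => c d; rewrite !mem_iota !add0n /= => hc hd.
  wlog : c d hc hd / (c <= d)%N.
    move=> W e; case: (leqP c d) => h; first exact: W.
    by apply/esym; apply: W => //; exact: ltnW.
  move=> hcd /eqP; rewrite eq_sym eqn_mod_dvd ?leq_mul2r ?hcd ?orbT // -mulnBl.
  rewrite Gauss_dvdl 1?coprime_sym // => h; apply/eqP; rewrite eqn_leq hcd /=.
  rewrite -subn_eq0; case: posnP => // h0; have := dvdn_leq h0 h; lia.
apply: uniq_perm => //; first exact: iota_uniq.
have sub : {subset [seq (d * x) %% q | d <- seq.iota 0 q] <= seq.iota 0 q}.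
  by move=> y /mapP[d _ ->]; rewrite mem_iota add0n ltn_mod.
by have [] := uniq_min_size U sub ltac:(by rewrite size_map).
Qed.

Lemma discrep_mod q a k : discrep q a (k %% q) = discrep q a k.
Proof. by rewrite /discrep /residue modn_mod coprime_modl. Qed.

(** Multiplication by x permutes the residue classes, so x may be taken to be 1. *)
Lemma discrep_mean q a x : (a < q)%N -> coprime x q ->
  \rsum_(0 <= k < q) discrep q a (k * x)%N = 0.
Proof.
move=> ha hx; have hq : (0 < q)%N by exact: leq_ltn_trans ha.
have -> : \rsum_(0 <= k < q) discrep q a (k * x)%N = \rsum_(0 <= k < q) discrep q a k.
  rewrite -[RHS](perm_big _ (perm_mul_mod hq hx)) big_map.
  by apply: eq_bigr => k _; rewrite discrep_mod.
rewrite /discrep rsum_sub rsum_scal.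
have -> : \rsum_(0 <= k < q) residue q a k = 1.
  rewrite (@rsum_cat 0 a q) //; last exact: ltnW.
  rewrite (@big_ltn _ _ _ a) //.
  have Z m n : (forall k, (m <= k < n)%N -> (k < q)%N /\ k <> a) ->
    \rsum_(m <= k < n) residue q a k = 0.
    move=> H; rewrite big_nat_cond big1 // => k /andP[/H[h1 h2] _].
    by rewrite /residue modn_small //; case: eqP.
  rewrite !Z; first by rewrite /residue modn_small // eqxx /=; lra.
    by move=> k /andP[h1 h2]; split=> // e; lia.
  by move=> k /andP[h1 h2]; split; lia.
rewrite totient_count_coprime INR_sum Rmult_1_r.
rewrite (eq_bigr (fun k => INR (coprime k q))) ?Rminus_diag // => k _.
by rewrite coprime_sym.
Qed.

Lemma exists_level d J : 0 < d -> exists L, (J <= L)%N /\ Rpower 2 (- d) ^ L / d <= 1.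
Proof.
move=> d0; have r0 := Rpower_gt0 2 (- d).
have r1 : Rpower 2 (- d) < 1.
  by rewrite /Rpower -exp_0; apply: exp_increasing; have := ln2_gt0; nra.
have [n Hn] := pow_lt_1_zero (Rpower 2 (- d)) ltac:(rewrite Rabs_pos_eq; lra) d d0.
exists (maxn n J); split; first exact: leq_maxr.
have h : (maxn n J >= n)%coq_nat by apply/leP; exact: leq_maxl.
have := Hn _ h; rewrite Rabs_pos_eq; last by apply: pow_le; lra.
move=> h'; apply: (Rmult_le_reg_r d) => //.
by rewrite /Rdiv Rmult_assoc Rinv_l; lra.
Qed.

Lemma discrep_noncoprime q a k : coprime a q -> ~~ coprime k q -> discrep q a k = 0.
Proof.
move=> ha hk; rewrite /discrep /residue (negbTE hk) /=; case: eqP => [e|_] /=; last by ring.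
by move: hk; rewrite -coprime_modl e ha.
Qed.

Lemma discrep_tsum q a J : (a < q)%N -> coprime a q -> (0 < J)%N ->
  Rabs (tsum (res_weight q J) (discrep q a)) <= (INR q + 2) * INR q * exp distance_const.
Proof.
move=> ha hc hJ; have hq : (0 < q)%N by exact: leq_ltn_trans ha.
have J0 := INR_gt0 hJ; have d0 := Rinv_0_lt_compat _ J0.
have [L [hL1 hL2]] := exists_level J d0.
have base x : coprime x q ->
    Rabs (tsum (zeta_weight q (/ INR J) L) (fun k => discrep q a (k * x)%N)) <= (INR q + 2) * INR q.
  move=> hx; apply: zeta_weight_tsum => //.
  - by move=> k; rewrite -discrep_mod -[RHS]discrep_mod mulnDl [(k * x +
    _)%N]addnC [(q * x)%N]mulnC modnMDl.
  - exact: discrep_mean.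
  - by move=> k; exact: discrep_abs.
  - by move=> k hk; apply: discrep_noncoprime => //; rewrite coprimeMl negb_and hk.
have := tsum_hyb_weight d0 hL1 (fun k => discrep_abs a k hq) base (2 ^ L).+1 (coprime1n q).
rewrite (@tsum_eq (hyb_weight q J (/ INR J) L (2 ^ L).+1) (res_weight q J) _ (discrep q a));
  last first.
- by move=> k _; rewrite muln1.
- move=> p _; rewrite /hyb_weight; case: ltnP => // hp; rewrite (res_weight_admissible q hL1).2 //.
  by rewrite /zeta_weight leqNgt hp.
move=> h; apply: Rle_trans h _; apply: Rmult_le_compat_l.
  by have := pos_INR q; nra.
by have := weight_distance q hJ hL1; case=> [/exp_increasing|->]; lra.
Qed.

Lemma tsum_lin w Y f g c B : admissible w Y -> (forall k, Rabs (f k) <= B) ->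
  (forall k, Rabs (g k) <= B) ->
  tsum w (fun k => c * f k - g k) = c * tsum w f - tsum w g.
Proof.
move=> aw Hf Hg.
have c1 := is_lim_seq_minus' _ _ _ _ (is_lim_seq_scal_l _ c _ (psum_cv aw Hf)) (psum_cv aw Hg).
rewrite {1}/tsum (_ : Lim_seq _ = Finite (c * tsum w f - tsum w g)) //.
apply: is_lim_seq_unique; apply: is_lim_seq_ext c1 => N.
by rewrite /psum -rsum_scal -rsum_sub; apply: eq_bigr => k _; ring.
Qed.

Lemma residue_abs q a k : Rabs (residue q a k) <= 1.
Proof. by have := INR_bool (k %% q == a) => h; rewrite Rabs_pos_eq /residue; lra. Qed.

(** The weight vanishes on integers not coprime to q, so the subtracted part of
    discrep contributes the full Euler product. *)
Lemma residue_euler_prod q a J : (a < q)%N -> coprime a q -> (0 < J)%N ->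
  euler_prod (res_weight q J) (2 ^ J).+1 - (INR q + 2) * INR q * exp distance_const <=
  INR (totient q) * tsum (res_weight q J) (residue q a).
Proof.
move=> ha hc hJ; have hq : (0 < q)%N by exact: leq_ltn_trans ha.
have aw := res_weight_admissible q (leqnn J).
have := discrep_tsum ha hc hJ.
have b1 k : Rabs (INR (coprime k q)) <= 1.
  by have := INR_bool (coprime k q) => h; rewrite Rabs_pos_eq; lra.
rewrite /discrep (tsum_lin _ aw (residue_abs q a) b1) -(tsum1_euler_prod aw).
have -> : tsum (res_weight q J) (fun k => INR (coprime k q)) = tsum (res_weight q J) (fun=> 1).
  rewrite /tsum; congr real; apply: Lim_seq_ext => N; rewrite /psum.
  rewrite big_nat_cond [RHS]big_nat_cond; apply: eq_bigr => k /andP[/andP[hk _] _].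
  case: (boolP (coprime k q)) => h //=.
  have g1 : (1 < gcdn k q)%N.
    by rewrite ltn_neqAle eq_sym -/(coprime k q) h gcdn_gt0 hk.
  have hp := pdiv_prime g1; have := pdiv_dvd (gcdn k q); rewrite dvdn_gcd => /andP[d1 d2].
  rewrite (cmext_eq0 hk hp d1) ?Rmult_0_l //; last by rewrite /res_weight d2 !andbF.
by move=> /Rabs_le_between; lra.
Qed.

Lemma prod_primes n : (0 < n)%N -> n = (\prod_(p <- primes n) p ^ logn p n)%N.
Proof. by move=> hn; rewrite {1}(prod_prime_decomp hn) prime_decompE big_map. Qed.

Lemma totient_prod q : (0 < q)%N ->
  INR (totient q) = INR q * \big[Rmult/1]_(p <- primes q) (1 - / INR p).
Proof.
move=> hq; rewrite totientE // [X in INR X * _](prod_primes hq).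
have INRprod (s : seq nat) (F : nat -> nat) :
    INR (\prod_(i <- s) F i)%N = \big[Rmult/1]_(i <- s) INR (F i).
  by apply: (big_morph INR INR_muln).
rewrite !INRprod -big_split /=; rewrite big_seq [RHS]big_seq; apply: eq_bigr => p hp.
have e0 : (0 < logn p q)%N by rewrite logn_gt0.
move: hp; rewrite mem_primes => /andP[pp _].
have p2 := INR_prime_ge2 pp; rewrite -{2}(prednK e0) expnS !INR_muln.
have -> : INR p.-1 = INR p - 1 by rewrite -{2}(prednK (prime_gt0 pp)) S_INR; lra.
by field; lra.
Qed.

Lemma prod_dvd_primes q X : (0 < q)%N ->
  \big[Rmult/1]_(p <- primes q) (1 - / INR p) <=
  \rprod_(0 <= p < X | prime p) (if p %| q then 1 - / INR p else 1).
Proof.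
move=> hq.
have F01 p : prime p -> 0 <= (if p %| q then 1 - / INR p else 1) <= 1.
  move=> hp; have p2 := INR_prime_ge2 hp; case: ifP => _; last lra.
  have := Rinv_0_lt_compat (INR p); have := Rinv_le_contravar 2 (INR p); lra.
set F := fun p : nat => (if p %| q then 1 - / INR p else 1) in F01 *.
have -> : \big[Rmult/1]_(p <- primes q) (1 - / INR p) = \rprod_(0 <= p < maxn X q.+1 | prime p) F p.
  rewrite /F -big_mkcondr -[RHS]big_filter; apply: perm_big; apply: uniq_perm.
  - exact: primes_uniq.
  - by apply: filter_uniq; exact: iota_uniq.
  move=> p; rewrite mem_filter mem_primes mem_index_iota hq /=.
  case: (boolP (prime p)) => //= hp; case: (boolP (p %| q)) => //= hpq.
  by rewrite leq_max ltnS (dvdn_leq hq hpq) orbT.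
rewrite (@big_cat_nat _ _ _ X 0 (maxn X q.+1)) ?leq_maxl //= -{2}(Rmult_1_r (\rprod_(0 <=
  p < X | prime p) F p)).
have P1 m n : 0 <= \rprod_(m <= p < n | prime p) F p <= 1.
  elim/big_ind: _ => [|x y [? ?] [? ?]|p hp]; [lra| |exact: F01].
  by split; [exact: Rmult_le_pos|nra].
by apply: Rmult_le_compat_l; [case: (P1 0%N X)|case: (P1 X (maxn X q.+1))].
Qed.

(** The factors exp (2/X) over the primes up to X contribute 128 = 2 * 64. *)
Definition euler_const := mertens_const + 128.

(** Factor by factor: 1 - 1/p + 1/X <= (1 - 1/p) exp (2/X) when p does not divide q,
    and the missing factors at p | q make up totient q / q.  The number of primes up
    to X being O(X / J), the factors exp (2/X) cost a relative error O(1/J). *)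
Lemma euler_prod_res_weight_ge q J : (0 < q)%N -> (0 < J)%N ->
  INR (totient q) / INR q * (exp euler_gamma * ln 2 * (INR J - euler_const)) <=
  euler_prod (res_weight q J) (2 ^ J).+1.
Proof.
move=> hq hJ; set X := 2 ^ J; have X0 : 0 < X by apply: pow_lt; lra.
have x0 := Rinv_0_lt_compat _ X0; have J0 := INR_gt0 hJ; have l2 := ln2_gt0.
have q0 := INR_gt0 hq.
have e1 : \rprod_(0 <= p < (2 ^ J).+1 | prime p)
   (exp (ell p + (- (2 * / X)) * 1) * (if p %| q then 1 - / INR p else 1)) <=
     euler_prod (res_weight q J) (2 ^ J).+1.
  apply: (@rprod_le 0 (2 ^ J).+1 prime _ (fun p => / (1 - res_weight q J p)) _).2 =>
    p /andP[_ hp] pp.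
  have p2 := INR_prime_ge2 pp.
  have i0 : 0 < / INR p by apply: Rinv_0_lt_compat; lra.
  have i1 : / INR p <= / 2 by apply: Rinv_le_contravar; lra.
  have a0 : 0 < 1 - / INR p by lra.
  have E : exp (ell p + - (2 * / X) * 1) = / (1 - / INR p) * exp (- (2 * / X)).
    rewrite exp_plus Rmult_1_r; congr (_ * _).
    by rewrite /ell exp_Ropp exp_ln.
  have ex0 := exp_pos (- (2 * / X)).
  have ex1 : exp (- (2 * / X)) <= 1.
    by rewrite -exp_0; apply: Rlt_le; apply: exp_increasing; lra.
  rewrite E /res_weight -ltnS hp pp /=; case: ifP => hpq /=.
    rewrite Rminus_0_r Rinv_1 Rmult_assoc [_ * (1 - _)]Rmult_comm -Rmult_assoc Rinv_l; lra.
  have b0 := Rinv_0_lt_compat _ a0.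
  rewrite Rmult_1_r; split; first by apply: Rmult_le_pos; lra.
  rewrite exp_Ropp -Rinv_mult; apply: Rinv_le_contravar; first by rewrite -/X;
    have := INR_leq hp; nra.
  have := exp_ineq1_le (2 * / X); rewrite -/X => h.
  have := Rmult_le_compat_l _ _ _ (Rlt_le _ _ a0) h; nra.
apply: Rle_trans e1; rewrite big_split /= rprod_exp rsum_add rsum_scal -/(mertens_sum J).
apply: Rle_trans (_ : exp (mertens_sum J + - (2 * / X) * (\rsum_(0 <=
  p < (2 ^ J).+1 | prime p) 1)) * (INR (totient q) / INR q) <= _); last first.
  apply: Rmult_le_compat_l; first exact: Rlt_le (exp_pos _).
  apply: Rle_trans (prod_dvd_primes _ hq); apply: Req_le; rewrite totient_prod //; field; lra.
rewrite Rmult_comm; apply: Rmult_le_compat_r.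
  by apply: Rmult_le_pos; [exact: pos_INR|apply: Rlt_le; apply: Rinv_0_lt_compat].
have c := prime_count hJ; rewrite -/X in c.
have m := mertens3_gamma hJ.
have H : euler_gamma + ln (INR J * ln 2) + - (euler_const / INR J) <=
   mertens_sum J + - (2 * / X) * (\rsum_(0 <= p < (2 ^ J).+1 | prime p) 1).
  have : 2 * / X * (\rsum_(0 <= p < (2 ^ J).+1 | prime p) 1) <= 2 * / X * (64 * (X / INR J)).
    by apply: Rmult_le_compat_l => //; lra.
  have -> : 2 * / X * (64 * (X / INR J)) = 128 / INR J by field; lra.
  rewrite /euler_const /Rdiv Rmult_plus_distr_r in m *; lra.
apply: Rle_trans (_ : exp (euler_gamma + ln (INR J * ln 2) + - (euler_const / INR J)) <= _);
  last first.
  by case: H => [/exp_increasing|->]; lra.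
rewrite !exp_plus exp_ln; last exact: Rmult_lt_0_compat.
have g0 := exp_pos euler_gamma.
have h := exp_ineq1_le (- (euler_const / INR J)).
have k0 : 0 < exp euler_gamma * (INR J * ln 2) by apply: Rmult_lt_0_compat => //;
  exact: Rmult_lt_0_compat.
apply: Rle_trans (Rmult_le_compat_l _ _ _ (Rlt_le _ _ k0) h).
by apply: Req_le; field; lra.
Qed.

Definition progression_const q := exp euler_gamma * ln 2 * euler_const + INR q * ((INR q +
  2) * INR q * exp distance_const).

(** Each class coprime to q receives 1 / totient q of the Euler product, up to O(1);
    the density totient q / q of that product cancels. *)
Lemma smooth_progression q a J : (a < q)%N -> coprime a q -> (0 < J)%N ->
  exp euler_gamma * (INR J * ln 2) - progression_const q <=
    INR q * tsum (res_weight q J) (residue q a).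
Proof.
move=> ha hc hJ; have hq : (0 < q)%N by exact: leq_ltn_trans ha.
have /andP[t0 _] := totient_le hq.
have h1 := residue_euler_prod ha hc hJ; have h2 := euler_prod_res_weight_ge hq hJ.
have q0 := INR_gt0 hq; have t0' := INR_gt0 t0; have t1 := INR_ge1 t0.
set E := (INR q + 2) * INR q * exp distance_const in h1.
have E0 : 0 <= E by rewrite /E; have := exp_pos distance_const; move=> ?; apply: Rmult_le_pos; nra.
have h3 := Rle_trans _ _ _ (Rplus_le_compat_r (- E) _ _ h2) h1.
set t := tsum _ _ in h3 *.
apply: (Rmult_le_reg_l (INR (totient q) / INR q)); first exact: Rdiv_lt_0_compat.
have -> : INR (totient q) / INR q * (INR q * t) = INR (totient q) * t by field; lra.
apply: Rle_trans h3; rewrite /progression_const -/E.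
have -> : INR (totient q) / INR q * (exp euler_gamma * (INR J * ln 2) -
   (exp euler_gamma * ln 2 * euler_const + INR q * E)) =
   INR (totient q) / INR q * (exp euler_gamma * ln 2 * (INR J - euler_const)) - INR (totient q) * E.
  by field; lra.
have : E <= INR (totient q) * E by nra.
lra.
Qed.

(** * The Hurwitz zeta function on the line of real part 1 *)

Lemma exp_mono x y : x <= y -> exp x <= exp y.
Proof. by case=> [/exp_increasing|->]; lra. Qed.

(** The real part of exp(-i th) z. *)
Definition rotated_re (th : R) (z : C) : R := cos th * Re z + sin th * Im z.

Lemma rotated_re_plus th z z' : rotated_re th (z + z')%C = rotated_re th z + rotated_re th z'.
Proof. by rewrite /rotated_re /Re /Im /=; ring. Qed.
Lemma rotated_re_minus th z z' : rotated_re th (z - z')%C = rotated_re th z - rotated_re th z'.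
Proof. by rewrite /rotated_re /Re /Im /=; ring. Qed.

Lemma rotated_re_le_Cmod th z : Rabs (rotated_re th z) <= Cmod z.
Proof.
rewrite /Cmod -sqrt_Rsqr_abs; apply: sqrt_le_1_alt.
have := sin2_cos2 th; rewrite /rotated_re /Re /Im /Rsqr; case: z => x y /=.
move: (cos th) (sin th) => c s h.
have : 0 <= (s * x - c * y) * (s * x - c * y) by exact: Rle_0_sqr.
nra.
Qed.

Lemma MVT_ineq (f f' : R -> R) a b K : a <= b ->
  (forall x, a <= x <= b -> is_derive f x (f' x)) ->
  (forall x, a <= x <= b -> Rabs (f' x) <= K) -> Rabs (f b - f a) <= K * (b - a).
Proof.
move=> hab Hd HK; have := @MVT_gen f a b f'.
rewrite Rmin_left ?Rmax_right //; case=> [x hx|x hx|c [hc ->]].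
- by apply: Hd; lra.
- exact: is_derive_continuity_pt (Hd x hx).
rewrite Rabs_mult (Rabs_pos_eq (b - a)); last lra.
by apply: Rmult_le_compat_r; [lra|exact: HK].
Qed.

(** In this section G is a primitive of g, where g(u) is the real part of u^(-s)
    rotated by -th, with s = sg + i t. *)
Section Oscillation.
Variables (sg t th : R).
Hypothesis hsg : 1 < sg <= 2.
Hypothesis ht : 1 <= t.

Let g u := Rpower u (- sg) * cos (th + t * ln u).
Let g' u := - (sg * cos (th + t * ln u) + t * sin (th + t * ln u)) * Rpower u (- sg - 1).
Let den := (1 - sg) * (1 - sg) + t * t.
Let G u := Rpower u (1 - sg) * ((1 - sg) * cos (th + t * ln u) + t * sin (th + t * ln u)) / den.

Lemma osc_den_gt0 : 0 < den.
Proof. by rewrite /den; nra. Qed.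

Lemma Rpower_m1 u s : 0 < u -> Rpower u (s - 1) = Rpower u s / u.
Proof. by move=> hu; rewrite /Rminus Rpower_plus Rpower_Ropp Rpower_1. Qed.

Lemma osc_derive u : 0 < u -> is_derive g u (g' u).
Proof.
move=> hu; rewrite /g /g' Rpower_m1 //; rewrite /Rpower; auto_derive; first by split.
by field; lra.
Qed.

Lemma osc_primitive_derive u : 0 < u -> is_derive G u (g u).
Proof.
move=> hu; have d0 := osc_den_gt0; rewrite /G /g.
have -> : Rpower u (- sg) = Rpower u (1 - sg) / u.
  by rewrite -Rpower_m1 //; congr Rpower; ring.
rewrite /Rpower; auto_derive; first by split.
by rewrite /den in d0 *; field; lra.
Qed.

Lemma osc_derivative_bound u : 1 <= u -> Rabs (g' u) <= (2 + t) / (u * u).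
Proof.
move=> hu; rewrite /g' Rabs_mult.
have hp : 0 <= Rpower u (- sg - 1) <= / (u * u).
  split; first exact: Rlt_le (Rpower_gt0 _ _).
  have -> : / (u * u) = Rpower u (- 1 - 1) by rewrite Rpower_m1 ?Rpower_Ropp ?Rpower_1;
    [field|..]; lra.
  have := ln_ge0 hu => l0; rewrite /Rpower.
  have : (- sg - 1) * ln u <= (- 1 - 1) * ln u by nra.
  by case=> [/exp_increasing|->]; lra.
rewrite (Rabs_pos_eq (Rpower _ _)); last lra.
apply: Rmult_le_compat; [exact: Rabs_pos|lra| |lra].
rewrite Rabs_Ropp; apply: Rle_trans (Rabs_triang _ _) _.
have c1 : Rabs (cos (th + t * ln u)) <= 1 by apply/Rabs_le_between;
  have := COS_bound (th + t * ln u); lra.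
have s1 : Rabs (sin (th + t * ln u)) <= 1 by apply/Rabs_le_between;
  have := SIN_bound (th + t * ln u); lra.
rewrite !Rabs_mult (Rabs_pos_eq sg) 1?(Rabs_pos_eq t); try lra.
nra.
Qed.

Lemma osc_primitive_bound u : 1 <= u -> Rabs (G u) <= 2.
Proof.
move=> hu; have d0 := osc_den_gt0; rewrite /G /Rdiv !Rabs_mult.
rewrite (Rabs_pos_eq (Rpower _ _)); last exact: Rlt_le (Rpower_gt0 _ _).
rewrite (Rabs_pos_eq (/ den)); last by apply: Rlt_le; exact: Rinv_0_lt_compat.
have hp : Rpower u (1 - sg) <= 1.
  have l0 := ln_ge0 hu; rewrite -[X in _ <= X]exp_0 /Rpower.
  by apply: exp_mono; nra.
have c1 : Rabs (cos (th + t * ln u)) <= 1 by apply/Rabs_le_between;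
  have := COS_bound (th + t * ln u); lra.
have s1 : Rabs (sin (th + t * ln u)) <= 1 by apply/Rabs_le_between;
  have := SIN_bound (th + t * ln u); lra.
have b : Rabs ((1 - sg) * cos (th + t * ln u) + t * sin (th + t * ln u)) <= 2 * den.
  apply: Rle_trans (Rabs_triang _ _) _; rewrite !Rabs_mult (Rabs_pos_eq t); last lra.
  have : Rabs (1 - sg) <= 1 by apply/Rabs_le_between; lra.
  have := Rabs_pos (1 - sg); have := Rabs_pos (cos (th + t * ln u));
    have := Rabs_pos (sin (th + t * ln u)).
  rewrite /den; nra.
have i0 := Rinv_0_lt_compat _ d0.
have -> : 2 = 1 * (2 * den) * / den by field; lra.
apply: Rmult_le_compat_r; first lra.
apply: Rmult_le_compat => //; [exact: Rlt_le (Rpower_gt0 _ _)|exact: Rabs_pos].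
Qed.

Lemma osc_integral u : 1 <= u -> Rabs (g u - (G (u + 1) - G u)) <= (2 + t) / (u * u).
Proof.
move=> hu; have := @MVT_gen G u (u + 1) g.
rewrite Rmin_left ?Rmax_right //; try lra.
case=> [x hx|x hx|c [hc ->]].
- by apply: osc_primitive_derive; lra.
- by apply: is_derive_continuity_pt (osc_primitive_derive _); lra.
have -> : g u - g c * (u + 1 - u) = - (g c - g u) by ring.
rewrite Rabs_Ropp.
have K0 : 0 <= (2 + t) / (u * u) by apply: Rlt_le; apply: Rdiv_lt_0_compat; nra.
apply: Rle_trans (@MVT_ineq g g' u c ((2 + t) / (u * u)) _ _ _) _; try lra.
- by move=> x hx; apply: osc_derive; lra.
- move=> x hx; apply: Rle_trans (osc_derivative_bound _) _; first lra.
  by apply: Rmult_le_compat_l; [lra|apply: Rinv_le_contravar; nra].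
- nra.
Qed.

(** The sum is compared with the increments of the primitive G, which is bounded
    because t >= 1; the error (2 + t) / k^2 in each term sums to O(1) once N >= t. *)
Lemma oscillating_tail alpha N n : 0 < alpha -> (2 <= N)%N -> (N <= n)%N -> t <= INR N ->
  Rabs (\rsum_(N <= k < n) (Rpower (INR k + alpha) (- sg) *
    cos (th + t * ln (INR k + alpha)))) <= 8.
Proof.
move=> ha hN hn htN; change (Rabs (\rsum_(N <= k < n) g (INR k + alpha)) <= 8).
have u1 k : (N <= k)%N -> 1 <= INR k + alpha /\ INR k <= INR k + alpha /\ 2 <= INR k.
  move=> hk; have : 2 <= INR k by apply: (@INR_leq 2); exact: leq_trans hk.
  lra.
have E : \rsum_(N <= k < n) g (INR k + alpha) =
  (\rsum_(N <= k < n) (g (INR k + alpha) - (G (INR k + alpha + 1) - G (INR k + alpha)))) +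
  (G (INR n + alpha) - G (INR N + alpha)).
  rewrite -(@rsum_telescope N n (fun k => G (INR k + alpha)) hn) -rsum_add.
  apply: eq_bigr => k _; rewrite S_INR.
  have -> : INR k + 1 + alpha = INR k + alpha + 1 by ring.
  ring.
rewrite E; apply: Rle_trans (Rabs_triang _ _) _.
have b1 : Rabs (G (INR n + alpha) - G (INR N + alpha)) <= 4.
  apply: Rle_trans (Rabs_triang _ _) _; rewrite Rabs_Ropp.
  have := @osc_primitive_bound (INR n + alpha) (proj1 (u1 n hn));
    have := @osc_primitive_bound (INR N + alpha) (proj1 (u1 N (leqnn N))); lra.
suff : Rabs (\rsum_(N <= k < n) (g (INR k + alpha) - (G (INR k + alpha + 1) - G (INR k +
  alpha)))) <= 4 by lra.
apply: Rle_trans (rsum_abs _ _ _ _) _.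
apply: Rle_trans (_ : \rsum_(N <= k < n) ((2 + t) * (- / (INR k.+1 - 1) - - / (INR k - 1))) <= _).
  apply: rsum_le => k /andP[hk _] _; have [h1 [h2 h3]] := u1 k hk.
  apply: Rle_trans (osc_integral h1) _; apply: Rmult_le_compat_l; first lra.
  rewrite S_INR; have -> : - / (INR k +
    1 - 1) - - / (INR k - 1) = / (INR k * (INR k - 1)) by field; lra.
  by apply: Rinv_le_contravar; nra.
rewrite rsum_scal (@rsum_telescope N n (fun k => - / (INR k - 1)) hn).
have [_ [_ N2]] := u1 N (leqnn N); have [_ [_ n2]] := u1 n hn.
have i0 : 0 < / (INR n - 1) by apply: Rinv_0_lt_compat; lra.
have i1 : 0 < / (INR N - 1) by apply: Rinv_0_lt_compat; lra.
apply: Rle_trans (_ : (2 + INR N) * / (INR N - 1) <= _); first nra.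
apply: (Rmult_le_reg_r (INR N - 1)); first lra.
rewrite Rmult_assoc Rinv_l; lra.
Qed.
End Oscillation.

Lemma rotated_re_term th sg t u : rotated_re th (Rcpow u (- (sg, t))%C) = Rpower u (- sg) * cos
  (th + t * ln u).
Proof.
rewrite /rotated_re /Rcpow /Cexp /Rpower /Re /Im /=.
have -> : - sg * ln u - - t * 0 = - sg * ln u by ring.
have -> : - sg * 0 + - t * ln u = - (t * ln u) by ring.
by rewrite cos_plus cos_neg sin_neg; ring.
Qed.

Lemma rotated_re_sum_n th (F : nat -> C) n :
  rotated_re th (@sum_n C_AbelianMonoid F n) = \rsum_(0 <= k < n.+1) rotated_re th (F k).
Proof.
elim: n => [|n IH]; first by rewrite sum_O rsum_recr // big_geq //; lra.
by rewrite sum_Sn rsum_recr // -IH -rotated_re_plus.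
Qed.

Lemma zeta_series alpha zeta sg t th : is_hurwitz_zeta alpha zeta -> 1 < sg ->
  is_lim_seq (fun n => \rsum_(0 <= k < n.+1)
     (Rpower (INR k + alpha) (- sg) * cos (th + t * ln (INR k +
       alpha)))) (rotated_re th (zeta (sg, t))).
Proof.
move=> [H _] hs; have {}H := H (sg, t) hs.
apply/is_lim_seq_spec => eps.
have := (proj1 (@filterlim_locally_ball_norm _ C_AbsRing C_NormedModule _ _ _ _)) H eps.
case=> M HM; exists M => n hn; have {}HM := HM n hn.
have -> : \rsum_(0 <= k < n.+1) (Rpower (INR k + alpha) (- sg) * cos (th + t * ln (INR k +
  alpha))) =
  rotated_re th (@sum_n C_AbelianMonoid (fun k => Rcpow (INR k + alpha) (- (sg, t))%C) n).
  by rewrite rotated_re_sum_n; apply: eq_bigr => k _; rewrite rotated_re_term.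
rewrite -rotated_re_minus; apply: Rle_lt_trans (rotated_re_le_Cmod _ _) _.
exact: HM.
Qed.

Lemma zeta_near alpha zeta s : is_hurwitz_zeta alpha zeta -> s <> RtoC 1 ->
  forall eps : posreal, exists del : posreal, forall z, Cmod (z - s)%C < del ->
  Cmod (zeta z - zeta s)%C < eps.
Proof.
move=> [_ [H _]] /H h eps; have c := ex_derive_continuous zeta s h.
have [del Hd] := (proj1 (@filterlim_locally_ball_norm _ C_AbsRing C_NormedModule _ _ _ _)) c eps.
by exists del => z hz; apply: Hd.
Qed.

Lemma line_neq1 t : 1 <= t -> (1, t) <> RtoC 1.
Proof. by move=> ht [e]; lra. Qed.

Lemma zeta_partial alpha zeta sg t th N : is_hurwitz_zeta alpha zeta -> 0 < alpha ->
  1 < sg <= 2 -> 1 <= t -> (2 <= N)%N -> t <= INR N ->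
  (\rsum_(0 <= k < N) (Rpower (INR k + alpha) (- sg) * cos (th + t * ln (INR k + alpha)))) - 8
  <= rotated_re th (zeta (sg, t)).
Proof.
move=> Hz ha hsg ht hN htN; have c := @zeta_series alpha zeta sg t th Hz (proj1 hsg).
have := is_lim_seq_le_loc (fun=> _) _ _ _ _ (is_lim_seq_const _) c; apply.
exists N => n /leP hn.
rewrite (@rsum_cat 0 N n.+1) //; last exact: leqW.
have := @oscillating_tail sg t th hsg ht alpha N n.+1 ha hN (leqW hn) htN;
  move=> /Rabs_le_between; lra.
Qed.

(** The bound for real part sg > 1 is uniform in sg, and only the continuity of zeta
    at 1 + it is needed to let sg tend to 1. *)
Lemma zeta_approx alpha zeta t th N : is_hurwitz_zeta alpha zeta -> 0 < alpha ->
  1 <= t -> (2 <= N)%N -> t <= INR N ->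
  (\rsum_(0 <= k < N) (cos (th + t * ln (INR k + alpha)) / (INR k + alpha))) - 8
  <= rotated_re th (zeta (1, t)).
Proof.
move=> Hz ha ht hN htN.
pose s n := 1 + / INR n.+1.
have hs n : 1 < s n <= 2.
  have n0 := @INR_gt0 n.+1 isT; have n1 := @INR_ge1 n.+1 isT.
  have := Rinv_0_lt_compat _ n0; have := Rinv_le_contravar 1 _ Rlt_0_1 n1.
  rewrite /s; lra.
have i0 : is_lim_seq (fun n => / INR n.+1) 0.
  apply: (is_lim_seq_incr_1 (fun n => / INR n) 0).1.
  have := is_lim_seq_inv _ _ is_lim_seq_INR; exact.
have c1 : is_lim_seq (fun n => rotated_re th (zeta (s n, t))) (rotated_re th (zeta (1, t))).
  apply/is_lim_seq_spec => eps; have [del Hd] := zeta_near Hz (line_neq1 ht) eps.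
  have := (proj2 (is_lim_seq_spec _ _) i0) del; case=> M HM; exists M => n hn.
  rewrite -rotated_re_minus; apply: Rle_lt_trans (rotated_re_le_Cmod _ _) _; apply: Hd.
  have -> : ((s n, t) - (1, t))%C = RtoC (/ INR n.+1 - 0).
    by rewrite /RtoC /s /Cminus /Cplus /Copp /=; congr pair; ring.
  by rewrite Cmod_R; exact: HM.
have c2 : is_lim_seq (fun n => (\rsum_(0 <= k < N) (Rpower (INR k + alpha) (- s n) *
      cos (th + t * ln (INR k + alpha)))) - 8)
   ((\rsum_(0 <= k < N) (cos (th + t * ln (INR k + alpha)) / (INR k + alpha))) - 8).
  apply: is_lim_seq_minus'; last exact: is_lim_seq_const.
  elim: N {hN htN} => [|N IH].
    apply: (is_lim_seq_ext (fun=> 0)); first by move=> n; rewrite big_geq.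
    by rewrite big_geq //; exact: is_lim_seq_const.
  rewrite rsum_recr //; apply: (is_lim_seq_ext _ _ _ (fun n => esym (rsum_recr _ (leq0n N)))).
  apply: is_lim_seq_plus' => //.
  have u0 : 0 < INR N + alpha by have := pos_INR N; lra.
  rewrite /Rdiv [X in is_lim_seq _ (Finite X)]Rmult_comm -[/ _](_ : Rpower (INR N +
    alpha) (- (1 + 0)) = _); last first.
    by rewrite Rplus_0_r Rpower_Ropp Rpower_1.
  apply: (is_lim_seq_mult' _ (fun=> _)); last exact: is_lim_seq_const.
  apply: (is_lim_seq_continuous (fun x => Rpower (INR N + alpha) (- (1 + x)))) => //.
  apply: (is_derive_continuity_pt (l := - ln (INR N + alpha) * Rpower (INR N + alpha) (- (1 + 0)))).
  by rewrite /Rpower; auto_derive => //; ring.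
apply: (is_lim_seq_le _ _ (Finite _) (Finite _) _ c2 c1) => n.
exact: zeta_partial.
Qed.

Lemma line_C t : (RtoC 1 + Ci * RtoC t)%C = (1, t).
Proof. by rewrite /RtoC /Ci /Cmult /Cplus /=; congr pair; ring. Qed.

Lemma Rabs_sub_le (x y z : R) : x <= z + y -> y <= z + x -> Rabs (y - x) <= z.
Proof. by move=> h1 h2; apply/Rabs_le_between; lra. Qed.

Lemma zeta_max alpha zeta a b : is_hurwitz_zeta alpha zeta -> 1 <= a <= b ->
  exists M, is_maximum (fun y : R => exists t : R,
         a <= t <= b /\ y = Cmod (zeta (RtoC 1 + Ci * RtoC t)%C)) M.
Proof.
move=> Hz [ha hab].
have ct t : a <= t <= b -> continuity_pt (fun t => Cmod (zeta (1, t))) t.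
  move=> ht; apply/continuity_pt_locally => eps.
  have [|del Hd] := @zeta_near alpha zeta (1, t) Hz _ eps; first by apply: line_neq1; lra.
  exists del => y hy; have : Cmod (zeta (1, y) - zeta (1, t))%C < eps.
    apply: Hd; have -> : ((1, y) - (1, t))%C = (Ci * RtoC (y - t))%C.
      by rewrite /RtoC /Ci /Cminus /Cmult /Cplus /Copp /=; congr pair; ring.
    by rewrite Cmod_mult Cmod_R Cmod_Ci Rmult_1_l; exact: hy.
  apply: Rle_lt_trans; have := Cmod_triangle (zeta (1, y) - zeta (1, t)) (zeta (1, t)).
  have := Cmod_triangle (zeta (1, t) - zeta (1, y)) (zeta (1, y)).
  have e1 : Cmod (zeta (1, t) - zeta (1, y))%C = Cmod (zeta (1, y) - zeta (1, t))%C.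
    by rewrite -Cmod_opp; congr Cmod; ring.
  rewrite e1.
  have -> : (zeta (1, y) - zeta (1, t) + zeta (1, t))%C = zeta (1, y) by ring.
  have -> : (zeta (1, t) - zeta (1, y) + zeta (1, y))%C = zeta (1, t) by ring.
  by move=> h1 h2; exact: Rabs_sub_le.
have [x [Hx hx]] := continuity_ab_maj _ a b hab ct.
exists (Cmod (zeta (1, x))); split.
  by exists x; split=> //; rewrite line_C.
by move=> y [t [ht ->]]; rewrite line_C; exact: Hx.
Qed.

(** * The resonance inequality *)

(** The integral of (1 - t/T) cos(l t) over [0, T]. *)
Definition fejer (T l : R) : R :=
  if Req_EM_T l 0 then T / 2 else (1 - cos (l * T)) / (l * l * T).

Lemma fejer_RInt T l : 0 < T -> is_RInt (fun t => (1 - t / T) * cos (l * t)) 0 T (fejer T l).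
Proof.
move=> T0; rewrite /fejer; case: Req_EM_T => [l0|l0] /=.
  rewrite l0; have -> : T / 2 = minus (T - T * T / (2 * T)) (0 - 0 * 0 / (2 * T)).
    by rewrite /minus /plus /opp /=; field; lra.
  apply: (@is_RInt_derive _ (fun t => t - t * t / (2 * T))) => t _.
    by auto_derive => //; rewrite Rmult_0_l cos_0; field; lra.
  apply: (@ex_derive_continuous R_AbsRing R_NormedModule); auto_derive; done.
pose G t := (1 - t / T) * (sin (l * t) / l) - cos (l * t) / (l * l * T).
have -> : (1 - cos (l * T)) / (l * l * T) = minus (G T) (G 0).
  by rewrite /G /minus /plus /opp /= Rmult_0_r sin_0 cos_0; field; lra.
apply: (@is_RInt_derive _ G) => t _.
  by rewrite /G; auto_derive => //; field; lra.
apply: (@ex_derive_continuous R_AbsRing R_NormedModule); auto_derive; done.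
Qed.

Lemma fejer_ge0 T l : 0 < T -> 0 <= fejer T l.
Proof.
move=> T0; rewrite /fejer; case: Req_EM_T => l0 /=; first by lra.
apply: Rmult_le_pos; first by have := COS_bound (l * T); lra.
apply: Rlt_le; apply: Rinv_0_lt_compat; apply: Rmult_lt_0_compat => //; nra.
Qed.

Lemma fejer0 T : fejer T 0 = T / 2.
Proof. by rewrite /fejer; case: Req_EM_T. Qed.

Lemma fejer_le T l : 0 < T -> fejer T l <= T / 2.
Proof.
move=> T0; rewrite -(fejer0 T).
apply: (is_RInt_le _ _ 0 T _ _ _ (@fejer_RInt T l T0) (@fejer_RInt T 0 T0)); first lra.
move=> t ht; rewrite Rmult_0_l cos_0; apply: Rmult_le_compat_l.
  have : t / T <= 1; last lra.
  by apply: (Rmult_le_reg_r T) => //; rewrite /Rdiv Rmult_assoc Rinv_l; lra.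
by have := COS_bound (l * t); lra.
Qed.

Lemma is_RInt_rsum (f : nat -> R -> R) (l : nat -> R) a b m n :
  (forall i, (m <= i < n)%N -> is_RInt (f i) a b (l i)) ->
  is_RInt (fun t => \rsum_(m <= i < n) f i t) a b (\rsum_(m <= i < n) l i).
Proof.
move=> H; case: (leqP m n) => hmn; last first.
  rewrite big_geq; last exact: ltnW.
  apply: (is_RInt_ext (fun=> 0)); first by move=> t _; rewrite big_geq //; exact: ltnW.
  by have := @is_RInt_const R_NormedModule a b 0; rewrite scal_zero_r.
elim: n hmn H => [|n IH]; first rewrite leqn0 => /eqP -> _.
  rewrite big_geq //; apply: (is_RInt_ext (fun=> 0)); first by move=> t _; rewrite big_geq.
  by have := @is_RInt_const R_NormedModule a b 0; rewrite scal_zero_r.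
rewrite leq_eqVlt => /orP[/eqP ->|h] H.
  rewrite big_geq //; apply: (is_RInt_ext (fun=> 0)); first by move=> t _; rewrite big_geq.
  by have := @is_RInt_const R_NormedModule a b 0; rewrite scal_zero_r.
rewrite rsum_recr //; apply: (is_RInt_ext (fun t => (\rsum_(m <= i < n) f i t) + f n t)).
  by move=> t _; rewrite rsum_recr.
apply: (@is_RInt_plus R_NormedModule); last by apply: H; rewrite ltnSn andbT.
by apply: IH => // i /andP[h1 h2]; apply: H; rewrite h1 ltnW.
Qed.

Lemma is_RInt_extR (f g : R -> R) (a b l : R) : (forall t, f t = g t) ->
  is_RInt f a b l -> is_RInt g a b l.
Proof. by move=> H; apply: is_RInt_ext => t _; exact: H. Qed.

Section Resonance.
Variables (T : R) (r : nat -> R).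
Hypothesis T1 : 1 <= T.
Hypothesis r0 : forall n, 0 <= r n.
Hypothesis r1 : r 1%N = 1.
Hypothesis rM : forall m n, (0 < m)%N -> (0 < n)%N -> r (m * n)%N = r m * r n.
Variable Sr : R.
Hypothesis rS : forall M, \rsum_(1 <= m < M.+1) r m <= Sr.

Let T0 : 0 < T. Proof. by lra. Qed.

(** The square |R(t)|^2 for R(t) = sum_(m <= M) r(m) m^(it). *)
Definition resonator_sq M t := \rsum_(1 <= m < M.+1) \rsum_(1 <= n < M.+1)
  (r m * r n * cos (t * (ln (INR m) - ln (INR n)))).
Definition quad_form M M' c := \rsum_(1 <= m < M.+1) \rsum_(1 <= n < M'.+1)
  (r m * r n * fejer T (c + (ln (INR m) - ln (INR n)))).
(** The integral of (1 - t/T) |R(t)|^2 over [0, T]. *)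
Definition energy M := quad_form M M 0.

Lemma resonator_sq_squares M t : resonator_sq M t =
  (\rsum_(1 <= m < M.+1) (r m * cos (t * ln (INR m)))) ^ 2 +
  (\rsum_(1 <= m < M.+1) (r m * sin (t * ln (INR m)))) ^ 2.
Proof.
rewrite /= !Rmult_1_r -!rsum_scalr -rsum_add; apply: eq_bigr => m _.
rewrite -!rsum_scal -rsum_add; apply: eq_bigr => n _.
by rewrite Rmult_minus_distr_l cos_minus; ring.
Qed.

Lemma resonator_sq_ge0 M t : 0 <= resonator_sq M t.
Proof. by rewrite resonator_sq_squares; apply: Rplus_le_le_0_compat; apply: pow2_ge_0. Qed.

Lemma Sr_ge0 : 0 <= Sr.
Proof. by apply: Rle_trans (rS 0); rewrite big_geq //; lra. Qed.

Lemma double_le M M' (c : nat -> nat -> R) B : 0 <= B -> (forall m n, c m n <= B) ->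
  \rsum_(1 <= m < M.+1) \rsum_(1 <= n < M'.+1) (r m * r n * c m n) <= Sr * Sr * B.
Proof.
move=> B0 H; have S0 := Sr_ge0.
apply: Rle_trans (_ : \rsum_(1 <= m < M.+1) (r m * (Sr * B)) <= _).
  apply: rsum_le => m _ _.
  apply: Rle_trans (_ : \rsum_(1 <= n < M'.+1) (r m * B * r n) <= _).
    apply: rsum_le => n _ _.
    by have := Rmult_le_compat_l _ _ _ (Rmult_le_pos _ _ (r0 m) (r0 n)) (H m n); lra.
  by rewrite rsum_scal; have := Rmult_le_compat_l _ _ _ (Rmult_le_pos _ _ (r0 m) B0) (rS M'); lra.
rewrite rsum_scalr Rmult_assoc; apply: Rmult_le_compat_r (rS M); exact: Rmult_le_pos.
Qed.

Lemma resonator_sq_le M t : resonator_sq M t <= Sr * Sr.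
Proof.
rewrite -[X in _ <= X]Rmult_1_r; apply: double_le; first lra.
by move=> m n; have := COS_bound (t * (ln (INR m) - ln (INR n))); lra.
Qed.

Lemma energy_le M : energy M <= Sr * Sr * (T / 2).
Proof. by apply: double_le; [lra|move=> m n; exact: fejer_le]. Qed.

Lemma quad_term_ge0 m n c : 0 <= r m * r n * fejer T c.
Proof. by apply: Rmult_le_pos; [exact: Rmult_le_pos|exact: fejer_ge0]. Qed.

Lemma energy_mono M M' : (M <= M')%N -> energy M <= energy M'.
Proof.
move=> h; apply: Rle_trans (_ : quad_form M M' 0 <= _).
  by apply: rsum_le => m _ _; apply: rsum_mono_range => // n _ _; exact: quad_term_ge0.
apply: rsum_mono_range => // m _ _; apply: rsum_ge0 => n _ _; exact: quad_term_ge0.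
Qed.

Lemma energy_ge M : (0 < M)%N -> T / 2 <= energy M.
Proof.
move=> h; apply: Rle_trans (energy_mono h); rewrite /energy /quad_form.
by rewrite rsum_recr // big_geq // rsum_recr // big_geq // r1 ln_1 Rminus_diag !Rplus_0_l
  fejer0; lra.
Qed.

Lemma energy_RInt M : is_RInt (fun t => (1 - t / T) * resonator_sq M t) 0 T (energy M).
Proof.
apply: (@is_RInt_extR (fun t => \rsum_(1 <= m < M.+1) \rsum_(1 <= n < M.+1)
   (r m * r n * ((1 - t / T) * cos ((0 + (ln (INR m) - ln (INR n))) * t))))).
  move=> t; rewrite -rsum_scal; apply: eq_bigr => m _.
  rewrite -rsum_scal; apply: eq_bigr => n _; rewrite Rplus_0_l [_ * t]Rmult_comm; ring.
apply: is_RInt_rsum => m _; apply: is_RInt_rsum => n _.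
by apply: (@is_RInt_scal R_NormedModule); exact: fejer_RInt.
Qed.

Variables (K : nat) (b : nat -> R).
Hypothesis K0 : (0 < K)%N.
Hypothesis b0 : forall k, 0 <= b k.
Definition cos_poly t := \rsum_(1 <= k < K.+1) (b k * cos (t * ln (INR k))).

Lemma quad_form_swap M c : \rsum_(1 <= m < M.+1) \rsum_(1 <= n < M.+1)
  (r m * r n * fejer T (c - (ln (INR m) - ln (INR n)))) = quad_form M M c.
Proof.
rewrite exchange_big; apply: eq_bigr => m _; apply: eq_bigr => n _.
by rewrite [r n * _]Rmult_comm; congr (_ * fejer T _); ring.
Qed.

Lemma cos_poly_RInt M : is_RInt (fun t => (1 - t / T) * (cos_poly t * resonator_sq M t)) 0 T
  (\rsum_(1 <= k < K.+1) (b k * quad_form M M (ln (INR k)))).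
Proof.
apply: (@is_RInt_extR (fun t => \rsum_(1 <= k < K.+1) (b k * (/ 2 *
   ((\rsum_(1 <= m < M.+1) \rsum_(1 <= n < M.+1)
   (r m * r n * ((1 - t / T) * cos ((ln (INR k) + (ln (INR m) - ln (INR n))) * t)))) +
   (\rsum_(1 <= m < M.+1) \rsum_(1 <= n < M.+1)
   (r m * r n * ((1 - t / T) * cos ((ln (INR k) - (ln (INR m) - ln (INR n))) * t))))))))).
  move=> t; rewrite /cos_poly -rsum_scalr -rsum_scal; apply: eq_bigr => k _.
  rewrite -rsum_add /resonator_sq -!rsum_scal; apply: eq_bigr => m _.
  rewrite -rsum_add -!rsum_scal; apply: eq_bigr => n _.
  have -> : (ln (INR k) + (ln (INR m) - ln (INR n))) * t =
    t * ln (INR k) + t * (ln (INR m) - ln (INR n)) by ring.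
  have -> : (ln (INR k) - (ln (INR m) - ln (INR n))) * t =
    t * ln (INR k) - t * (ln (INR m) - ln (INR n)) by ring.
  by rewrite cos_plus cos_minus; field; lra.
apply: is_RInt_rsum => k _; apply: (@is_RInt_scal R_NormedModule).
have -> : quad_form M M (ln (INR k)) = scal (/ 2) (plus (quad_form M M (ln (INR k)))
    (\rsum_(1 <= m < M.+1) \rsum_(1 <= n < M.+1)
      (r m * r n * fejer T (ln (INR k) - (ln (INR m) - ln (INR n)))))).
  by rewrite quad_form_swap /scal /plus /= /mult /=; field.
apply: (@is_RInt_scal R_NormedModule); apply: (@is_RInt_plus R_NormedModule);
  apply: is_RInt_rsum => m _; apply: is_RInt_rsum => n _;
  by apply: (@is_RInt_scal R_NormedModule); exact: fejer_RInt.
Qed.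

(** Only the pairs (m, k n) are kept, with m, n <= M / k: on them the frequency ln k
    cancels and r (k n) = r k * r n. *)
Lemma quad_form_ge M k : (0 < k)%N -> r k * energy (M %/ k) <= quad_form M M (ln (INR k)).
Proof.
move=> hk; rewrite /energy /quad_form -rsum_scal.
apply: Rle_trans (_ : \rsum_(1 <= m < (M %/ k).+1) \rsum_(1 <= n < M.+1)
   (r m * r n * fejer T (ln (INR k) + (ln (INR m) - ln (INR n)))) <= _); last first.
  apply: rsum_mono_range; first by rewrite ltnS leq_div.
  by move=> m _ _; apply: rsum_ge0 => n _ _; exact: quad_term_ge0.
apply: rsum_le => m _ _; rewrite -rsum_scal.
rewrite -(@rsum_dvd k M (fun n => r k * (r m * r n * fejer T (0 + (ln (INR m) - ln (INR n)))))) //.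
apply: rsum_le => n /andP[hn _] _; case: ifP => [/dvdnP[n' e]|_]; last exact: quad_term_ge0.
have hn' : (0 < n')%N by move: hn; rewrite e; case: n' {e}.
rewrite e mulnK // rM // INR_muln ln_mult; try exact: INR_gt0.
apply: Req_le; rewrite Rplus_0_l.
have -> : ln (INR k) + (ln (INR m) - (ln (INR n') + ln (INR k))) = ln (INR m) - ln (INR n') by ring.
ring.
Qed.

(** The energies along powers of K are bounded below and above, so they cannot grow
    by a fixed factor at every step.  This makes the loss from M to M / K negligible
    without computing any energy. *)
Lemma energy_pigeonhole eps : 0 < eps < 1 ->
  exists j, (1 - eps) * energy (K ^ j.+1) <= energy (K ^ j).
Proof.
move=> he; apply: Classical_Prop.NNPP => H.
have {}H j : energy (K ^ j) < (1 - eps) * energy (K ^ j.+1).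
  by apply: Rnot_le_lt => h; apply: H; exists j.
have e0 j : T / 2 <= energy (K ^ j) by apply: energy_ge; rewrite expn_gt0 K0.
have G j : (1 + INR j * eps) * (T / 2) <= energy (K ^ j).
  elim: j => [|j IH]; first by have := e0 0%N; rewrite /=; lra.
  have := H j; have := e0 j.+1; rewrite S_INR; have := pos_INR j => j0.
  have : 0 <= INR j * eps by nra.
  move=> h1 h2 h3.
  have h4 : energy (K ^ j) + eps * (T / 2) <= energy (K ^ j.+1) by nra.
  nra.
have [n Hn] := INR_unbounded (Sr * Sr / eps).
have := energy_le (K ^ n); have := G n; have S0 := Sr_ge0.
have : Sr * Sr < INR n * eps.
  have -> : Sr * Sr = Sr * Sr / eps * eps by field; lra.
  by apply: Rmult_lt_compat_r; lra.
nra.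
Qed.

Variables (V Lam : R).
Hypothesis V0 : 0 <= V.
Hypothesis dV : forall t, sqrt T <= t <= T -> cos_poly t <= V.
Hypothesis dL : forall t, cos_poly t <= Lam.

(** On [0, sqrt T], where nothing is known about F beyond F <= Lam, the factor
    exp (1 - t / sqrt T) >= 1 serves as a smooth majorant whose integral is at most
    3 sqrt T. *)
Lemma resonance eps : 0 < eps < 1 ->
  (1 - eps) * (\rsum_(1 <= k < K.+1) (b k * r k)) <= V + 6 * Lam * (Sr * Sr) / sqrt T.
Proof.
move=> he; have [j hj] := energy_pigeonhole he.
set M := (K ^ j.+1)%N in hj.
have M0 : (0 < M)%N by rewrite expn_gt0 K0.
have AM := energy_ge M0.
have sq0 : 0 < sqrt T by apply: sqrt_lt_R0.
have sq1 : sqrt T * sqrt T = T by apply: sqrt_sqrt; lra.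
have S0 := Sr_ge0.
have br0 : 0 <= \rsum_(1 <= k < K.+1) (b k * r k) by apply: rsum_ge0 => k _ _; exact: Rmult_le_pos.
have L0 : 0 <= Lam.
  apply: Rle_trans (dL 0); apply: rsum_ge0 => k _ _.
  by rewrite Rmult_0_l cos_0 Rmult_1_r.
(* Lower bound for the integral of F |R|^2: M %/ k >= K ^ j for every k <= K. *)
have low : (\rsum_(1 <= k < K.+1) (b k * r k)) * ((1 - eps) * energy M) <=
    \rsum_(1 <= k < K.+1) (b k * quad_form M M (ln (INR k))).
  apply: Rle_trans (Rmult_le_compat_l _ _ _ br0 hj) _.
  rewrite -rsum_scalr; apply: rsum_le => k /andP[k0 kK] _.
  rewrite Rmult_assoc; apply: Rmult_le_compat_l => //.
  apply: Rle_trans (quad_form_ge M k0); apply: Rmult_le_compat_l => //.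
  apply: energy_mono; rewrite leq_divRL // /M expnS mulnC leq_mul2r.
  by rewrite -ltnS kK orbT.
have eI : is_RInt (fun t => Lam * (Sr * Sr) * exp (1 - t / sqrt T)) 0 T
    (Lam * (Sr * Sr) * (sqrt T * exp 1 * (1 - exp (- sqrt T)))).
  apply: (@is_RInt_scal R_NormedModule).
  have -> : sqrt T * exp 1 * (1 - exp (- sqrt T)) =
     minus (- sqrt T * exp (1 - T / sqrt T)) (- sqrt T * exp (1 - 0 / sqrt T)).
    have -> : T / sqrt T = sqrt T by rewrite -{1}sq1; field; lra.
    rewrite /minus /plus /opp /= /Rdiv Rmult_0_l Rminus_0_r /Rminus exp_plus; ring.
  apply: (@is_RInt_derive _ (fun t => - sqrt T * exp (1 - t / sqrt T))) => t _.
    by auto_derive => //; rewrite /Rminus /Rdiv; field; lra.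
  by apply: (@ex_derive_continuous R_AbsRing R_NormedModule); auto_derive.
have up := is_RInt_le _ _ 0 T _ _ (Rlt_le _ _ T0) (@cos_poly_RInt M)
   (@is_RInt_plus R_NormedModule _ _ _ _ _ _ (@is_RInt_scal R_NormedModule _ _ _ V _
     (@energy_RInt M)) eI).
have {}up : \rsum_(1 <= k < K.+1) (b k * quad_form M M (ln (INR k))) <=
   V * energy M + Lam * (Sr * Sr) * (sqrt T * exp 1 * (1 - exp (- sqrt T))).
  apply: up => t ht; rewrite /plus /scal /= /mult /=.
  have q0 := resonator_sq_ge0 M t; have qS := resonator_sq_le M t.
  have w0 : 0 <= t / T by apply: Rmult_le_pos; [lra|apply: Rlt_le; apply: Rinv_0_lt_compat].
  have w1 : t / T <= 1 by apply: (Rmult_le_reg_r T) => //; rewrite /Rdiv Rmult_assoc Rinv_l; lra.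
  have SS0 : 0 <= Lam * (Sr * Sr) by apply: Rmult_le_pos => //; exact: Rmult_le_pos.
  have ex0 := exp_pos (1 - t / sqrt T).
  have wq0 : 0 <= (1 - t / T) * resonator_sq M t by apply: Rmult_le_pos; lra.
  have -> : (1 - t / T) * (cos_poly t * resonator_sq M t) = cos_poly t * ((1 - t / T) *
    resonator_sq M t) by ring.
  (* F <= V to the right of sqrt T; to its left only F <= Lam and |R|^2 <= Sr^2. *)
  case: (Rle_lt_dec (sqrt T) t) => hs.
    have := dV (conj hs (Rlt_le _ _ (proj2 ht))) => h.
    have := Rmult_le_compat_r _ _ _ wq0 h; have := Rmult_le_pos _ _ SS0 (Rlt_le _ _ ex0); lra.
  have h := Rmult_le_compat_r _ _ _ wq0 (dL t).
  have e1 : 1 <= exp (1 - t / sqrt T).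
    have := exp_ineq1_le (1 - t / sqrt T).
    have : t / sqrt T <= 1; last lra.
    by apply: (Rmult_le_reg_r (sqrt T)) => //; rewrite /Rdiv Rmult_assoc Rinv_l; lra.
  have h1 : (1 - t / T) * resonator_sq M t <= Sr * Sr by nra.
  have := Rmult_le_compat_l _ _ _ L0 h1; have := Rmult_le_pos _ _ V0 wq0; nra.
have e3 := exp_le_3; have em := exp_pos (- sqrt T); have ep := exp_pos 1.
set s := \rsum_(1 <= k < K.+1) (b k * r k) in low br0 *.
have SS0 : 0 <= Lam * (Sr * Sr) by apply: Rmult_le_pos => //; exact: Rmult_le_pos.
have h2 : s * ((1 - eps) * energy M) <= V * energy M + Lam * (Sr * Sr) * (sqrt T * 3).
  apply: Rle_trans low _; apply: Rle_trans up _; apply: Rplus_le_compat_l.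
  apply: Rmult_le_compat_l => //; rewrite Rmult_assoc; apply: Rmult_le_compat_l; first lra.
  nra.
apply: (Rmult_le_reg_r (energy M)); first lra.
have -> : (1 - eps) * s * energy M = s * ((1 - eps) * energy M) by ring.
apply: Rle_trans h2 _; rewrite Rmult_plus_distr_r; apply: Rplus_le_compat_l.
apply: Rle_trans (_ : 6 * Lam * (Sr * Sr) / sqrt T * (T / 2) <= _); last first.
  apply: Rmult_le_compat_l => //; apply: Rmult_le_pos; first by lra.
  by apply: Rlt_le; apply: Rinv_0_lt_compat.
have -> : T / 2 = sqrt T * sqrt T / 2 by rewrite sq1.
by apply: Req_le; field; lra.
Qed.
End Resonance.

(** * Choice of the resonator and conclusion *)

Definition res_coef q J p : R :=
  if [&& (p <= 2 ^ J)%N, prime p & ~~ (p %| q)] then 1 - INR p / 2 ^ J else 0.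

Lemma res_coef_admissible q J : admissible (res_coef q J) (2 ^ J).+1.
Proof.
have X0 : 0 < 2 ^ J by apply: pow_lt; lra.
split=> p; last by move=> hp; rewrite /res_coef leqNgt hp.
rewrite /res_coef; case: ifP => [/and3P[h1 h2 _]|_]; last lra.
have p2 := INR_prime_ge2 h2; have h := INR_leq h1; rewrite INR_pow2 in h.
have : 0 < INR p / 2 ^ J by apply: Rdiv_lt_0_compat; lra.
have : INR p / 2 ^ J <= 1; last lra.
by apply: (Rmult_le_reg_r (2 ^ J)) => //; rewrite /Rdiv Rmult_assoc Rinv_l; lra.
Qed.

(** The Euler factor at p is X/p. *)
Lemma euler_prod_res_coef q J : (0 < J)%N ->
  euler_prod (res_coef q J) (2 ^ J).+1 <= exp (64 * (2 ^ J / INR J)).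
Proof.
move=> hJ; have X0 : 0 < 2 ^ J by apply: pow_lt; lra.
apply: Rle_trans (exp_mono (sum_ln_ratio hJ)); rewrite -rprod_exp.
apply: (@rprod_le 0 (2 ^ J).+1 prime (fun p => / (1 - res_coef q J p)) _ _).2 => p /andP[_ hp] pp.
have [a1 a2] := (res_coef_admissible q J).1 p; split; first by apply: Rlt_le;
  apply: Rinv_0_lt_compat; lra.
have p2 := INR_prime_ge2 pp.
rewrite exp_ln; last by apply: Rdiv_lt_0_compat; lra.
rewrite /res_coef -ltnS hp pp /=; case: ifP => _.
  by apply: Req_le; field; lra.
rewrite Rminus_0_r Rinv_1.
have h := INR_leq hp; rewrite -[X in _ <= X](_ : 2 ^ J / INR p * INR p / INR p = _);
  last by field; lra.
have h' : INR p <= 2 ^ J by rewrite -INR_pow2; exact: INR_leq.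
apply: (Rmult_le_reg_r (INR p)); first lra.
have -> : 2 ^ J / INR p * INR p / INR p * INR p = 2 ^ J by field; lra.
lra.
Qed.

Lemma cmext_res_coef q J k : (0 < k)%N -> cmext (res_coef q J) k / INR k = cmext (res_weight q J) k.
Proof.
move=> hk; rewrite /Rdiv -(cmext_inv hk) -cmext_mul; apply: cmext_eq => // p hp _.
have p2 := INR_prime_ge2 hp; have X0 : 0 < 2 ^ J by apply: pow_lt; lra.
by rewrite /res_coef /res_weight; case: ifP => _; [field|ring]; lra.
Qed.

(** Rankin's trick with exponent 1: beyond K, r(k)/k is at most r(k)/K. *)
Lemma tsum_tail q a J K : (0 < K)%N ->
  tsum (res_weight q J) (residue q a) <=
    psum (res_weight q J) (residue q a) K + euler_prod (res_coef q J) (2 ^ J).+1 / INR K.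
Proof.
move=> hK; have K0 := INR_gt0 hK; have k0 := Rinv_0_lt_compat _ K0.
have c := psum_cv (res_weight_admissible q (leqnn J)) (residue_abs q a).
apply: (is_lim_seq_le_loc _ (fun=> psum (res_weight q J) (residue q a) K +
  euler_prod (res_coef q J) (2 ^ J).+1 / INR K)
  (Finite _) (Finite _) _ c (is_lim_seq_const _)).
exists K => M /leP hM; rewrite /psum (@rsum_cat 1 K.+1 M.+1) //.
apply: Rplus_le_compat_l; rewrite /Rdiv Rmult_comm.
apply: Rle_trans (Rmult_le_compat_l _ _ _ (Rlt_le _ _ k0) (psum1_le M (res_coef_admissible q J))).
have g0 k : 0 <= cmext (res_coef q J) k by apply: cmext_ge0 => p;
  case: ((res_coef_admissible q J).1 p).
rewrite /psum -rsum_scal (@rsum_cat 1 K.+1 M.+1) //.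
have : 0 <= \rsum_(1 <= k < K.+1) (/ INR K * (cmext (res_coef q J) k * 1)).
  by apply: rsum_ge0 => k _ _; have := g0 k; nra.
suff : \rsum_(K.+1 <= k < M.+1) (cmext (res_weight q J) k * residue q a k) <=
  \rsum_(K.+1 <= k < M.+1) (/ INR K * (cmext (res_coef q J) k * 1)) by lra.
apply: rsum_le => k /andP[hk _] _; have hk0 : (0 < k)%N by exact: leq_ltn_trans hk.
rewrite -cmext_res_coef // Rmult_1_r [/ INR K * _]Rmult_comm.
have h : / INR k <= / INR K by apply: Rinv_le_contravar => //; apply: INR_leq; exact: ltnW.
have kk := Rinv_0_lt_compat _ (INR_gt0 hk0).
have := INR_bool (k %% q == a); rewrite -/(residue q a k) => r01.
have := g0 k; move=> g; apply: Rle_trans (_ : cmext (res_coef q J) k / INR k <= _).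
  have : 0 <= cmext (res_coef q J) k / INR k by apply: Rmult_le_pos; lra.
  nra.
by apply: Rmult_le_compat_l.
Qed.

Lemma harm_le_ln n : harm n.+1 <= 1 + ln (INR n.+1).
Proof.
elim: n => [|n IH]; first by rewrite /harm rsum_recr // big_geq //= ln_1; lra.
rewrite harm_recr.
have n0 := @INR_gt0 n.+1 isT; have n1 := @INR_gt0 n.+2 isT.
have := @ln_le_sub1 (INR n.+1 / INR n.+2); rewrite ln_div // => h.
have := h (Rdiv_lt_0_compat _ _ n0 n1).
have -> : INR n.+1 / INR n.+2 - 1 = - / INR n.+2 by rewrite (S_INR n.+1); field; rewrite -S_INR;
  lra.
lra.
Qed.

Lemma sum_residue q a N (g : nat -> R) : (0 < a < q)%N ->
  \rsum_(0 <= n < N) g (n * q + a)%N = \rsum_(1 <= k < (N * q).+1) (residue q a k * g k).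
Proof.
move=> /andP[a0 aq]; elim: N => [|N IH]; first by rewrite mul0n !big_geq.
rewrite rsum_recr // IH (@rsum_cat 1 (N * q).+1 (N.+1 * q).+1) //;
  last by rewrite ltnS leq_mul2r leqnSn orbT.
congr (_ + _).
have m1 : (N * q + a < (N.+1 * q).+1)%N by rewrite mulSn; lia.
have m2 : (N * q < N * q + a)%N by rewrite -{1}[(N * q)%N]addn0 ltn_add2l.
rewrite (rsum_cat _ _ m2 (ltnW m1)) (@big_ltn _ _ _ (N * q + a)) //.
have Z m n : (forall k, (m <= k < n)%N ->
  (N * q < k)%N /\ (k <= N.+1 * q)%N /\ k <> (N * q + a)%N) ->
    \rsum_(m <= k < n) (residue q a k * g k) = 0.
  move=> H; rewrite big_nat_cond big1 // => k /andP[/H[h1 [h2 h3]] _].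
  rewrite /residue; case: eqP => [e|_] /=; last by ring.
  have hq : (0 < q)%N by exact: ltn_trans aq.
  case: h3; have e2 := divn_eq k q; rewrite e in e2; move: h1 h2.
  move: (k %/ q)%N e2 => d -> h1 h2; congr (_ * q + a)%N.
  have d1 : (d * q < N.+1 * q)%N by lia.
  have d2 : (N * q < d.+1 * q)%N by rewrite mulSn; lia.
  by move: d1 d2; rewrite !ltn_pmul2r //; lia.
rewrite !Z; first by rewrite /residue modnMDl modn_small // eqxx /=; ring.
  by move=> k /andP[h1 h2]; split; [|split]; lia.
by move=> k /andP[h1 h2]; split; [|split]; lia.
Qed.

Lemma exists_ceil T : 1 <= T -> exists N, T <= INR N <= 2 * T /\ (0 < N)%N.
Proof.
move=> hT; have [n [h1 h2]] := nfloor_ex T ltac:(lra).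
by exists n.+1; rewrite S_INR; split=> //; lra.
Qed.

Lemma exists_pow2 y : 1 <= y -> exists J, 2 ^ J <= y < 2 ^ J.+1.
Proof.
move=> hy; have [n Hn] := Pow_x_infinity 2 ltac:(rewrite Rabs_pos_eq; lra) y.
have {Hn}: y <= 2 ^ n.
  have := Hn n (le_n n); rewrite Rabs_pos_eq; [lra|apply: pow_le; lra].
elim: n => [|n IH] h; first by exists 0%N; rewrite /= in h *; lra.
case: (Rle_lt_dec y (2 ^ n)) => h'; first exact: IH.
case: (Rle_lt_dec (2 ^ n.+1) y) => h2; last by exists n; lra.
by exists n.+1; have := pow_lt 2 n Rlt_0_2; rewrite /= in h h2 *; lra.
Qed.

(** J is the integer part of the base 2 logarithm of L ln L / 1024, where L = ln T. *)
Lemma exists_cutoff L : 1024 <= ln L -> 0 < L -> exists J, (0 < J)%N /\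
  64 * (2 ^ J / INR J) <= L / 8 /\ ln L + ln (ln L) - ln 2048 <= INR J * ln 2.
Proof.
move=> hl L0; have l2 := ln2_gt0; have l1 := ln2_lt1.
have Ll : ln L <= L by have := ln_le_sub1 L0; lra.
have LL : 0 < L * ln L by apply: Rmult_lt_0_compat; lra.
pose y := L * ln L / 1024.
have y1 : 1 <= y by rewrite /y; nra.
have [J [h1 h2]] := exists_pow2 y1.
have ey : ln y = ln L + ln (ln L) - ln 1024 by rewrite /y ln_div ?ln_mult; lra.
have ll : ln 1024 <= ln (ln L) by apply: ln_le; lra.
have e2 : ln 2048 = ln 1024 + ln 2 by rewrite -ln_mult; [congr ln|..]; lra.
have hJ : ln y <= INR J.+1 * ln 2.
  by rewrite -ln_pow; [apply: ln_le|]; lra.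
rewrite S_INR in hJ.
have J1 : ln L / 2 <= INR J by have := pos_INR J; nra.
have J0 : 0 < INR J by lra.
exists J; split; first by case: J J0 {h1 h2 hJ J1} => //=; lra.
split; last by rewrite e2; lra.
apply: (Rmult_le_reg_r (INR J)) => //.
have -> : 64 * (2 ^ J / INR J) * INR J = 64 * 2 ^ J by field; lra.
apply: Rle_trans (_ : 64 * y <= _); first lra.
rewrite /y; nra.
Qed.

Lemma coprime_of_Zgcd (a q : Z) : (0 < a)%Z -> (0 < q)%Z -> Z.gcd a q = 1%Z ->
  coprime (Z.to_nat a) (Z.to_nat q).
Proof.
move=> ha hq h; set d := gcdn (Z.to_nat a) (Z.to_nat q).
have dv n : (0 < n)%Z -> d %| Z.to_nat n -> Z.divide (Z.of_nat d) n.
  by move=> hn /dvdnP[m e]; exists (Z.of_nat m); rewrite -{1}(Z2Nat.id n); [rewrite e; lia|lia].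
have := Z.gcd_greatest a q (Z.of_nat d) (dv a ha (dvdn_gcdl _ _)) (dv q hq (dvdn_gcdr _ _)).
rewrite h => /Z.divide_1_r_nonneg e; rewrite /coprime -/d; apply/eqP; have := e ltac:(lia); lia.
Qed.

(** The loss in the choice of J accounts for ln 2048, eps = 1/(J + 1) for ln 2, the
    tail beyond K and the error term of resonance for 2 q, and zeta_approx for 8. *)
Definition final_const q := exp euler_gamma * (ln 2048 + ln 2) + progression_const q +
  2 * INR q + 8.

Lemma progression_const_ge0 q : 0 <= progression_const q.
Proof.
have l2 := ln2_gt0; have g := exp_pos euler_gamma; have A := exp_pos distance_const;
  have q0 := pos_INR q.
have i0 := Rinv_0_lt_compat _ l2.
have cM0 : 0 <= mertens_const by rewrite /mertens_const; nra.
rewrite /progression_const; apply: Rplus_le_le_0_compat.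
  by apply: Rmult_le_pos; [nra|rewrite /euler_const; lra].
by apply: Rmult_le_pos => //; apply: Rmult_le_pos; nra.
Qed.

Lemma final_const_gt0 q : 0 < final_const q.
Proof.
have := progression_const_ge0 q; have l2 := ln2_gt0; have g := exp_pos euler_gamma;
  have q0 := pos_INR q.
have : 0 <= ln 2048 by apply: ln_ge0; lra.
rewrite /final_const; nra.
Qed.

Lemma hurwitz_cos_poly q a zeta t N : (0 < a < q)%N -> is_hurwitz_zeta (INR a / INR q) zeta ->
  1 <= t -> (2 <= N)%N -> t <= INR N ->
  INR q * cos_poly (N * q) (fun k => residue q a k / INR k) t - 8 <= Cmod (zeta (1, t)).
Proof.
move=> haq Hz ht hN htN; have /andP[a0 aq] := haq.
have a0' := INR_gt0 a0; have q0 : 0 < INR q by apply: INR_gt0; exact: ltn_trans aq.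
have al0 : 0 < INR a / INR q by exact: Rdiv_lt_0_compat.
have := zeta_approx (t * ln (INR q)) Hz al0 ht hN htN.
move=> h; apply: Rle_trans (Rle_trans _ _ _ h (Rle_trans _ _ _ (Rle_abs _) (rotated_re_le_Cmod _
  _))).
apply: Req_le; congr (_ - _); rewrite /cos_poly.
rewrite (eq_bigr (fun k => residue q a k * (cos (t * ln (INR k)) / INR k))); last by move=> k _;
  rewrite /Rdiv; ring.
rewrite -(sum_residue N (fun k => cos (t * ln (INR k)) / INR k) haq) -rsum_scal;
  apply: eq_bigr => k _.
have k0 := pos_INR k.
have e : INR (k * q + a) = INR q * (INR k + INR a / INR q).
  by rewrite INR_addn INR_muln; field; lra.
rewrite e ln_mult //; last lra.
rewrite -Rmult_plus_distr_l; field; split; nra.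
Qed.

Lemma cutoff_bound c L : 0 <= c -> 400 + c <= L ->
  6 * (c + L) * (exp (L / 8) * exp (L / 8)) / exp (L / 2) <= 1.
Proof.
move=> c0 hL; rewrite -exp_plus.
have e0 := exp_pos (L / 2).
have -> : exp (L / 2) = exp (L / 8 + L / 8) * (exp (L / 8) * exp (L / 8)).
  by rewrite -!exp_plus; congr exp; lra.
have e1 := exp_pos (L / 8 + L / 8); have e2 := exp_pos (L / 8).
have e3 := exp_ineq1_le (L / 8).
have -> : 6 * (c + L) * exp (L / 8 + L / 8) / (exp (L / 8 + L / 8) * (exp (L / 8) * exp (L / 8))) =
   6 * (c + L) / (exp (L / 8) * exp (L / 8)) by field; lra.
apply: (Rmult_le_reg_r (exp (L / 8) * exp (L / 8))); first nra.
rewrite /Rdiv Rmult_assoc Rinv_l; last nra.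
have : (1 + L / 8) * (1 + L / 8) <= exp (L / 8) * exp (L / 8) by apply: Rmult_le_compat; lra.
nra.
Qed.

(** With L = ln T, the sum of the coefficients of the resonator is at most exp (L/8), so
    the error term of resonance is at most
    6 (c + L) exp (L/4 - L/2), and eps = 1/(J + 1) changes e^gamma J ln 2 by O(1). *)
Lemma large_value q a zeta T M : (0 < a < q)%N -> coprime a q ->
  is_hurwitz_zeta (INR a / INR q) zeta ->
  exp (exp 1024 + 401 + ln (2 * INR q)) <= T ->
  (forall t, sqrt T <= t <= T -> Cmod (zeta (1, t)) <= M) ->
  exp euler_gamma * (log2 T + log3 T) - final_const q <= M.
Proof.
move=> haq hc Hz hT HM; have /andP[a0 aq] := haq.
have q1 : 1 <= INR q by apply: INR_ge1; exact: ltn_trans aq.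
set c := 1 + ln (2 * INR q).
have c0 : 0 <= c by rewrite /c; have := @ln_ge0 (2 * INR q) ltac:(lra); lra.
have T0 : 0 < T by apply: Rlt_le_trans hT; exact: exp_pos.
pose L := ln T.
have eT : T = exp L by rewrite /L exp_ln.
have hL : exp 1024 + 400 + c <= L.
  have -> : exp 1024 + 400 + c = ln (exp (exp 1024 + 401 +
    ln (2 * INR q))) by rewrite ln_exp /c; lra.
  by apply: ln_le => //; exact: exp_pos.
have E0 := exp_pos 1024.
have hl : 1024 <= ln L.
  by rewrite -(ln_exp 1024); apply: ln_le => //; lra.
have T1 : 1 <= T by rewrite eT -exp_0; apply: exp_mono; lra.
have T4 : 4 <= T by have := exp_ineq1_le L; rewrite -eT; lra.
have [J [J0 [hJ1 hJ2]]] := exists_cutoff hl ltac:(lra).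
have [N [[hN1 hN2] N0]] := exists_ceil T1.
have N2 : (2 <= N)%N.
  case: N N0 hN1 {hN2} => [|[|N]] //= _; lra.
have esq : sqrt T = exp (L / 2).
  apply: sqrt_lem_1; [lra|exact: Rlt_le (exp_pos _)|].
  by rewrite -exp_plus eT; congr exp; lra.
have sq1 : 1 <= sqrt T by rewrite esq -exp_0; apply: exp_mono; lra.
have K0 : (0 < N * q)%N by rewrite muln_gt0 N0; exact: ltn_trans aq.
pose b k := residue q a k / INR k.
have b0 k : 0 <= b k.
  have := INR_bool (k %% q == a); rewrite -/(residue q a k) => h.
  apply: Rmult_le_pos; first lra.
  case: k h => [|k] _; first by rewrite /= Rinv_0; lra.
  by apply: Rlt_le; apply: Rinv_0_lt_compat; exact: INR_gt0.
have sT := sqrt_sqrt T ltac:(lra).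
have M0 : 0 <= M by apply: Rle_trans (HM T _); [exact: Cmod_ge_0|split; [nra|lra]].
have dV t : sqrt T <= t <= T -> cos_poly (N * q) b t <= (M + 8) / INR q.
  move=> ht; have := @hurwitz_cos_poly q a zeta t N haq Hz ltac:(lra) N2 ltac:(lra).
  have := HM t ht => h1 h2; apply: (Rmult_le_reg_l (INR q)); first lra.
  have -> : INR q * ((M + 8) / INR q) = M + 8 by field; lra.
  by move: h2; rewrite -/b; lra.
have dL t : cos_poly (N * q) b t <= c + L.
  apply: Rle_trans (_ : harm (N * q) <= _).
    apply: rsum_le => k /andP[hk _] _.
    have := INR_bool (k %% q == a); rewrite -/(residue q a k) => h.
    have := COS_bound (t * ln (INR k)) => h'; have := b0 k.
    have := Rinv_0_lt_compat _ (INR_gt0 hk); rewrite /b /Rdiv; nra.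
  have := harm_le_ln (N * q).-1; rewrite prednK // => h; apply: Rle_trans h _.
  rewrite /c /L Rplus_assoc -ln_mult; try lra.
  apply: Rplus_le_compat_l; apply: ln_le; first exact: INR_gt0.
  by rewrite INR_muln; nra.
have rM m n : (0 < m)%N -> (0 < n)%N ->
  cmext (res_coef q J) (m * n)%N = cmext (res_coef q J) m * cmext (res_coef q J) n.
  exact: cmextM.
have r0 n : 0 <= cmext (res_coef q J) n by apply: cmext_ge0 => p;
  case: ((res_coef_admissible q J).1 p).
have rS X : \rsum_(1 <= m < X.+1) cmext (res_coef q J) m <= exp (L / 8).
  apply: Rle_trans (Rle_trans _ _ _ (euler_prod_res_coef q J0) (exp_mono hJ1)).
  apply: Rle_trans (psum1_le X (res_coef_admissible q J)); apply: Req_le; apply: eq_bigr => k _;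
    ring.
pose eps := / INR J.+1.
have J1 := INR_ge1 J0.
have he : 0 < eps < 1.
  rewrite /eps; split; first by apply: Rinv_0_lt_compat; exact: INR_gt0.
  by rewrite -Rinv_1; apply: Rinv_lt_contravar; rewrite S_INR; lra.
have V0 : 0 <= (M + 8) / INR q by apply: Rmult_le_pos; [lra|apply: Rlt_le;
  apply: Rinv_0_lt_compat; lra].
have := resonance T1 r0 (cmext1 _) rM rS K0 b0 V0 dV dL he.
have eb : \rsum_(1 <= k < (N * q).+1) (b k * cmext (res_coef q J) k) = psum (res_weight q J)
  (residue q a) (N * q).
  rewrite /psum big_nat_cond [RHS]big_nat_cond; apply: eq_bigr => k /andP[/andP[hk _] _].
  by rewrite -cmext_res_coef // /b /Rdiv; ring.
rewrite eb.
have -> : 6 * (c + L) * (exp (L / 8) * exp (L / 8)) / sqrt T =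
  6 * (c + L) * (exp (L / 8) * exp (L / 8)) / exp (L / 2) by rewrite esq.
have cb := @cutoff_bound c L c0 ltac:(lra).
have tl := tsum_tail q a J K0.
have tl1 : euler_prod (res_coef q J) (2 ^ J).+1 / INR (N * q) <= 1.
  have h1 : euler_prod (res_coef q J) (2 ^ J).+1 <= T.
    apply: Rle_trans (euler_prod_res_coef q J0) _; rewrite eT; apply: exp_mono; lra.
  have h2 : T <= INR (N * q) by rewrite INR_muln; nra.
  apply: (Rmult_le_reg_r (INR (N * q))); first exact: INR_gt0.
  rewrite /Rdiv Rmult_assoc Rinv_l; last by have := INR_gt0 K0; lra.
  lra.
have sp := smooth_progression aq hc J0.
set ts := tsum _ _ in tl sp; set ps := psum _ _ _ in tl *.
move=> hres; have {}hres : (1 - eps) * ps <= (M + 8) / INR q + 1 by lra.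
have hM : (1 - eps) * (INR q * ps) <= M + 8 + INR q.
  have := Rmult_le_compat_l (INR q) _ _ ltac:(lra) hres.
  have -> : INR q * ((M + 8) / INR q + 1) = M + 8 + INR q by field; lra.
  lra.
have g0 := exp_pos euler_gamma; have l2 := ln2_gt0; have P0 := progression_const_ge0 q.
have hps : exp euler_gamma * (INR J * ln 2) - progression_const q - INR q <= INR q * ps by nra.
have ej : eps * INR J <= 1.
  rewrite /eps S_INR; apply: (Rmult_le_reg_l (INR J + 1)); first lra.
  by rewrite -Rmult_assoc Rinv_r; lra.
have fin : exp euler_gamma * (INR J * ln 2) - exp euler_gamma * ln 2 - progression_const q - INR
  q <= (1 - eps) * (INR q * ps).
  apply: Rle_trans (Rmult_le_compat_l (1 - eps) _ _ ltac:(lra) hps).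
  have : eps * INR J * (exp euler_gamma * ln 2) <= 1 * (exp euler_gamma * ln 2).
    by apply: Rmult_le_compat_r => //; nra.
  have := pos_INR q; nra.
have : exp euler_gamma * (ln L + ln (ln L) - ln 2048) <= exp euler_gamma * (INR J * ln 2).
  by apply: Rmult_le_compat_l => //; lra.
rewrite /log2 /log3 -/L /final_const; lra.
Qed.

Theorem theorem1p3 :
  forall q : Z,
  exists Cq : R, 0 < Cq /\
  forall a : Z, (0 < a < q)%Z -> Z.gcd a q = 1%Z ->
  forall zeta : C -> C, is_hurwitz_zeta (IZR a / IZR q) zeta ->
  exists T0 : R, forall T : R, T0 <= T ->
  exists M : R,
    is_maximum
      (fun y : R => exists t : R,
         sqrt T <= t <= T /\ y = Cmod (zeta (RtoC 1 + Ci * RtoC t)%C)) M /\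
    M >= exp euler_gamma * (log2 T + log3 T) - Cq.
Proof.
move=> q; exists (final_const (Z.to_nat q)); split; first exact: final_const_gt0.
move=> a [a0 aq] hg zeta Hz.
have q0 : (0 < q)%Z by lia.
have Hz' : is_hurwitz_zeta (INR (Z.to_nat a) / INR (Z.to_nat q)) zeta.
  by rewrite !INR_IZR_INZ !Z2Nat.id //; lia.
exists (exp (exp 1024 + 401 + ln (2 * INR (Z.to_nat q)))) => T hT.
have T1 : 1 <= T.
  apply: Rle_trans hT; rewrite -[X in X <= _]exp_0; apply: exp_mono.
  have q1 : 1 <= INR (Z.to_nat q) by apply: INR_ge1; lia.
  have := @ln_ge0 (2 * INR (Z.to_nat q)) ltac:(lra); have := exp_pos 1024; lra.
have s1 : 1 <= sqrt T by rewrite -sqrt_1; exact: sqrt_le_1_alt.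
have s2 : sqrt T <= T by have := sqrt_sqrt T ltac:(lra); nra.
have [M HM] := zeta_max Hz (conj s1 s2).
exists M; split=> //; apply: Rle_ge.
apply: (large_value (a := Z.to_nat a) _ (coprime_of_Zgcd a0 q0 hg) Hz' hT); first by lia.
move=> t ht; apply: HM.2; exists t; split=> //.
by rewrite line_C.
Qed.
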